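(* Let $\mathbf D=(D;D_1,D_2;M)$ be a double vector bundle with core $D_3$, and let the special double affine bundle $\mathbf A=(A;A_1,A_2;M)$ be given in $\mathbf D$ by means of fibrewise non-zero linear functions $l_1,l_2$ on $D_1,D_2$ respectively (so that $A=\{x\in D:\tilde l_1(x)=1=\tilde l_2(x)\}$, $A_i=\{l_i=1\}\subset D_i$), with distinguished nowhere vanishing section $\sigma\in\mathrm{Sec}_M(D_3)$. Let $l_3$ be $\sigma$ considered as a linear function on $D_3^*$. Then the double affine bundle determined by the linear functions $l_1$ and $l_3$ in the vertical dual double vector bundle $(D^{*D_1};D_1,D_3^*;M)$ is canonically isomorphic to the double affine bundle $(A^{\#A_1};A_1,D_3^\ddagger;M)$. Moreover, $l_2$ is the distinguished section of the core bundle $D_2^*\to M$ of $D^{*D_1}$, which corresponds to $1_{A_2}\in\mathrm{Sec}_M(A_2^\dagger)$.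
   Context: All manifolds and maps are smooth, bundles have finite rank, and the base $M$ is connected. A double vector bundle $(D;D_1,D_2;M)$ is a commuting diagram of four vector bundles $\pi_1:D\to D_1$, $\pi_2:D\to D_2$, $D_1\to M$, $D_2\to M$ such that the homotheties of $D\to D_1$ and of $D\to D_2$ commute. Its core $D_3\to M$ is the vector bundle of points of $D$ projecting to the zero sections of both $D_1$ and $D_2$. For $d\in D_1$ over $m$, $(D_3)_m$ is identified with the kernel of $\pi_2$ on the fibre $D_d=\pi_1^{-1}(d)$ ($c\mapsto$ the sum in $D\to D_2$ of the zero of $D_d$ and $c$). The vertical dual is the double vector bundle $(D^{*D_1};D_1,D_3^*;M)$, where $D^{*D_1}\to D_1$ is the dual of the vector bundle $D\to D_1$; the projection to $D_3^*$ is restriction to the core, and the addition over $D_3^*$ is determined by $\langle\Phi+\Psi,x+_{D_2}y\rangle=\Phi(x)+\Psi(y)$ for $x,y$ in the same fibre of $D\to D_2$. Its core is $D_2^*$ ($\phi\in (D_2^* )_m$ corresponds to the functional $\phi\circ\pi_2$ on $D_{0_m}$). For a double vector bundle $\mathbf D$ and fibrewise non-zero linear functions $l_i$ on its side bundles $D_i$, the double affine bundle determined by $l_1,l_2$ is $\{x\in D:\tilde l_1(x)=1=\tilde l_2(x)\}$ over $\{l_1=1\}\subset D_1$ and $\{l_2=1\}\subset D_2$, with affine structures inherited from $\mathbf D$; $\tilde l_i$ is the pullback of $l_i$ along $D\to D_i$. (A double affine bundle $(A;A_1,A_2;M)$ is a commuting diagram of four affine bundles $\pi_1:A\to A_1,\pi_2:A\to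 A_2$, $\pi_1':A_2\to M$, $\pi_2':A_1\to M$ with: $\pi_1,\pi_2$ affine bundle morphisms for the other structures; $(\pi_1,\pi_2):A\to A_1\times_MA_2$ surjective; and fibrewise affine combinations $\mathrm{aff}_i(-,-;\lambda)$, weights $\lambda,1-\lambda$, for each structure $\pi_i$ being affine bundle morphisms for the other structure.) When $\mathbf A$ is given in $\mathbf D$ in this way, $\mathbf D$ is canonically the vector hull of $\mathbf A$, and the core of $\mathbf A$ is the core $D_3$ of $\mathbf D$. A special double affine bundle is a double affine bundle with a distinguished nowhere vanishing section $\sigma$ of its core. The fibres of $\pi_1:A\to A_1$ are affine subspaces of fibres $D_a$, $a\in A_1$, with model space containing $(D_3)_m\subset D_a$; hence $\sigma$ induces a nowhere vanishing section $\sigma_1$ of the model bundle of $\pi_1:A\to A_1$. The affine dual of an affine space $A$ with a distinguished non-zero vector $v_A\in\mathcal V(A)$ (model space) is $A^\#=\{f:A\to\mathbb R\text{ affine}: f^v(v_A)=1\}$, $f^v$ the linear part; it has distinguished vector the constant function $1_A$. $A^{\#A_1}\to A_1$ is the fibrewise affine dual of $(\pi_1:A\to A_1,\sigma_1)$. $D_3^\ddagger=\{\phi\in D_3^*:\phi(\sigma)=1\}$. $A_2^\dagger\to M$ is the vector bundle with fibres $\mathrm{Aff}((A_2)_m,\mathbb R)$ and $1_{A_2}$ is the constant function $1$; $A_2^\dagger\simeq D_2^*$ by restriction of linear functions on $D_2$ to $A_2$. The double affine bundle $(A^{\#A_1};A_1,D_3^\ddagger;M)$: the projection $A^{\#A_1}\to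 D_3^\ddagger$ sends $f$ on $\pi_1^{-1}(a)$ to the restriction of its linear part to $(D_3)_m$; for $f_1,f_2$ in the same fibre of it, lying over $a_1,a_1'\in A_1$, the affine combination with weights $\lambda,1-\lambda$ is the affine function $f$ on $\pi_1^{-1}(\lambda a_1+(1-\lambda)a_1')$ determined by $f(\mathrm{aff}_2(x,y;\lambda))=\lambda f_1(x)+(1-\lambda)f_2(y)$ for all $x\in\pi_1^{-1}(a_1)$, $y\in\pi_1^{-1}(a_1')$ with $\pi_2(x)=\pi_2(y)$. Its core is $A_2^\dagger$ with distinguished section $1_{A_2}$. *)

(* Defs.v *)
From HB Require Import structures.
From mathcomp Require Import all_boot all_order all_algebra.
From mathcomp Require Import all_classical all_reals all_analysis.
Import Order.TTheory GRing.Theory Num.Theory.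
Import numFieldNormedType.Exports.
Set Implicit Arguments.
Unset Strict Implicit.
Unset Printing Implicit Defensive.
Local Open Scope classical_set_scope.
Local Open Scope ring_scope.

Fixpoint Ck (R : realType) (k m n : nat) (U : set 'rV[R]_m)
    (f : 'rV[R]_m -> 'rV[R]_n) : Prop :=
  match k with
  | 0 => forall x, U x -> {for x, continuous f}
  | k'.+1 => (forall x, U x -> differentiable f x) /\
             (forall v : 'rV[R]_m, Ck k' U (fun x => 'D_v f x))
  end.

(* Only meaningful for U open. *)
Definition Csmooth (R : realType) (m n : nat) (U : set 'rV[R]_m)
  (f : 'rV[R]_m -> 'rV[R]_n) : Prop := forall k, Ck k U f.

(* A chart is a domain together with a coordinate map, whose values outside of
   the domain are irrelevant. *)
Definition chart (R : realType) (T : Type) (n : nat) : Type :=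
  (set T * (T -> 'rV[R]_n))%type.

(* Manifold data: a set of points [carrier] in an ambient type, and an atlas;
   the topology is the one induced by the charts.  The dimension of the charts
   is not fixed, which avoids casts between dimensions; it is locally constant
   by the compatibility of charts. *)
Record mfd (R : realType) := Mfd {
  pt :> Type ;
  carrier : set pt ;
  atlas : forall n : nat, set (chart R pt n) }.
Arguments carrier {R} m _.
Arguments atlas {R} m {n} _.

Section Manifolds.
Context {R : realType}.

Definition transition_smooth (T : Type) m n (c : chart R T m) (d : chart R T n) :=
  open (c.2 @` (c.1 `&` d.1)) /\
  exists h : 'rV[R]_m -> 'rV[R]_n,
    Csmooth (c.2 @` (c.1 `&` d.1)) h /\
    forall x, c.1 x -> d.1 x -> d.2 x = h (c.2 x).

(* Membership in the maximal atlas. *)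
Definition admissible (X : mfd R) n (c : chart R X n) : Prop :=
  [/\ c.1 `<=` carrier X, set_inj c.1 c.2, open (c.2 @` c.1) &
      forall m (d : chart R X m), atlas X d ->
        transition_smooth c d /\ transition_smooth d c].

Definition mopen (X : mfd R) (O : set X) : Prop :=
  O `<=` carrier X /\
  forall n (c : chart R X n), atlas X c -> open (c.2 @` (c.1 `&` O)).

Definition hausdorff_mfd (X : mfd R) : Prop :=
  forall x y : X, carrier X x -> carrier X y -> x <> y ->
  exists U V : set X, [/\ mopen U, mopen V, U x, V y & U `&` V = set0].

Definition second_countable_mfd (X : mfd R) : Prop :=
  exists B : nat -> set X, (forall i, mopen (B i)) /\
    forall (O : set X) x, mopen O -> O x -> exists i, B i x /\ B i `<=` O.

Definition is_manifold (X : mfd R) : Prop :=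
  [/\ forall x : X, carrier X x -> exists n (c : chart R X n), atlas X c /\ c.1 x,
      forall n (c : chart R X n), atlas X c -> admissible c,
      hausdorff_mfd X & second_countable_mfd X].

Definition connected_mfd (X : mfd R) : Prop :=
  forall U V : set X, mopen U -> mopen V -> U `&` V = set0 ->
    U `|` V = carrier X -> U = set0 \/ V = set0.

Definition smooth_on (X Y : mfd R) (O : set X) (f : X -> Y) : Prop :=
  forall x, carrier X x -> O x ->
  forall m (c : chart R X m), atlas X c -> c.1 x ->
  forall n (d : chart R Y n), atlas Y d -> d.1 (f x) ->
  exists (W : set 'rV[R]_m) (h : 'rV[R]_m -> 'rV[R]_n),
    [/\ open W, W (c.2 x), W `<=` c.2 @` c.1, Csmooth W h &
        forall y, c.1 y -> W (c.2 y) -> d.1 (f y) /\ d.2 (f y) = h (c.2 y)].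

Definition smooth_map (X Y : mfd R) (f : X -> Y) : Prop :=
  (forall x, carrier X x -> carrier Y (f x)) /\ smooth_on setT f.

Definition diffeo (X Y : mfd R) (f : X -> Y) : Prop :=
  smooth_map f /\
  exists g : Y -> X, [/\ smooth_map g,
    forall x, carrier X x -> g (f x) = x & forall y, carrier Y y -> f (g y) = y].

Inductive real_line_atlas : forall n, chart R R n -> Prop :=
  RealLineChart : @real_line_atlas 1 (setT, fun x => const_mx x).

Definition real_line : mfd R := @Mfd R R setT real_line_atlas.

(* The embedded submanifold of X on S: slice charts. *)
Inductive sub_atlas (X : mfd R) (S : set X) : forall k, chart R X k -> Prop :=
  SliceChart k q (d : chart R X (k + q)) :
    admissible d ->
    (forall x, d.1 x -> (S x <-> rsubmx (d.2 x) = 0)) ->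
    @sub_atlas X S k (d.1 `&` S, fun x => lsubmx (d.2 x)).

Definition sub_mfd (X : mfd R) (S : set X) : mfd R :=
  @Mfd R X (carrier X `&` S) (@sub_atlas X S).

(* The operations are total, but meaningful only within fibres. *)
Record vbstr (E B : mfd R) := VBStr {
  vpr : E -> B ;
  vadd : E -> E -> E ;
  vscl : R -> E -> E ;
  vzero : B -> E }.

Definition vfib (E B : mfd R) (V : vbstr E B) (b : B) : set E :=
  [set x | carrier E x /\ vpr V x = b].

(* The axioms of vector spaces for the fibres are transported from R^r by the
   fibrewise linear bijections h. *)
Definition is_vb (E B : mfd R) (V : vbstr E B) : Prop :=
  [/\ is_manifold E, is_manifold B, smooth_map (vpr V),
      forall b, carrier B b ->
        [/\ forall x y, vfib V b x -> vfib V b y -> vfib V b (vadd V x y),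
            forall t x, vfib V b x -> vfib V b (vscl V t x) &
            vfib V b (vzero V b)] &
      forall b0, carrier B b0 ->
      exists n r (c : chart R B n) (h : E -> 'rV[R]_r),
        [/\ admissible c, c.1 b0,
            @admissible E (n + r)
              ([set x | carrier E x /\ c.1 (vpr V x)],
               fun x => row_mx (c.2 (vpr V x)) (h x)) &
            forall b, c.1 b ->
            [/\ forall v, exists x, vfib V b x /\ h x = v,
                forall x y, vfib V b x -> vfib V b y ->
                  h (vadd V x y) = h x + h y,
                forall t x, vfib V b x -> h (vscl V t x) = t *: h x &
                h (vzero V b) = 0]]].

Definition linear_on (E B : mfd R) (V : vbstr E B) (b : B) (f : E -> R) : Prop :=
  (forall x y, vfib V b x -> vfib V b y -> f (vadd V x y) = f x + f y) /\
  (forall t x, vfib V b x -> f (vscl V t x) = t * f x).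

Definition nonzero_linear_fun (E B : mfd R) (V : vbstr E B) (l : E -> R) : Prop :=
  [/\ @smooth_map E real_line l,
      forall b, carrier B b -> linear_on V b l &
      forall b, carrier B b -> exists x, vfib V b x /\ l x <> 0].

Definition nonvanishing_section (E B : mfd R) (V : vbstr E B) (s : B -> E) : Prop :=
  smooth_map s /\
  forall b, carrier B b -> vpr V (s b) = b /\ s b <> vzero V b.

(* A function on the fibre over b is represented by the pair of b and its
   extension by 0 to the ambient type. *)
Definition ext0 (T : Type) (A : set T) (f : T -> R) : T -> R :=
  patch (fun=> 0) A f.

Definition dual_set (E B : mfd R) (V : vbstr E B) : set (B * (E -> R)) :=
  [set u | [/\ carrier B u.1, linear_on V u.1 u.2 &
               u.2 = ext0 (vfib V u.1) u.2]].

Definition smooth_frame (E B : mfd R) (V : vbstr E B) (U : set B) r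
    (e : 'I_r -> B -> E) : Prop :=
  (forall i, smooth_on U (e i)) /\
  forall b, U b ->
    (forall i, vfib V b (e i b)) /\
    forall x, vfib V b x ->
    exists! v : 'rV[R]_r,
      x = \big[vadd V / vzero V b]_(i < r) vscl V (v 0 i) (e i b).

Inductive dual_atlas (E B : mfd R) (V : vbstr E B) :
    forall n, chart R (B * (E -> R)) n -> Prop :=
  DualChart k r (c : chart R B k) (e : 'I_r -> B -> E) :
    admissible c -> smooth_frame V c.1 e ->
    @dual_atlas E B V (k + r)
      (dual_set V `&` [set u | c.1 u.1],
       fun u => row_mx (c.2 u.1) (\row_i u.2 (e i u.1))).

Definition dual_mfd (E B : mfd R) (V : vbstr E B) : mfd R :=
  @Mfd R (B * (E -> R)) (dual_set V) (@dual_atlas E B V).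

Definition dual_str (E B : mfd R) (V : vbstr E B) : vbstr (dual_mfd V) B :=
  @VBStr (dual_mfd V) B fst
    (fun u v => (u.1, fun x => u.2 x + v.2 x))
    (fun t u => (u.1, fun x => t * u.2 x))
    (fun b => (b, fun=> 0)).

Definition fiberwise_linear_bij (E E' B : mfd R) (V : vbstr E B)
    (V' : vbstr E' B) (f : E -> E') : Prop :=
  [/\ set_bij (carrier E) (carrier E') f,
      forall x, carrier E x -> vpr V' (f x) = vpr V x,
      forall x y, carrier E x -> carrier E y -> vpr V x = vpr V y ->
        f (vadd V x y) = vadd V' (f x) (f y) &
      forall t x, carrier E x -> f (vscl V t x) = vscl V' t (f x)].

(* [aff] t x y is the affine combination with weights t, 1 - t. *)
Record affstr (A B : mfd R) := AffStr {
  apr : A -> B ;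
  aff : R -> A -> A -> A }.

Definition afib (A B : mfd R) (P : affstr A B) (b : B) : set A :=
  [set x | carrier A x /\ apr P x = b].

Definition vb_aff (E B : mfd R) (V : vbstr E B) : affstr E B :=
  AffStr (vpr V) (fun t x y => vadd V (vscl V t x) (vscl V (1 - t) y)).

(* The structures inherited by subsets of the total space, respectively of the
   total space and of the base. *)
Definition sub_aff (A B : mfd R) (P : affstr A B) (S : set A) :
  affstr (sub_mfd S) B := @AffStr (sub_mfd S) B (apr P) (aff P).
Definition sub_aff2 (A B : mfd R) (P : affstr A B) (S : set A) (S' : set B) :
  affstr (sub_mfd S) (sub_mfd S') :=
  @AffStr (sub_mfd S) (sub_mfd S') (apr P) (aff P).

Definition affine_on (A B : mfd R) (P : affstr A B) (b : B) (f : A -> R) : Prop :=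
  forall t x y, afib P b x -> afib P b y ->
    f (aff P t x y) = t * f x + (1 - t) * f y.

Definition dagger_set (A B : mfd R) (P : affstr A B) : set (B * (A -> R)) :=
  [set u | [/\ carrier B u.1, affine_on P u.1 u.2 &
               u.2 = ext0 (afib P u.1) u.2]].

(* Points s_i b form an affine basis of the fibre iff affine functions are
   determined by their values at them, which are arbitrary. *)
Definition smooth_affine_frame (A B : mfd R) (P : affstr A B) (U : set B) r
    (s : 'I_r -> B -> A) : Prop :=
  (forall i, smooth_on U (s i)) /\
  forall b, U b ->
    (forall i, afib P b (s i b)) /\
    forall v : 'I_r -> R, exists! u : B * (A -> R),
      [/\ dagger_set P u, u.1 = b & forall i, u.2 (s i b) = v i].

Inductive dagger_atlas (A B : mfd R) (P : affstr A B) :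
    forall n, chart R (B * (A -> R)) n -> Prop :=
  DaggerChart k r (c : chart R B k) (s : 'I_r -> B -> A) :
    admissible c -> smooth_affine_frame P c.1 s ->
    @dagger_atlas A B P (k + r)
      (dagger_set P `&` [set u | c.1 u.1],
       fun u => row_mx (c.2 u.1) (\row_i u.2 (s i u.1))).

Definition dagger_mfd (A B : mfd R) (P : affstr A B) : mfd R :=
  @Mfd R (B * (A -> R)) (dagger_set P) (@dagger_atlas A B P).

Definition dagger_str (A B : mfd R) (P : affstr A B) : vbstr (dagger_mfd P) B :=
  @VBStr (dagger_mfd P) B fst
    (fun u v => (u.1, fun x => u.2 x + v.2 x))
    (fun t u => (u.1, fun x => t * u.2 x))
    (fun b => (b, fun=> 0)).

Definition dagger_one (A B : mfd R) (P : affstr A B) (b : B) : dagger_mfd P :=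
  (b, ext0 (afib P b) (fun=> 1)).

Record dvb := DVB {
  dtot : mfd R ; dside1 : mfd R ; dside2 : mfd R ; dbase : mfd R ;
  dstr1 : vbstr dtot dside1 ;
  dstr2 : vbstr dtot dside2 ;
  dstrS1 : vbstr dside1 dbase ;
  dstrS2 : vbstr dside2 dbase }.

(* The last condition says that the vector bundle structures of the sides are
   the ones induced from the total space. *)
Definition is_dvb (D : dvb) : Prop :=
  [/\ is_vb (dstr1 D) /\ is_vb (dstr2 D),
      is_vb (dstrS1 D) /\ is_vb (dstrS2 D),
      forall x, carrier (dtot D) x ->
        vpr (dstrS1 D) (vpr (dstr1 D) x) = vpr (dstrS2 D) (vpr (dstr2 D) x),
      forall s t x, carrier (dtot D) x ->
        vscl (dstr1 D) s (vscl (dstr2 D) t x) =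
        vscl (dstr2 D) t (vscl (dstr1 D) s x) &
      forall t x, carrier (dtot D) x ->
        vpr (dstr1 D) (vscl (dstr2 D) t x) =
          vscl (dstrS1 D) t (vpr (dstr1 D) x) /\
        vpr (dstr2 D) (vscl (dstr1 D) t x) =
          vscl (dstrS2 D) t (vpr (dstr2 D) x)].

Definition dpr (D : dvb) (x : dtot D) : dbase D :=
  vpr (dstrS1 D) (vpr (dstr1 D) x).

Definition core_set (D : dvb) : set (dtot D) :=
  [set x | vpr (dstr1 D) x = vzero (dstrS1 D) (dpr x) /\
           vpr (dstr2 D) x = vzero (dstrS2 D) (dpr x)].

Definition core (D : dvb) : mfd R := sub_mfd (@core_set D).

(* Both structures of the total space restrict to the same one on the core. *)
Definition core_str (D : dvb) : vbstr (core D) (dbase D) :=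
  @VBStr (core D) (dbase D) (@dpr D) (vadd (dstr1 D)) (vscl (dstr1 D))
    (fun m => vzero (dstr1 D) (vzero (dstrS1 D) m)).

(* The identification of (D_3)_m with the kernel of pi_2 on D_a. *)
Definition core_at (D : dvb) (a : dside1 D) (c : core D) : dtot D :=
  vadd (dstr2 D) (vzero (dstr1 D) a) c.

(* The element satisfying P when there is one, d otherwise. *)
Definition the (T : Type) (d : T) (P : T -> Prop) : T :=
  if pselect (exists x, P x) is left h then projT1 (cid h) else d.

Definition vdual_tot (D : dvb) : mfd R := dual_mfd (dstr1 D).
Definition vdual_side2 (D : dvb) : mfd R := dual_mfd (core_str D).

Definition vdual_pr2 (D : dvb) (u : vdual_tot D) : vdual_side2 D :=
  let m := vpr (dstrS1 D) u.1 in
  (m, ext0 (vfib (core_str D) m) (fun c => u.2 (core_at u.1 c))).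

Definition is_vdual_add (D : dvb) (u v w : vdual_tot D) : Prop :=
  [/\ carrier (vdual_tot D) w, w.1 = vadd (dstrS1 D) u.1 v.1 &
      forall x y, vfib (dstr1 D) u.1 x -> vfib (dstr1 D) v.1 y ->
        vpr (dstr2 D) x = vpr (dstr2 D) y ->
        w.2 (vadd (dstr2 D) x y) = u.2 x + v.2 y].

(* For t <> 0 the condition on the projection is redundant; for t = 0 it
   singles out the zero vector of the fibre containing u. *)
Definition is_vdual_scl (D : dvb) (t : R) (u w : vdual_tot D) : Prop :=
  [/\ carrier (vdual_tot D) w, w.1 = vscl (dstrS1 D) t u.1,
      vdual_pr2 w = vdual_pr2 u &
      forall x, vfib (dstr1 D) u.1 x ->
        w.2 (vscl (dstr2 D) t x) = t * u.2 x].

Definition is_vdual_zero (D : dvb) (k : vdual_side2 D) (w : vdual_tot D) : Prop :=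
  [/\ carrier (vdual_tot D) w, w.1 = vzero (dstrS1 D) k.1, vdual_pr2 w = k &
      forall b, vfib (dstrS2 D) k.1 b -> w.2 (vzero (dstr2 D) b) = 0].

Definition vdual_str2 (D : dvb) : vbstr (vdual_tot D) (vdual_side2 D) :=
  @VBStr (vdual_tot D) (vdual_side2 D) (@vdual_pr2 D)
    (fun u v => the (vadd (dstrS1 D) u.1 v.1, fun=> 0) (is_vdual_add u v))
    (fun t u => the (vscl (dstrS1 D) t u.1, fun=> 0) (is_vdual_scl t u))
    (fun k => the (vzero (dstrS1 D) k.1, fun=> 0) (is_vdual_zero k)).

Definition vdual (D : dvb) : dvb :=
  @DVB (vdual_tot D) (dside1 D) (vdual_side2 D) (dbase D)
    (dual_str (dstr1 D)) (vdual_str2 D) (dstrS1 D) (dual_str (core_str D)).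

(* The objects defined by means of [the] exist and are unique. *)
Definition vdual_well_defined (D : dvb) : Prop :=
  [/\ forall u v, carrier (vdual_tot D) u -> carrier (vdual_tot D) v ->
        vdual_pr2 u = vdual_pr2 v -> exists! w, is_vdual_add u v w,
      forall t u, carrier (vdual_tot D) u -> exists! w, is_vdual_scl t u w &
      forall k, carrier (vdual_side2 D) k -> exists! w, is_vdual_zero k w].

(* The functional phi \o pi_2 on D_{0_m}, for phi in the fibre of D_2^* at m. *)
Definition vdual_core_incl (D : dvb) (w : dual_mfd (dstrS2 D)) : core (vdual D) :=
  let z := vzero (dstrS1 D) w.1 in
  (z, ext0 (vfib (dstr1 D) z) (fun x => w.2 (vpr (dstr2 D) x))).

(* [acore], with [acorestr], is the core, a vector bundle over the base, and
   [atr] is the translation of points of the total space by elements of the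
   core over the same point of the base. *)
Record dab := DAB {
  atot : mfd R ; aside1 : mfd R ; aside2 : mfd R ; abase : mfd R ; acore : mfd R ;
  astr1 : affstr atot aside1 ;
  astr2 : affstr atot aside2 ;
  astrS1 : affstr aside1 abase ;
  astrS2 : affstr aside2 abase ;
  acorestr : vbstr acore abase ;
  atr : acore -> atot -> atot }.

Definition dab_of_dvb (D : dvb) (l1 : dside1 D -> R) (l2 : dside2 D -> R) : dab :=
  let A := [set x | l1 (vpr (dstr1 D) x) = 1 /\ l2 (vpr (dstr2 D) x) = 1] in
  let A1 := [set a | l1 a = 1] in
  let A2 := [set b | l2 b = 1] in
  @DAB (sub_mfd A) (sub_mfd A1) (sub_mfd A2) (dbase D) (core D)
    (sub_aff2 (vb_aff (dstr1 D)) A A1) (sub_aff2 (vb_aff (dstr2 D)) A A2)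
    (sub_aff (vb_aff (dstrS1 D)) A1) (sub_aff (vb_aff (dstrS2 D)) A2)
    (core_str D)
    (fun c x => vadd (dstr1 D) x (core_at (vpr (dstr1 D) x) c)).

Definition adual_set (A : dab) (sigma : abase A -> acore A) :
    set (dagger_mfd (astr1 A)) :=
  [set u | forall x, afib (astr1 A) u.1 x ->
     u.2 (atr (sigma (apr (astrS1 A) u.1)) x) = u.2 x + 1].

Definition adual_tot (A : dab) (sigma : abase A -> acore A) : mfd R :=
  sub_mfd (adual_set sigma).

Definition ddagger_set (A : dab) (sigma : abase A -> acore A) :
    set (dual_mfd (acorestr A)) := [set k | k.2 (sigma k.1) = 1].

Definition adual_side2 (A : dab) (sigma : abase A -> acore A) : mfd R :=
  sub_mfd (ddagger_set sigma).

(* k is the restriction of the linear part of u to the core. *)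
Definition is_adual_pr2 (A : dab) (sigma : abase A -> acore A)
    (u : adual_tot sigma) (k : adual_side2 sigma) : Prop :=
  [/\ carrier (adual_side2 sigma) k, k.1 = apr (astrS1 A) u.1 &
      forall x c, afib (astr1 A) u.1 x -> vfib (acorestr A) k.1 c ->
        u.2 (atr c x) = u.2 x + k.2 c].

Definition adual_pr2 (A : dab) (sigma : abase A -> acore A)
    (u : adual_tot sigma) : adual_side2 sigma :=
  the (apr (astrS1 A) u.1, fun=> 0) (is_adual_pr2 u).

Definition is_adual_aff2 (A : dab) (sigma : abase A -> acore A) (t : R)
    (u v w : adual_tot sigma) : Prop :=
  [/\ carrier (adual_tot sigma) w, w.1 = aff (astrS1 A) t u.1 v.1 &
      forall x y, afib (astr1 A) u.1 x -> afib (astr1 A) v.1 y ->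
        apr (astr2 A) x = apr (astr2 A) y ->
        w.2 (aff (astr2 A) t x y) = t * u.2 x + (1 - t) * v.2 y].

Definition adual_str2 (A : dab) (sigma : abase A -> acore A) :
    affstr (adual_tot sigma) (adual_side2 sigma) :=
  @AffStr (adual_tot sigma) (adual_side2 sigma) (@adual_pr2 A sigma)
    (fun t u v => the (aff (astrS1 A) t u.1 v.1, fun=> 0) (is_adual_aff2 t u v)).

(* The core A_2^dagger acts by g . f = f + g \o pi_2. *)
Definition adual (A : dab) (sigma : abase A -> acore A) : dab :=
  @DAB (adual_tot sigma) (aside1 A) (adual_side2 sigma) (abase A)
    (dagger_mfd (astrS2 A))
    (sub_aff (vb_aff (dagger_str (astr1 A))) (adual_set sigma))
    (adual_str2 sigma)
    (astrS1 A)
    (sub_aff (vb_aff (dual_str (acorestr A))) (ddagger_set sigma))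
    (dagger_str (astrS2 A))
    (fun g u => (u.1, ext0 (afib (astr1 A) u.1)
                           (fun x => u.2 x + g.2 (apr (astr2 A) x)))).

(* The objects defined by means of [the] exist and are unique. *)
Definition adual_well_defined (A : dab) (sigma : abase A -> acore A) : Prop :=
  (forall u, carrier (adual_tot sigma) u -> exists! k, is_adual_pr2 u k) /\
  (forall t u v, carrier (adual_tot sigma) u -> carrier (adual_tot sigma) v ->
     adual_pr2 u = adual_pr2 v -> exists! w, is_adual_aff2 t u v w).

Definition affine_morph (A A' B B' : mfd R) (P : affstr A B) (P' : affstr A' B')
    (f : A -> A') (g : B -> B') : Prop :=
  (forall x, carrier A x -> apr P' (f x) = g (apr P x)) /\
  (forall t x y, carrier A x -> carrier A y -> apr P x = apr P y ->
     f (aff P t x y) = aff P' t (f x) (f y)).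

Definition dab_iso (A B : dab) (F : atot A -> atot B)
    (F1 : aside1 A -> aside1 B) (F2 : aside2 A -> aside2 B)
    (F0 : abase A -> abase B) : Prop :=
  [/\ diffeo F /\ diffeo F1, diffeo F2 /\ diffeo F0,
      affine_morph (astr1 A) (astr1 B) F F1,
      affine_morph (astr2 A) (astr2 B) F F2 &
      affine_morph (astrS1 A) (astrS1 B) F1 F0 /\
      affine_morph (astrS2 A) (astrS2 B) F2 F0].

(* l_3, that is sigma as a linear function on D_3^* *)
Definition eval_section (D : dvb) (sigma : dbase D -> core D) :
    dside2 (vdual D) -> R := fun k => k.2 (sigma k.1).

(* A linear functional on D_a is sent to its restriction to A_a. *)
Definition restr_to_A (D : dvb) (l1 : dside1 D -> R) (l2 : dside2 D -> R)
    (sigma : dbase D -> core D)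
    (u : atot (@dab_of_dvb (vdual D) l1 (eval_section sigma))) :
    atot (@adual (dab_of_dvb l1 l2) sigma) :=
  (u.1, ext0 (afib (astr1 (dab_of_dvb l1 l2)) u.1) u.2).

(* The isomorphism from D_2^* to A_2^dagger *)
Definition restr_to_A2 (D : dvb) (l1 : dside1 D -> R) (l2 : dside2 D -> R)
    (w : dual_mfd (dstrS2 D)) : dagger_mfd (astrS2 (dab_of_dvb l1 l2)) :=
  (w.1, ext0 (afib (astrS2 (dab_of_dvb l1 l2)) w.1) w.2).

(* A function on D_2 as a map from M to D_2^* *)
Definition section_of_fun (D : dvb) (l2 : dside2 D -> R) (m : dbase D) :
    dual_mfd (dstrS2 D) :=
  (m, ext0 (vfib (dstrS2 D) m) l2).

End Manifolds.

Arguments vbstr {R} E B.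
Arguments dvb R : clear implicits.
Arguments dab R : clear implicits.

(* Main.v *)
(** A function that is homogeneous of degree 1 and differentiable at the origin
    is linear, so commutation of the homotheties makes the projections of a
    double vector bundle linear and gives the interchange law of the two
    additions.  The projection onto the fibre product of the sides is onto,
    since the rank of p1 on the fibre of D over t b does not depend on t <> 0
    and is maximal at t = 0.  Two points of D with the same projections differ
    by an element of the core; this makes the operations on functionals well
    defined.

    For a in A_1 the fibre A_a is an affine hyperplane of D_a that avoids the
    origin, so affine functions on A_a are the restrictions of linear functions
    on D_a, and the affine function has linear part 1 on sigma iff l_3 is 1.
    Restriction is smooth in both directions because, near a point of A_1, there
    is a frame of D over D_1 with values in A over A_1: it is both a linear
    frame of D_a and an affine frame of A_a, and in the corresponding charts
    restriction is the identity. *)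
Require Import Defs.
From mathcomp Require Import all_boot all_order all_algebra.
From mathcomp Require Import all_classical all_reals all_analysis.
From mathcomp Require Import ring.
Import Order.TTheory GRing.Theory Num.Theory.
Import numFieldNormedType.Exports.
Set Implicit Arguments.
Unset Strict Implicit.
Unset Printing Implicit Defensive.
Local Open Scope classical_set_scope.
Local Open Scope ring_scope.

(** * Smooth functions between coordinate spaces *)

(** The linear and affine duals, the core and the submanifolds cut out by linear functions are given
    here by atlases only: they are not shown to be manifolds, nor is the core known to be a vector
    bundle. Smoothness is therefore reduced to a local notion between two individual charts, [lsm],
    which assumes nothing about either, and two charts of such a space are compared through one
    injective chart of its atlas. Exhibiting such a chart around each point is what the frames are
    for. The operations of both duals are chosen by a specification, so existence and uniqueness
    precede every use. On the vertical dual they come from decompositions of vectors of D; on the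
    affine dual existence is transported along the restriction map, whose bijectivity involves only
    the underlying sets. *)

Section Calculus.
Context {R : realType}.

(** The difference [g - f] vanishes near [x], so its differential there is 0 by uniqueness of
    differentials, and [g = f + (g - f)]. *)
Lemma differentiable_near_eq (V W : normedModType R) (f g : V -> W) (x : V) :
  {near x, f =1 g} -> differentiable f x -> differentiable g x.
Proof.
move=> fg df.
suff dz : differentiable (g - f) x.
  rewrite (_ : g = f + (g - f)); first exact: differentiableD.
  by rewrite addrC subrK.
have e : (g - f) \o shift x = cst ((g - f) x) + \0 +o_ 0 id.
  apply/eqaddoP => eps eps0.
  have fgx : f x = g x by exact: nbhs_singleton fg.
  move: fg; rewrite (near_shift 0 x) => fg; near=> y.
  have fgy : f (y + x) = g (y + x).
    by near: y; apply: filterS fg => y /=; rewrite subr0.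
  have -> : ((g - f) \o shift x - (cst ((g - f) x) + \0)) y = 0.
    by rewrite !fctE [shift x y]/= fgx fgy !subrr !addr0 subrr.
  by rewrite normr0; apply: mulr_ge0; [exact: ltW|exact: normr_ge0].
have h := diff_unique (df := \0 : {linear V -> W}) _ e.
apply/diff_locallyP; rewrite h; first by split => // y; exact: cst_continuous.
by move=> y; exact: cst_continuous.
Unshelve. all: by end_near. Qed.

Lemma open_near (T : topologicalType) (U : set T) x : open U -> U x ->
  \forall y \near x, U y.
Proof. by move=> oU Ux; exact: open_nbhs_nbhs. Qed.

Lemma differentiable_rvP (V : normedModType R) n (f : V -> 'rV[R]_n) x :
  differentiable f x <-> forall j, differentiable (fun y => f y 0 j) x.
Proof.
split=> [df j|df].
  exact: (differentiable_comp df (differentiable_coord _ 0 j)).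
rewrite (_ : f = \sum_j (fun y => f y 0 j *: delta_mx 0 j)).
  by apply: differentiable_sum => j; exact: differentiableZl.
by apply/funext => y; rewrite fct_sumE -row_sum_delta.
Qed.

Section Scalar.
Context {m : nat}.
Implicit Types (f g : 'rV[R]_m -> R) (U W : set 'rV[R]_m).

(** The scalar counterpart of [Ck]: products, inverses and determinants are formed among real-valued
    functions, and [CkP] reduces a vector-valued map to its coordinates. *)
Fixpoint Cks (k : nat) U f : Prop :=
  match k with
  | 0 => forall x, U x -> {for x, continuous f}
  | k'.+1 => (forall x, U x -> differentiable f x) /\
             (forall v, Cks k' U (fun x => 'D_v f x))
  end.

Definition smoothR U f := forall k, Cks k U f.

Lemma Cks_sub k U W f : W `<=` U -> Cks k U f -> Cks k W f.
Proof.
move=> WU; elim: k f => [|k IH] f /=; first by move=> h x /WU; exact: h.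
by move=> [df h]; split => [x /WU|v]; [exact: df|exact/IH/h].
Qed.

Lemma Cks_local k U f : (forall x, U x -> exists2 W, W x & Cks k W f) ->
  Cks k U f.
Proof.
elim: k f => [|k IH] f /= h.
  by move=> x /h [W Wx]; apply.
split=> [x /h [W Wx [df _]]|v]; first exact: df.
by apply: IH => x /h [W Wx [_ dv]]; exists W.
Qed.

(** Derivatives at a point depend on a whole neighbourhood of it, hence the openness of [U]. *)
Lemma Cks_ext k U f g : open U -> (forall x, U x -> f x = g x) ->
  Cks k U f -> Cks k U g.
Proof.
move=> oU; elim: k f g => [|k IH] f g fg.
  move=> /= fc x Ux.
  have e : {near x, f =1 g} by apply: filterS (open_near oU Ux) => y; exact: fg.
  rewrite /prop_for /continuous_at -(fg x Ux).
  by apply: cvg_trans (fc x Ux); exact: (near_eq_cvg e).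
move=> [df dv]; split=> [x Ux|v].
  apply: differentiable_near_eq (df x Ux).
  by apply: filterS (open_near oU Ux) => y; exact: fg.
apply: IH (dv v) => x Ux; apply: near_eq_derive.
by apply: filterS (open_near oU Ux) => y; exact: fg.
Qed.

Lemma Cks_pred k U f : Cks k.+1 U f -> Cks k U f.
Proof.
elim: k f => [|k IH] f.
  by move=> [df _] x Ux; exact/differentiable_continuous/df.
by move=> [df dv]; split=> // v; exact/IH/dv.
Qed.

Lemma Cks_cst k U c : Cks k U (fun=> c).
Proof.
elim: k c => [|k IH] c /=; first by move=> x _; exact: (@cst_continuous _ _ c x).
split=> [x _|v]; first exact: differentiable_cst.
have -> : 'D_v (fun=> c) = (fun=> 0) :> ('rV[R]_m -> R).
  by apply/funext => x; exact: derive_cst.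
exact: IH.
Qed.

Lemma Cks_coord k U i : Cks k U (fun x => x 0 i).
Proof.
case: k => [|k] /=; first by move=> x _; exact: coord_continuous.
split=> [x _|v]; first exact: differentiable_coord.
have -> : 'D_v (fun x : 'rV[R]_m => x 0 i) = (fun=> v 0 i) :> ('rV[R]_m -> R).
  apply/funext => x.
  have := @derive_mx R 'rV[R]_m 1 m id x v (@derivable_id _ _ x v).
  by move=> /matrixP/(_ 0 i); rewrite derive_id !mxE => ->.
exact: Cks_cst.
Qed.

Lemma CksD k U f g : open U -> Cks k U f -> Cks k U g ->
  Cks k U (fun x => f x + g x).
Proof.
move=> oU; elim: k f g => [|k IH] f g.
  by move=> fc gc x Ux; apply: continuousD; [exact: fc|exact: gc].
move=> [df dvf] [dg dvg]; split=> [x Ux|v].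
  by apply: (differentiableD (f := f) (g := g)); [exact: df|exact: dg].
apply: Cks_ext (IH _ _ (dvf v) (dvg v)) => // x Ux.
by rewrite -deriveD//; apply: diff_derivable; [exact: df|exact: dg].
Qed.

Lemma CksM k U f g : open U -> Cks k U f -> Cks k U g ->
  Cks k U (fun x => f x * g x).
Proof.
move=> oU; elim: k f g => [|k IH] f g.
  by move=> fc gc x Ux; apply: (@continuousM R); [exact: fc|exact: gc].
move=> Cf Cg; move: (Cf) (Cg) => [df dvf] [dg dvg]; split=> [x Ux|v].
  by apply: (differentiableM (f := f) (g := g)); [exact: df|exact: dg].
apply: (@Cks_ext _ _ (fun x => f x * 'D_v g x + g x * 'D_v f x)) => //.
  by move=> x Ux; rewrite -deriveM//; apply: diff_derivable; [exact: df|exact: dg].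
by apply: CksD => //; apply: IH;
  [exact: Cks_pred|exact: dvg|exact: Cks_pred|exact: dvf].
Qed.

(** The derivative of [f^-1] is [- f^-2 f'], and [f^-1] has one order less by induction; the sign is
    written as a factor -1, so that closure under products suffices. *)
Lemma CksV k U f : open U -> (forall x, U x -> f x != 0) -> Cks k U f ->
  Cks k U (fun x => (f x)^-1).
Proof.
move=> oU f0; elim: k => [|k IH].
  by move=> fc x Ux; apply: continuousV; [exact: f0|exact: fc].
move=> Cf; move: (Cf) => [df dv]; split=> [x Ux|v].
  by apply: differentiableV; [exact: df|exact: f0].
have Cf' := IH (Cks_pred Cf).
apply: (@Cks_ext _ _ (fun x => -1 * (((f x)^-1 * (f x)^-1) * 'D_v f x))) => //.
  move=> x Ux; rewrite deriveV ?f0//; last exact/diff_derivable/df.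
  by rewrite mulN1r -mulNr expr2 invfM.
have C2 := CksM oU (CksM oU Cf' Cf') (dv v).
have C3 := CksM oU (@Cks_cst k U (-1)) C2.
exact: C3.
Qed.

Lemma Cks_sum k U (I : Type) (r : seq I) (P : pred I) (F : I -> 'rV[R]_m -> R) :
  open U -> (forall i, Cks k U (F i)) ->
  Cks k U (fun x => \sum_(i <- r | P i) F i x).
Proof.
move=> oU CF; elim: r => [|i r IH].
  rewrite (_ : (fun x => _) = fun=> 0); first exact: Cks_cst.
  by apply/funext => x; rewrite big_nil.
rewrite (_ : (fun x => _) = fun x => (if P i then F i x else 0) +
  \sum_(i <- r | P i) F i x).
  by apply: CksD => //; case: (P i) => //; exact: Cks_cst.
by apply/funext => x; rewrite big_cons; case: (P i); rewrite ?add0r.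
Qed.

End Scalar.

(** At order 0 the norm of a row is the maximum of its entries; at higher orders derivation commutes
    with taking a coordinate wherever [f] is differentiable. *)
Lemma CkP k m n (U : set 'rV[R]_m) (f : 'rV[R]_m -> 'rV[R]_n) : open U ->
  Ck k U f <-> forall j, Cks k U (fun x => f x 0 j).
Proof.
move=> oU; elim: k f => [|k IH] f.
  split=> [fc j x Ux|fc x Ux].
    apply: (@continuous_comp _ _ _ f (fun y : 'rV[R]_n => y 0 j)).
      exact: fc.
    exact: coord_continuous.
  suff : f y @[y --> x] --> f x by [].
  have FF : Filter (nbhs x) by exact: nbhs_filter.
  apply/(@cvgrPdist_le _ _ _ (nbhs x) FF) => /= e e0; near=> y.
  rewrite [leLHS]/Num.Def.normr/= mx_normrE (bigmax_le _ (ltW e0))//= => -[i j] _.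
  rewrite !mxE (ord1 i); move: j {i}; near: y; apply: filter_forall => j.
  have /cvgrPdist_le : f y 0 j @[y --> x] --> f x 0 j by exact: fc.
  exact.
have E : (forall x, U x -> differentiable f x) -> forall v j x, U x ->
    ('D_v f x) 0 j = 'D_v (fun y => f y 0 j) x.
  move=> df v j x Ux; rewrite (derive_mx (diff_derivable (df x Ux))).
  by rewrite mxE.
split.
- move=> [df dv] j; split=> [x Ux|v]; first exact: (differentiable_rvP f x).1 (df x Ux) j.
  have /IH := dv v; move=> /(_ j); apply: Cks_ext => // x Ux; exact: E.
- move=> h; have df x : U x -> differentiable f x.
    by move=> Ux; apply/differentiable_rvP => j; have [+ _] := h j; apply.
  split=> // v; apply/IH => j.
  have [_ /(_ v)] := h j; apply: Cks_ext => // x Ux; exact/esym/E.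
Unshelve. all: by end_near. Qed.

(** By the chain rule a derivative of [g \o f] is a sum of products of derivatives of the
    coordinates of [f] with partial derivatives of [g] along [f]; the induction hypothesis applies
    to the latter. *)
Lemma Cks_comp k m n (U : set 'rV[R]_m) (V : set 'rV[R]_n)
    (f : 'rV[R]_m -> 'rV[R]_n) (g : 'rV[R]_n -> R) : open U -> open V ->
  (forall x, U x -> V (f x)) -> (forall j, Cks k U (fun x => f x 0 j)) ->
  Cks k V g -> Cks k U (g \o f).
Proof.
move=> oU oV UV; elim: k g => [|k IH] g Cf Cg.
  move=> x Ux; apply: continuous_comp; last exact/Cg/UV.
  have : Ck 0 U f by apply/CkP.
  exact.
have df x : U x -> differentiable f x.
  by move=> Ux; apply/differentiable_rvP => j; have [+ _] := Cf j; apply.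
case: Cg => dg dvg; split=> [x Ux|v].
  by apply: differentiable_comp; [exact: df|exact/dg/UV].
apply: (@Cks_ext _ _ _ (fun x => \sum_j 'D_v (fun y => f y 0 j) x *
  'D_(delta_mx 0 j) g (f x))) => //.
  move=> x Ux; rewrite deriveE; last first.
    by apply: differentiable_comp; [exact: df|exact/dg/UV].
  rewrite diff_comp; [|exact: df|exact/dg/UV].
  rewrite /= -(deriveE v (df x Ux)).
  rewrite (derive_mx (diff_derivable (df x Ux))) [\matrix_(_, _) _]row_sum_delta.
  rewrite linear_sum; apply: eq_bigr => j _.
  by rewrite linearZ/= mxE -(deriveE _ (dg _ (UV _ Ux))).
apply: Cks_sum => // j; apply: CksM => //; first by have [_] := Cf j; apply.
apply: (IH (fun x => 'D_(delta_mx 0 j) g x)).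
  by move=> i; exact/Cks_pred/Cf.
exact: dvg.
Qed.

(** The difference quotients of [g] at 0 in the direction [v] are constantly [g v], so [g] coincides
    with its differential at 0. *)
Lemma homogeneous_additive (V W : normedModType R) (g : V -> W) :
  differentiable g 0 -> (forall t v, g (t *: v) = t *: g v) ->
  forall u v, g (u + v) = g u + g v.
Proof.
move=> dg hom.
suff E v : g v = 'd g 0 v by move=> u v; rewrite !E linearD.
rewrite -deriveE//; apply/esym/cvg_lim => //.
apply: cvg_near_cst; near=> h; rewrite /= addr0 hom.
have -> : g 0 = 0 by rewrite -(scale0r (0 : V)) hom scale0r.
rewrite subr0 scalerA mulVf ?scale1r//.
by near: h; exact: nbhs_dnbhs_neq.
Unshelve. all: by end_near. Qed.

Lemma CsmoothP m n (U : set 'rV[R]_m) (f : 'rV[R]_m -> 'rV[R]_n) : open U ->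
  Csmooth U f <-> forall j, smoothR U (fun x => f x 0 j).
Proof.
move=> oU; split=> [Cf j k|Cf k]; first exact: (CkP k f oU).1.
by apply/CkP => // j; exact: Cf.
Qed.

Lemma Csmooth_continuous m n (U : set 'rV[R]_m) (f : 'rV[R]_m -> 'rV[R]_n) x :
  Csmooth U f -> U x -> {for x, continuous f}.
Proof. by move=> /(_ 0) Cf /Cf. Qed.

Lemma Csmooth_preimage_open m n (U : set 'rV[R]_m) (V : set 'rV[R]_n)
    (f : 'rV[R]_m -> 'rV[R]_n) : open U -> open V -> Csmooth U f ->
  open (U `&` f @^-1` V).
Proof.
move=> oU oV Cf; rewrite openE => x [Ux Vfx]; apply: filterI.
  exact: open_nbhs_nbhs.
exact: (Csmooth_continuous Cf Ux) (open_nbhs_nbhs (conj oV Vfx)).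
Qed.

End Calculus.

(** * Local smoothness in charts *)

Section LocalSmoothness.
Context {R : realType}.

(* Charts are used here as mere pairs of a domain and a function: no condition
   is imposed on them, so that the domain may be cut down at will. *)
Definition lnear (T : Type) m (c : chart R T m) (P : T -> Prop) (x : T) : Prop :=
  \forall v \near c.2 x, forall y, c.1 y -> c.2 y = v -> P y.

(** The representative [h] lives on an open set [W] of coordinates that may exceed the image of the
    chart, so the notion is meaningful even when that image is not open. *)
Definition lsmR (T : Type) m (c : chart R T m) (f : T -> R) (x : T) : Prop :=
  exists W h, [/\ open W, W (c.2 x), @smoothR R m W h &
    forall y, c.1 y -> W (c.2 y) -> f y = h (c.2 y)].

Definition lsm (T T' : Type) m n (c : chart R T m) (d : chart R T' n)
    (f : T -> T') (x : T) : Prop :=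
  lnear c (fun y => d.1 (f y)) x /\ forall j, lsmR c (fun y => d.2 (f y) 0 j) x.

Section Source.
Context {T : Type} {m : nat}.
Implicit Types (c : chart R T m) (f g : T -> R) (x : T).

Lemma lnearP c P x : lnear c P x <->
  exists W, [/\ open W, W (c.2 x) & forall y, c.1 y -> W (c.2 y) -> P y].
Proof.
split=> [n|[W [oW Wx h]]].
  have : nbhs (c.2 x) [set v | forall y, c.1 y -> c.2 y = v -> P y] by [].
  rewrite nbhsE => -[W [oW Wx] h].
  by exists W; split=> // y cy Wy; exact: (h (c.2 y)).
apply: (@filterS _ _ _ W); first by move=> v Wv y cy yv; apply: h; rewrite ?yv.
exact: (open_near oW Wx).
Qed.

Lemma lnear_all c P x : (forall y, c.1 y -> P y) -> lnear c P x.
Proof. by move=> h; apply: filterS filterT => v _ y cy _; exact: h. Qed.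

Lemma lnear_and c P Q x : lnear c P x -> lnear c Q x ->
  lnear c (fun y => P y /\ Q y) x.
Proof. by apply: filterS2 => v hP hQ y cy yv; split; [exact: hP|exact: hQ]. Qed.

Lemma lnear_imp c P Q x : (forall y, c.1 y -> P y -> Q y) ->
  lnear c P x -> lnear c Q x.
Proof. by move=> PQ; apply: filterS => v h y cy yv; apply: PQ => //; exact: h. Qed.

Lemma lsmR_near c f g x : lnear c (fun y => f y = g y) x ->
  lsmR c g x -> lsmR c f x.
Proof.
move=> /lnearP[W [oW Wx fg]] [W' [h [oW' W'x sh gh]]].
exists (W `&` W'), h; split=> //; first exact: openI.
  by move=> k; apply: Cks_sub (sh k) => y [].
by move=> y cy [Wy W'y]; rewrite fg// gh.
Qed.

Lemma lsmR_ext c f g x : (forall y, c.1 y -> f y = g y) ->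
  lsmR c g x -> lsmR c f x.
Proof. by move=> fg; apply: lsmR_near; exact: lnear_all. Qed.

Lemma lsmR_cst c a x : lsmR c (fun=> a) x.
Proof.
by exists setT, (fun=> a); split=> //; [exact: openT|move=> k; exact: Cks_cst].
Qed.

Lemma lsmR_coord c j x : lsmR c (fun y => c.2 y 0 j) x.
Proof.
exists setT, (fun v => v 0 j); split=> //; first exact: openT.
by move=> k; exact: Cks_coord.
Qed.

Lemma lsmRD c f g x : lsmR c f x -> lsmR c g x -> lsmR c (fun y => f y + g y) x.
Proof.
move=> [W [h [oW Wx sh fh]]] [W' [h' [oW' W'x sh' gh]]].
have oI := openI oW oW'.
exists (W `&` W'), (fun v => h v + h' v); split=> //.
  by move=> k; apply: CksD => //; [apply: Cks_sub (sh k)|apply: Cks_sub (sh' k)]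
    => y [].
by move=> y cy [Wy W'y]; rewrite fh// gh.
Qed.

Lemma lsmRM c f g x : lsmR c f x -> lsmR c g x -> lsmR c (fun y => f y * g y) x.
Proof.
move=> [W [h [oW Wx sh fh]]] [W' [h' [oW' W'x sh' gh]]].
have oI := openI oW oW'.
exists (W `&` W'), (fun v => h v * h' v); split=> //.
  by move=> k; apply: CksM => //; [apply: Cks_sub (sh k)|apply: Cks_sub (sh' k)]
    => y [].
by move=> y cy [Wy W'y]; rewrite fh// gh.
Qed.

Lemma smoothR_neq0_open (W : set 'rV[R]_m) h : open W -> smoothR W h ->
  open (W `&` [set v | h v != 0]).
Proof.
move=> oW sh; rewrite openE => v [Wv hv]; apply: filterI.
  exact: (open_near oW Wv).
have hc : {for v, continuous h} by exact: (sh 0).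
have oN : open [set a : R | a != 0] by exact: open_neq.
exact: hc _ (open_nbhs_nbhs (conj oN hv)).
Qed.

Lemma lsmR_neq0 c f x : c.1 x -> lsmR c f x -> f x != 0 ->
  lnear c (fun y => f y != 0) x.
Proof.
move=> cx [W [h [oW Wx sh fh]]] fx; apply/lnearP.
exists (W `&` [set v | h v != 0]); split; first exact: smoothR_neq0_open.
  by split=> //=; rewrite -fh.
by move=> y cy [Wy hy]; rewrite fh.
Qed.

Lemma lsmRV c f x : c.1 x -> lsmR c f x -> f x != 0 ->
  lsmR c (fun y => (f y)^-1) x.
Proof.
move=> cx [W [h [oW Wx sh fh]]] fx.
exists (W `&` [set v | h v != 0]), (fun v => (h v)^-1).
have oI := smoothR_neq0_open oW sh.
split=> //; first by split=> //=; rewrite -fh.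
  move=> k; apply: CksV => //; first by move=> v [].
  by apply: Cks_sub (sh k) => v [].
by move=> y cy [Wy hy]; rewrite fh.
Qed.

Lemma lsmR_sum c (I : Type) (r : seq I) (P : pred I) (F : I -> T -> R) x :
  (forall i, lsmR c (F i) x) -> lsmR c (fun y => \sum_(i <- r | P i) F i y) x.
Proof.
move=> CF; elim: r => [|i r IH].
  by apply: lsmR_ext (lsmR_cst _ 0 _) => y _; rewrite big_nil.
apply: (@lsmR_ext _ _ (fun y => (if P i then F i y else 0) +
  \sum_(i <- r | P i) F i y)).
  by move=> y _; rewrite big_cons; case: (P i); rewrite ?add0r.
by apply: lsmRD => //; case: (P i) => //; exact: lsmR_cst.
Qed.

Lemma lsmR_prod c (I : Type) (r : seq I) (P : pred I) (F : I -> T -> R) x :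
  (forall i, lsmR c (F i) x) -> lsmR c (fun y => \prod_(i <- r | P i) F i y) x.
Proof.
move=> CF; elim: r => [|i r IH].
  by apply: lsmR_ext (lsmR_cst _ 1 _) => y _; rewrite big_nil.
apply: (@lsmR_ext _ _ (fun y => (if P i then F i y else 1) *
  \prod_(i <- r | P i) F i y)).
  by move=> y _; rewrite big_cons; case: (P i); rewrite ?mul1r.
by apply: lsmRM => //; case: (P i) => //; exact: lsmR_cst.
Qed.

Lemma lsmR_mulmx c p q r (A : T -> 'M[R]_(p, q)) (B : T -> 'M[R]_(q, r)) x i j :
  (forall i j, lsmR c (fun y => A y i j) x) ->
  (forall i j, lsmR c (fun y => B y i j) x) ->
  lsmR c (fun y => (A y *m B y) i j) x.
Proof.
move=> sA sB; apply: (@lsmR_ext _ _ (fun y => \sum_k A y i k * B y k j)).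
  by move=> y _; rewrite mxE.
by apply: lsmR_sum => k; exact: lsmRM.
Qed.

Lemma lsmR_det c n (A : T -> 'M[R]_n) x :
  (forall i j, lsmR c (fun y => A y i j) x) -> lsmR c (fun y => \det (A y)) x.
Proof.
move=> sA; apply: lsmR_sum => s; apply: lsmRM; first exact: lsmR_cst.
exact: lsmR_prod.
Qed.

(** Cramer's formula. It describes [invmx] only where the determinant is nonzero, since [invmx]
    leaves a singular matrix unchanged; near [x] the determinant stays nonzero. *)
Lemma lsmR_invmx c n (A : T -> 'M[R]_n) x : c.1 x ->
  (forall i j, lsmR c (fun y => A y i j) x) -> A x \in unitmx ->
  forall i j, lsmR c (fun y => invmx (A y) i j) x.
Proof.
move=> cx sA ux i j.
have dx : \det (A x) != 0 by rewrite -unitfE -unitmxE.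
apply: (@lsmR_near _ _ (fun y => (\det (A y))^-1 * \adj (A y) i j)).
  apply: lnear_imp (lsmR_neq0 cx (lsmR_det sA) dx) => y cy dy.
  by rewrite /invmx unitmxE unitfE dy mxE.
apply: lsmRM; first exact: (lsmRV cx (lsmR_det sA) dx).
apply: (@lsmR_ext _ _ (fun y => (-1) ^+ (j + i) * \det (row' j (col' i (A y))))).
  by move=> y _; rewrite mxE.
apply: lsmRM; first exact: lsmR_cst.
by apply: lsmR_det => k l; apply: lsmR_ext (sA (lift j k) (lift i l)) => y _;
  rewrite !mxE.
Qed.

Lemma lsmR_unitmx c n (A : T -> 'M[R]_n) x : c.1 x ->
  (forall i j, lsmR c (fun y => A y i j) x) -> A x \in unitmx ->
  lnear c (fun y => A y \in unitmx) x.
Proof.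
move=> cx sA; rewrite unitmxE unitfE => dx.
by apply: lnear_imp (lsmR_neq0 cx (lsmR_det sA) dx) => y cy; rewrite unitmxE unitfE.
Qed.

Lemma lsmR_res c c' f x : (forall y, c'.1 y -> c.1 y) -> c'.2 = c.2 ->
  lsmR c f x -> lsmR c' f x.
Proof.
case: c c' => [D p] [D' p'] /= sub -> [W [h [/= oW Wx sh fh]]].
by exists W, h; split=> //= y /sub; exact: fh.
Qed.

Lemma lnear_res c c' P x : (forall y, c'.1 y -> c.1 y) -> c'.2 = c.2 ->
  lnear c P x -> lnear c' P x.
Proof.
case: c c' => [D p] [D' p'] /= sub ->; apply: filterS => v /= h y /sub; exact: h.
Qed.

End Source.

(** The neighbourhoods belonging to the finitely many coordinates are intersected, which yields one
    representative for all of them. *)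
Lemma lsmP T T' m n (c : chart R T m) (d : chart R T' n) (f : T -> T') x :
  lsm c d f x <-> exists W h, [/\ open W, W (c.2 x), @Csmooth R m n W h &
    forall y, c.1 y -> W (c.2 y) -> d.1 (f y) /\ d.2 (f y) = h (c.2 y)].
Proof.
split=> [[/lnearP[W [oW Wx dW]] fs]|[W [h [oW Wx sh fh]]]].
  have [W' W'P] := choice fs; have [h hP] := choice W'P.
  have oI : open (W `&` [set v | forall j, W' j v]).
    rewrite openE => v [Wv W'v]; apply: filterI; first exact: (open_near oW Wv).
    have FF : Filter (nbhs v) by exact: nbhs_filter.
    apply: (filter_forall (f := fun j v => W' j v) FF) => j.
    by have [oW' _ _ _] := hP j; exact: (open_near oW' (W'v j)).
  exists (W `&` [set v | forall j, W' j v]), (fun v => \row_j h j v); split=> //.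
  - by split=> // j; have [_ ? _ _] := hP j.
  - apply/CsmoothP => // j k; have [_ _ sh _] := hP j.
    apply: (@Cks_ext _ _ _ _ (h j)) => //; first by move=> v _; rewrite mxE.
    by apply: Cks_sub (sh k) => v [_]; exact.
  - move=> y cy [Wy W'y]; split; first exact: dW.
    apply/rowP => j; rewrite mxE; have [_ _ _ ->//] := hP j; exact: W'y.
split; first by apply/lnearP; exists W; split=> // y cy /(fh y cy)[].
move=> j; exists W, (fun v => h v 0 j); split=> //.
  by move: j; exact: (CsmoothP _ oW).1.
by move=> y cy /(fh y cy)[_ ->].
Qed.

Lemma lnear_comp T T' m n (c : chart R T m) (d : chart R T' n) (f : T -> T') P x :
  c.1 x -> lsm c d f x -> lnear d P (f x) -> lnear c (fun y => P (f y)) x.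
Proof.
move=> cx /lsmP[W [h [oW Wx sh fh]]] /lnearP[V [oV Vx PV]]; apply/lnearP.
exists (W `&` h @^-1` V); split; first exact: Csmooth_preimage_open.
  by split=> //=; have [_ <-] := fh x cx Wx.
by move=> y cy [Wy /= Vy]; have [dy e] := fh y cy Wy; apply: PV => //; rewrite e.
Qed.

Lemma lsmR_comp T T' m n (c : chart R T m) (d : chart R T' n) (f : T -> T')
    (g : T' -> R) x :
  c.1 x -> lsm c d f x -> lsmR d g (f x) -> lsmR c (g \o f) x.
Proof.
move=> cx /lsmP[W [h [oW Wx sh fh]]] [V [l [oV Vx sl gl]]].
have oI := Csmooth_preimage_open oW oV sh.
exists (W `&` h @^-1` V), (l \o h); split=> //.
- by split=> //=; have [_ <-] := fh x cx Wx.
- move=> k; apply: (@Cks_comp _ _ _ _ _ V) => //; first by move=> v [].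
  move=> j; apply: (@Cks_sub _ _ _ W); first by move=> v [].
  by move: j k; exact: (CsmoothP _ oW).1.
- by move=> y cy [Wy /= Vy]; have [dy e] := fh y cy Wy; rewrite /= gl -?e // e. 
Qed.

Lemma lsm_comp T T' T'' m n p (c : chart R T m) (d : chart R T' n)
    (e : chart R T'' p) (f : T -> T') (g : T' -> T'') x :
  c.1 x -> lsm c d f x -> lsm d e g (f x) -> lsm c e (g \o f) x.
Proof.
move=> cx sf [ng sg]; split; first exact: (lnear_comp cx sf ng).
by move=> j; exact: (lsmR_comp cx sf (sg j)).
Qed.

Lemma lsm_near T T' m n (c : chart R T m) (d : chart R T' n) (f g : T -> T') x :
  lnear c (fun y => f y = g y) x -> lsm c d g x -> lsm c d f x.
Proof.
move=> fg [ng sg]; split.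
  by apply: (lnear_imp _ (lnear_and fg ng)) => y cy /= [->].
by move=> j; apply: lsmR_near (sg j); apply: lnear_imp fg => y cy ->.
Qed.

Lemma lsm_ext T T' m n (c : chart R T m) (d : chart R T' n) (f g : T -> T') x :
  (forall y, c.1 y -> f y = g y) -> lsm c d g x -> lsm c d f x.
Proof. by move=> fg; apply: lsm_near; exact: lnear_all. Qed.

Lemma lsm_res T T' m n (c c' : chart R T m) (d : chart R T' n) f x :
  (forall y, c'.1 y -> c.1 y) -> c'.2 = c.2 -> lsm c d f x -> lsm c' d f x.
Proof.
move=> sub e [nf sf]; split; first exact: lnear_res nf.
by move=> j; exact: lsmR_res (sf j).
Qed.

Lemma lsm_id T m (c : chart R T m) x : lsm c c id x.
Proof. by split; [exact: lnear_all|move=> j; exact: lsmR_coord]. Qed.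

End LocalSmoothness.

(** * Transitions, admissible charts and slice charts of submanifolds *)

Section Charts.
Context {R : realType}.

Definition chart_inj (T : Type) n (c : chart R T n) : Prop :=
  forall x y, c.1 x -> c.1 y -> c.2 x = c.2 y -> x = y.

Lemma set_injP (T : Type) n (c : chart R T n) : set_inj c.1 c.2 <-> chart_inj c.
Proof.
split=> [h x y cx cy|h x y]; first by apply: h; rewrite inE.
by rewrite !inE; exact: h.
Qed.

Lemma transition_lsm (T : Type) m n (c : chart R T m) (d : chart R T n) x :
  chart_inj c -> transition_smooth c d -> c.1 x -> d.1 x -> lsm c d id x.
Proof.
move=> ci [om [h [sh dh]]] cx dx; apply/lsmP.
exists (c.2 @` (c.1 `&` d.1))%classic, h; split=> //; first by exists x.
by move=> y cy [z [cz dz] /ci e]; rewrite -(e cz cy); split=> //; exact: dh.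
Qed.

Lemma lsm_open_meet (T : Type) m n (c : chart R T m) (d : chart R T n) :
  open (c.2 @` c.1) -> (forall x, c.1 x -> d.1 x -> lsm c d id x) ->
  open (c.2 @` (c.1 `&` d.1)).
Proof.
move=> oc cd; rewrite openE => _ [x [cx dx] <-].
have /lsmP[W [h [oW Wx _ fh]]] := cd x cx dx.
have Ix : (W `&` c.2 @` c.1) (c.2 x) by split=> //; exists x.
apply: filterS (open_near (openI oW oc) Ix) => v [Wv [y cy yv]].
exists y => //; split=> //.
by have [] := fh y cy; rewrite ?yv.
Qed.

Lemma smoothR_glue m (U : set 'rV[R]_m) f :
  (forall x, U x -> exists W h, [/\ open W, W x, smoothR W h &
     forall y, U y -> W y -> f y = h y]) -> open U -> smoothR U f.
Proof.
move=> h oU k; apply: Cks_local => x Ux.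
have [W [g [oW Wx sg fg]]] := h x Ux.
exists (U `&` W) => //; apply: (@Cks_ext _ _ _ _ g).
- exact: openI.
- by move=> y [Uy Wy]; rewrite fg.
- by apply: Cks_sub (sg k) => y [].
Qed.

(** A transition has to be given by one function on the whole overlap: injectivity of [c] makes its
    values well defined, and near each point they agree with a local representative. *)
Lemma lsm_transition (T : Type) m n (c : chart R T m) (d : chart R T n) :
  chart_inj c -> open (c.2 @` c.1) ->
  (forall x, c.1 x -> d.1 x -> lsm c d id x) -> transition_smooth c d.
Proof.
move=> ci oc cd; have oI := lsm_open_meet oc cd; split=> //.
have hex v : exists w, forall x, c.1 x -> d.1 x -> c.2 x = v -> d.2 x = w.
  have [[x [cx dx xv]]|nx] := pselect (exists x, [/\ c.1 x, d.1 x & c.2 x = v]).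
    by exists (d.2 x) => y cy dy yv; rewrite (ci x y) // xv yv.
  by exists 0 => x cx dx xv; case: nx; exists x.
have [h hP] := choice hex; exists h; split; last by move=> x cx dx; exact: (hP (c.2 x)).
apply/CsmoothP => // j; apply: smoothR_glue => // _ [x [cx dx] <-].
have [W [l [oW Wx sl fl]]] := (cd x cx dx).2 j; exists W, l; split=> //.
by move=> _ [y [cy dy] <-] Wy; rewrite -fl// (hP (c.2 y) y).
Qed.

Definition covered (X : mfd R) : Prop := forall x : X, carrier X x ->
  exists n (c : chart R X n), atlas X c /\ c.1 x.

Section Admissible.
Variable X : mfd R.
Implicit Types n m : nat.

Lemma admissible_sub n (c : chart R X n) x : admissible c -> c.1 x -> carrier X x.
Proof. by case=> + _ _ _; apply. Qed.

Lemma admissible_inj n (c : chart R X n) : admissible c -> chart_inj c.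
Proof. by case=> _ /set_injP. Qed.

Lemma admissible_open n (c : chart R X n) : admissible c -> open (c.2 @` c.1).
Proof. by case. Qed.

Lemma admissible_to_atlas n (c : chart R X n) m (d : chart R X m) x :
  admissible c -> atlas X d -> c.1 x -> d.1 x -> lsm c d id x.
Proof.
move=> [_ ci _ h] ad; have [t _] := h m d ad.
by apply: transition_lsm => //; exact/set_injP.
Qed.

Lemma atlas_to_admissible n (c : chart R X n) m (d : chart R X m) x :
  chart_inj d -> admissible c -> atlas X d -> c.1 x -> d.1 x -> lsm d c id x.
Proof.
move=> di [_ ci _ h] ad cx dx; have [_ t] := h m d ad.
exact: transition_lsm.
Qed.

(** For spaces not known to be manifolds. Admissibility is compatibility with the atlas only, so two
    admissible charts are compared through a chart [e] of the atlas; the way back from [e] needs its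
    injectivity. *)
Lemma admissible_lsm_via n (c : chart R X n) m (d : chart R X m)
    p (e : chart R X p) x :
  admissible c -> admissible d -> atlas X e -> chart_inj e ->
  c.1 x -> d.1 x -> e.1 x -> lsm c d id x.
Proof.
move=> ac ad ae ei cx dx ex.
exact: (lsm_comp cx (admissible_to_atlas ac ae cx ex)
  (atlas_to_admissible ei ad ae dx ex)).
Qed.

Hypothesis X_mfd : is_manifold X.

Lemma atlas_admissible n (c : chart R X n) : atlas X c -> admissible c.
Proof. by case: X_mfd => _ + _ _; apply. Qed.

Lemma manifold_covered : covered X.
Proof. by case: X_mfd. Qed.

Lemma admissible_lsm n (c : chart R X n) m (d : chart R X m) x :
  admissible c -> admissible d -> c.1 x -> d.1 x -> lsm c d id x.
Proof.
move=> ac ad cx dx.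
have [p [e [ae ex]]] := manifold_covered (admissible_sub ac cx).
exact: admissible_lsm_via (admissible_inj (atlas_admissible ae)) cx dx ex.
Qed.

(** One admissible chart around each point is enough, because the transitions to the charts of the
    atlas factor through it. *)
Lemma build_admissible n (c : chart R X n) : c.1 `<=` carrier X ->
  chart_inj c -> open (c.2 @` c.1) ->
  (forall x, c.1 x -> exists m (d : chart R X m),
     [/\ admissible d, d.1 x, lsm c d id x & lsm d c id x]) ->
  admissible c.
Proof.
move=> cX ci oc h; split=> //; first exact/set_injP.
move=> m d ad; have adm_d := atlas_admissible ad.
split; apply: lsm_transition => //.
- move=> x cx dx; have [p [e [ae ex ce _]]] := h x cx.
  exact: (lsm_comp cx ce (admissible_lsm ae adm_d ex dx)).
- exact: admissible_inj.
- exact: admissible_open.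
- move=> x dx cx; have [p [e [ae ex _ ec]]] := h x cx.
  exact: (lsm_comp dx (admissible_lsm adm_d ae dx ex) ec).
Qed.

End Admissible.

Lemma smooth_on_lsm (X Y : mfd R) (O : set X) (f : X -> Y) m (c : chart R X m)
    n (d : chart R Y n) x :
  is_manifold X -> is_manifold Y -> smooth_on O f ->
  admissible c -> admissible d -> c.1 x -> O x -> d.1 (f x) -> lsm c d f x.
Proof.
move=> mX mY sf ac ad cx Ox dfx; have Xx := admissible_sub ac cx.
have [p [e [ae ex]]] := manifold_covered mX Xx.
have [q [l [al lx]]] := manifold_covered mY (admissible_sub ad dfx).
have elf : lsm e l f x.
  have [W [h [oW Wx _ sh fh]]] := sf x Xx Ox p e ae ex q l al lx.
  by apply/lsmP; exists W, h.
have ae' := atlas_admissible mX ae; have al' := atlas_admissible mY al.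
apply: (lsm_comp cx (admissible_lsm mX ac ae' cx ex)).
exact: (lsm_comp ex elf (admissible_lsm mY al' ad lx dfx)).
Qed.

(** Openness of the image is asked for because [smooth_on] wants its neighbourhood inside the image
    of the source chart. *)
Lemma lsm_smooth_on (X Y : mfd R) (O : set X) (f : X -> Y) :
  (forall x, carrier X x -> O x -> forall m (c : chart R X m), atlas X c -> c.1 x ->
     open (c.2 @` c.1) /\
     forall n (d : chart R Y n), atlas Y d -> d.1 (f x) -> lsm c d f x) ->
  smooth_on O f.
Proof.
move=> h x Xx Ox m c ac cx n d ad dfx.
have [oc /(_ n d ad dfx) /lsmP[W [l [oW Wx sl fl]]]] := h x Xx Ox m c ac cx.
exists (W `&` c.2 @` c.1), l; split=> //.
- exact: openI.
- by apply/CsmoothP; [exact: openI|move=> j k];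
    apply: (@Cks_sub _ _ _ W) => [v []//|]; exact: (CsmoothP _ oW).1.
- by move=> y cy [Wy _]; exact: fl.
Qed.

Lemma manifold_smooth_on (X Y : mfd R) (O : set X) (f : X -> Y) :
  is_manifold X ->
  (forall x, carrier X x -> O x -> forall m (c : chart R X m), admissible c -> c.1 x ->
     forall n (d : chart R Y n), atlas Y d -> d.1 (f x) -> lsm c d f x) ->
  smooth_on O f.
Proof.
move=> mX h; apply: lsm_smooth_on => x Xx Ox m c ac cx.
have ac' := atlas_admissible mX ac; split; first exact: admissible_open.
by move=> n d ad; exact: h.
Qed.

Section Slices.
Context {T : Type} (S : set T) {k q : nat}.
Implicit Types d : chart R T (k + q).

Definition is_slice d : Prop := forall x, d.1 x -> (S x <-> rsubmx (d.2 x) = 0).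

Definition slice d : chart R T k := (d.1 `&` S, fun x => lsubmx (d.2 x)).

Lemma lsm_row_mx U m (c : chart R U m) p p' (f : U -> 'rV[R]_p) (g : U -> 'rV[R]_p') x :
  (forall j, lsmR c (fun y => f y 0 j) x) -> (forall j, lsmR c (fun y => g y 0 j) x) ->
  forall j, lsmR c (fun y => (row_mx (f y) (g y)) 0 j) x.
Proof.
move=> sf sg j; case: (split_ordP j) => i ->.
  by apply: lsmR_ext (sf i) => y _; rewrite row_mxEl.
by apply: lsmR_ext (sg i) => y _; rewrite row_mxEr.
Qed.

Lemma slice_coordE d x : is_slice d -> (slice d).1 x ->
  d.2 x = row_mx ((slice d).2 x) 0.
Proof. by move=> sd [dx /(sd x dx) e]; rewrite -e hsubmxK. Qed.

(** In a slice chart the inclusion of the submanifold reads [v |-> (v, 0)]. *)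
Lemma lsm_slice_source d x : is_slice d -> lsm (slice d) d id x.
Proof.
move=> sd; split; first by apply: lnear_all => y [].
move=> j; apply: (@lsmR_ext _ _ _ _ _
  (fun y => (row_mx ((slice d).2 y) (0 : 'rV_q)) 0 j)).
  by move=> y sy; rewrite (slice_coordE sd sy).
apply: lsm_row_mx => i; first exact: lsmR_coord.
by apply: lsmR_ext (lsmR_cst _ 0 _) => y _; rewrite mxE.
Qed.

(** The coordinates in the slice are the first [k] coordinates in the ambient chart. *)
Lemma lsm_slice_target U m (c : chart R U m) d (f : U -> T) x :
  lnear c (fun y => S (f y)) x -> lsm c d f x -> lsm c (slice d) f x.
Proof.
move=> Sf [nf sf]; split; first exact: lnear_and.
by move=> j; apply: lsmR_ext (sf (lshift q j)) => y _; rewrite mxE.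
Qed.

Lemma slice_inj d : is_slice d -> chart_inj d -> chart_inj (slice d).
Proof.
move=> sd di x y sx sy e; apply: di; [exact: sx.1|exact: sy.1|].
by rewrite (slice_coordE sd sx) (slice_coordE sd sy) e.
Qed.

Lemma slice_open d : is_slice d -> open (d.2 @` d.1) ->
  open ((slice d).2 @` (slice d).1).
Proof.
move=> sd od.
(* The points of the slice are those of the domain of [d] whose last coordinates vanish, so the
   image is the preimage of an open set under [v |-> (v, 0)]. *)
have -> : (slice d).2 @` (slice d).1 =
    setT `&` (fun v : 'rV[R]_k => row_mx v (0 : 'rV_q)) @^-1` (d.2 @` d.1).
  apply/seteqP; split=> [_ [x sx <-]|v [_ [x dx e]]].
    by split=> //; exists x; [exact: sx.1|exact: slice_coordE].
  exists x; last by rewrite /= e row_mxKl.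
  by split=> //; apply/(sd x dx); rewrite e row_mxKr.
apply: Csmooth_preimage_open => //; first exact: openT.
apply/CsmoothP; first exact: openT.
move=> j n; case: (split_ordP j) => i ->.
  apply: (@Cks_ext _ _ _ _ (fun v => v 0 i)); first exact: openT.
    by move=> v _; rewrite row_mxEl.
  exact: Cks_coord.
apply: (@Cks_ext _ _ _ _ (fun=> 0)); first exact: openT.
  by move=> v _; rewrite row_mxEr mxE.
exact: Cks_cst.
Qed.

End Slices.

Lemma sub_smooth_on (X Y : mfd R) (S : set X) (O : set X) (f : X -> Y) :
  (forall x, carrier X x -> S x -> O x ->
     forall k q (d : chart R X (k + q)), admissible d -> is_slice S d -> d.1 x ->
     forall n (e : chart R Y n), atlas Y e -> e.1 (f x) -> lsm (slice S d) e f x) ->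
  @smooth_on R (sub_mfd S) Y O f.
Proof.
move=> h; apply: lsm_smooth_on => x [Xx Sx] Ox m c ac.
case: m c / ac => k q d ad sd [dx _]; split.
  exact: slice_open (admissible_open ad).
by move=> n e ae ex; exact: h.
Qed.

(** Makes slice charts eligible as base charts for bundles over the submanifold, in particular for
    the charts of [dagger_mfd] over A_1. *)
Lemma slice_admissible (X : mfd R) (S : set X) k q (d : chart R X (k + q)) :
  is_manifold X -> admissible d -> is_slice S d ->
  @admissible R (sub_mfd S) k (slice S d).
Proof.
move=> mX ad sd; split.
- by move=> x [dx Sx]; split=> //; exact: admissible_sub dx.
- apply/set_injP; apply: slice_inj => //; exact: admissible_inj ad.
- by apply: slice_open => //; exact: admissible_open ad.
move=> m c ac; case: m c / ac => k' q' d' ad' sd'.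
have tr j j' (e : chart R X (j + j')) i i' (l : chart R X (i + i')) :
    admissible e -> is_slice S e -> admissible l ->
    transition_smooth (slice S e) (slice S l).
  move=> ae se al; apply: lsm_transition.
  - exact/slice_inj/admissible_inj.
  - exact/slice_open/admissible_open.
  - move=> x [ex Sx] [lx _]; apply: lsm_slice_target; first by apply: lnear_all => y [].
    by apply: lsm_comp (lsm_slice_source _ se) (admissible_lsm mX ae al ex lx).
by split; exact: tr.
Qed.

Definition rchart : chart R R 1 := (setT, fun x => const_mx x).

Lemma lsm_rchart T m (c : chart R T m) (f : T -> R) x : lsm c rchart f x <-> lsmR c f x.
Proof.
split=> [[_ /(_ 0)]|sf]; first by apply: lsmR_ext => y _; rewrite mxE.
split; first exact: lnear_all.
by move=> j; apply: lsmR_ext sf => y _; rewrite mxE.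
Qed.

Lemma smooth_fun_lsmR (X : mfd R) (f : X -> R) m (c : chart R X m) x :
  is_manifold X -> @smooth_map R X real_line f -> admissible c -> c.1 x ->
  lsmR c f x.
Proof.
move=> mX [_ sf] ac cx; apply/lsm_rchart; have Xx := admissible_sub ac cx.
have [p [e [ae ex]]] := manifold_covered mX Xx.
apply: (lsm_comp cx (admissible_lsm mX ac (atlas_admissible mX ae) cx ex)).
have [W [h [oW Wx _ sh fh]]] := sf x Xx I p e ae ex 1%N rchart RealLineChart I.
by apply/lsmP; exists W, h.
Qed.

Lemma smooth_on_smooth_fun (X Y : mfd R) (O : set X) (f : X -> Y) (l : Y -> R)
  m (c : chart R X m) x :
  is_manifold X -> is_manifold Y -> smooth_on O f -> carrier Y (f x) ->
  @smooth_map R Y real_line l -> admissible c -> c.1 x -> O x ->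
  lsmR c (l \o f) x.
Proof.
move=> mX mY sf Yfx sl ac cx Ox.
have [p [e [ae ex]]] := manifold_covered mY Yfx.
have ae' := atlas_admissible mY ae.
exact: (lsmR_comp cx (smooth_on_lsm mX mY sf ac ae' cx Ox ex)
  (smooth_fun_lsmR mY sl ae' ex)).
Qed.

End Charts.

(** Zero is not isolated in the line, so a condition that holds near 0 holds for some scalar by
    which one may divide. *)
Lemma lnear_rchart_neq0 (R : realType) (P : R -> Prop) :
  lnear (@rchart R) P 0 -> exists2 t, t != 0 & P t.
Proof.
move=> /lnearP[W [oW W0 h]].
have cc : continuous (fun t : R => t *: (const_mx 1 : 'rV[R]_1)).
  exact: scalel_continuous.
have E t : t *: (const_mx 1 : 'rV[R]_1) = const_mx t.
  by apply/rowP => j; rewrite !mxE mulr1.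
have n0 : nbhs (0 : R) [set t | W (const_mx t)].
  have W0' : W (0 *: (const_mx 1 : 'rV[R]_1)) by rewrite E.
  have H : nbhs (0 : R) [set t : R | W (t *: (const_mx 1 : 'rV[R]_1))] :=
    cc 0 W (open_nbhs_nbhs (conj oW W0')).
  by apply: filterS H => t /=; rewrite E.
have n0' : nbhs (0 : R) [set t | t != 0 -> t != 0 /\ P t].
  by apply: filterS n0 => t /= Wt t0; split=> //; exact: h.
have [t [t0 Pt]] := @filter_ex R 0^' _ [set t | t != 0 /\ P t] n0'.
by exists t.
Qed.

(** * Vector bundles *)

Section Extension.
Context {R : realType} {T : Type}.
Implicit Types (A : set T) (f g : T -> R).

Lemma ext0E A f x : A x -> ext0 A f x = f x.
Proof. by move=> Ax; rewrite /ext0 patchT// inE. Qed.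

Lemma ext0_ext A f g : (forall x, A x -> f x = g x) -> ext0 A f = ext0 A g.
Proof.
move=> fg; apply/funext => x; rewrite /ext0 /patch.
by case: ifPn => //; rewrite inE => /fg.
Qed.

Lemma ext0_id A f : ext0 A f = ext0 A (ext0 A f).
Proof. by apply: ext0_ext => x Ax; rewrite ext0E. Qed.

Lemma ext0_inj A f g : f = ext0 A f -> g = ext0 A g ->
  (forall x, A x -> f x = g x) -> f = g.
Proof. by move=> fA gA fg; rewrite fA gA; exact: ext0_ext. Qed.

Lemma the_spec U (d : U) (P : U -> Prop) : (exists x, P x) -> P (the d P).
Proof. by rewrite /the => ex; case: pselect => // h; case: (cid h). Qed.

Lemma the_eq U (d : U) (P : U -> Prop) x : (exists! x, P x) -> P x -> the d P = x.
Proof.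
move=> [y [Py yu]] Px.
by rewrite -(yu x Px) -(yu _ (the_spec d (ex_intro P y Py))).
Qed.

End Extension.

Section Fibres.
Context {R : realType} {E B : mfd R} (V : vbstr E B).

(* A condition on a single fibre, because [core_str] has to be covered although
   it is not known to satisfy [is_vb]. *)
Record fib_coord (b : B) r (h : E -> 'rV[R]_r) : Prop := FibCoord {
  fc_add : forall x y, vfib V b x -> vfib V b y -> vfib V b (vadd V x y);
  fc_scl : forall t x, vfib V b x -> vfib V b (vscl V t x);
  fc_zero : vfib V b (vzero V b);
  fc_surj : forall v, exists x, vfib V b x /\ h x = v;
  fc_D : forall x y, vfib V b x -> vfib V b y -> h (vadd V x y) = h x + h y;
  fc_Z : forall t x, vfib V b x -> h (vscl V t x) = t *: h x;
  fc_0 : h (vzero V b) = 0;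
  fc_inj : forall x y, vfib V b x -> vfib V b y -> h x = h y -> x = y }.

Definition lcomb b r (v : 'rV[R]_r) (e : 'I_r -> E) : E :=
  \big[vadd V / vzero V b]_(i < r) vscl V (v 0 i) (e i).

Section Coordinates.
Context {b : B} {r : nat} {h : E -> 'rV[R]_r} (fc : fib_coord b h).

Lemma lcombP k (v : 'rV[R]_k) (e : 'I_k -> E) : (forall i, vfib V b (e i)) ->
  vfib V b (lcomb b v e) /\ h (lcomb b v e) = v *m (\matrix_i h (e i)).
Proof.
move=> eb.
have H : vfib V b (lcomb b v e) /\ h (lcomb b v e) = \sum_i v 0 i *: h (e i).
  rewrite /lcomb; elim: (index_enum _) => [|i s [IH1 IH2]].
    by rewrite !big_nil; split; [exact: fc_zero fc|exact: fc_0 fc].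
  have ib := fc_scl fc (v 0 i) (eb i).
  rewrite !big_cons; split; first exact: (fc_add fc ib IH1).
  by rewrite (fc_D fc ib IH1) (fc_Z fc)// IH2.
have [H1 ->] := H; split=> //; apply/rowP => j; rewrite mxE summxE.
by apply: eq_bigr => i _; rewrite !mxE.
Qed.

Lemma frame_unique (e : 'I_r -> E) : (forall i, vfib V b (e i)) ->
  \matrix_i h (e i) \in unitmx ->
  forall x, vfib V b x -> exists! v, x = lcomb b v e.
Proof.
move=> eb ue x xb; exists (h x *m invmx (\matrix_i h (e i))); split.
  have [lb lh] := lcombP (h x *m invmx (\matrix_i h (e i))) eb.
  by apply: (fc_inj fc xb lb); rewrite lh mulmxKV.
move=> v ->; have [_ ->] := lcombP v eb.
by rewrite mulmxK.
Qed.

Lemma linear_lcomb k (v : 'rV[R]_k) (e : 'I_k -> E) f : linear_on V b f ->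
  (forall i, vfib V b (e i)) -> f (lcomb b v e) = \sum_i v 0 i * f (e i).
Proof.
move=> [fD fZ] eb.
have f0 : f (vzero V b) = 0.
  have zb := fc_zero fc.
  have := fZ 0 _ zb; rewrite mul0r => <-; congr f; apply: (fc_inj fc zb).
    exact: fc_scl fc _ _ zb.
  by rewrite (fc_Z fc)// scale0r (fc_0 fc).
suff [_ //] : vfib V b (lcomb b v e) /\ f (lcomb b v e) = \sum_i v 0 i * f (e i).
rewrite /lcomb; elim: (index_enum _) => [|i s [IH1 IH2]].
  by rewrite !big_nil; split; [exact: fc_zero fc|].
have ib := fc_scl fc (v 0 i) (eb i).
rewrite !big_cons; split; first exact: (fc_add fc ib IH1).
by rewrite fD// fZ// IH2.
Qed.

End Coordinates.

Definition vsub (x y : E) : E := vadd V x (vscl V (-1) y).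

Definition is_fib (b : B) : Prop := exists r (h : E -> 'rV[R]_r), fib_coord b h.

Section Algebra.
Variables (b : B) (fb : is_fib b).

Lemma vfibD x y : vfib V b x -> vfib V b y -> vfib V b (vadd V x y).
Proof. by case: fb => r [h fc]; exact: fc_add fc _ _. Qed.

Lemma vfibZ t x : vfib V b x -> vfib V b (vscl V t x).
Proof. by case: fb => r [h fc]; exact: fc_scl fc _ _. Qed.

Lemma vfib0 : vfib V b (vzero V b).
Proof. by case: fb => r [h fc]; exact: fc_zero fc. Qed.

Lemma vfibB x y : vfib V b x -> vfib V b y -> vfib V b (vsub x y).
Proof. by move=> xb yb; apply: vfibD => //; exact: vfibZ. Qed.

Hint Resolve vfibD vfibZ vfib0 vfibB : core.

(** An identity between vectors of one fibre is checked on coordinates, where it becomes an identity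
    of row vectors. *)
Ltac fib_eq := let r := fresh "r" in let h := fresh "h" in let fc := fresh "fc" in
  case: (fb) => r [h fc]; apply: (fc_inj fc); [by auto 8|by auto 8|];
  rewrite /vsub ?(fc_D fc, fc_Z fc, fc_0 fc); auto 8.

Lemma vaddC x y : vfib V b x -> vfib V b y -> vadd V x y = vadd V y x.
Proof. by move=> xb yb; fib_eq; rewrite addrC. Qed.

Lemma vaddA x y z : vfib V b x -> vfib V b y -> vfib V b z ->
  vadd V x (vadd V y z) = vadd V (vadd V x y) z.
Proof. by move=> xb yb zb; fib_eq; rewrite addrA. Qed.

Lemma vaddx0 x : vfib V b x -> vadd V x (vzero V b) = x.
Proof. by move=> xb; fib_eq; rewrite addr0. Qed.

Lemma vadd0x x : vfib V b x -> vadd V (vzero V b) x = x.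
Proof. by move=> xb; fib_eq; rewrite add0r. Qed.

Lemma vscl1 x : vfib V b x -> vscl V 1 x = x.
Proof. by move=> xb; fib_eq; rewrite scale1r. Qed.

Lemma vscl0 x : vfib V b x -> vscl V 0 x = vzero V b.
Proof. by move=> xb; fib_eq; rewrite scale0r. Qed.

Lemma vsclx0 t : vscl V t (vzero V b) = vzero V b.
Proof. by fib_eq; rewrite scaler0. Qed.

Lemma vsclA s t x : vfib V b x -> vscl V s (vscl V t x) = vscl V (s * t) x.
Proof. by move=> xb; fib_eq; rewrite scalerA. Qed.

Lemma vsclDl s t x : vfib V b x ->
  vscl V (s + t) x = vadd V (vscl V s x) (vscl V t x).
Proof. by move=> xb; fib_eq; rewrite scalerDl. Qed.

Lemma vsclDr t x y : vfib V b x -> vfib V b y ->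
  vscl V t (vadd V x y) = vadd V (vscl V t x) (vscl V t y).
Proof. by move=> xb yb; fib_eq; rewrite scalerDr. Qed.

Lemma vsubKC x y : vfib V b x -> vfib V b y -> vadd V x (vsub y x) = y.
Proof. by move=> xb yb; fib_eq; rewrite scaleN1r addrC subrK. Qed.

Lemma vaddKC x y : vfib V b x -> vfib V b y -> vsub (vadd V x y) x = y.
Proof. by move=> xb yb; fib_eq; rewrite scaleN1r addrC addKr. Qed.

Lemma vaddACA x y z w : vfib V b x -> vfib V b y -> vfib V b z -> vfib V b w ->
  vadd V (vadd V x y) (vadd V z w) = vadd V (vadd V x z) (vadd V y w).
Proof. by move=> xb yb zb wb; fib_eq; rewrite addrACA. Qed.

Lemma vadd_sub_sub x y z w : vfib V b x -> vfib V b y -> vfib V b z -> vfib V b w ->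
  vadd V x y = vadd V z w -> vsub x z = vsub w y.
Proof.
move=> xb yb zb wb.
case: (fb) => r [h fc] e; apply: (fc_inj fc); [by auto|by auto|].
have : h (vadd V x y) = h (vadd V z w) by rewrite e.
rewrite /vsub ?(fc_D fc, fc_Z fc); auto => {}e; rewrite !scaleN1r.
apply: (addIr (h z + h y)); rewrite addrA subrK e.
by rewrite [in RHS](addrC (h z)) addrA subrK addrC.
Qed.

Lemma linear_on0 f : linear_on V b f -> f (vzero V b) = 0.
Proof. by move=> [_ fZ]; rewrite -(vsclx0 0) fZ ?mul0r. Qed.

End Algebra.

(** The map [pt] inverts the fibre coordinate [h] on each fibre, so that sections can be prescribed
    by their coordinates. *)
Record local_triv n r (c : chart R B n) (h : E -> 'rV[R]_r)
    (pt : B -> 'rV[R]_r -> E) : Prop := LocalTriv {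
  lt_base : admissible c;
  lt_tot : @admissible R E (n + r) ([set x | carrier E x /\ c.1 (vpr V x)],
                             fun x => row_mx (c.2 (vpr V x)) (h x));
  lt_fib : forall b, c.1 b -> fib_coord b h;
  lt_pt : forall b v, c.1 b -> vfib V b (pt b v) /\ h (pt b v) = v }.

Definition tchart n r (c : chart R B n) (h : E -> 'rV[R]_r) : chart R E (n + r) :=
  ([set x | carrier E x /\ c.1 (vpr V x)], fun x => row_mx (c.2 (vpr V x)) (h x)).

Section Bundle.
Hypothesis V_vb : is_vb V.

Lemma vb_total : is_manifold E. Proof. by case: V_vb. Qed.
Lemma vb_base : is_manifold B. Proof. by case: V_vb. Qed.

Lemma vpr_carrier x : carrier E x -> carrier B (vpr V x).
Proof. by case: V_vb => _ _ [+ _] _ _; apply. Qed.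

Lemma vb_triv b : carrier B b -> exists n r (c : chart R B n) h pt,
  @local_triv n r c h pt /\ c.1 b.
Proof.
case: V_vb => mE mB _ cl tr Bb.
have [n [r [c [h [ac cb at_ fib]]]]] := tr b Bb.
(* Injectivity of [h] on a fibre is not among the axioms: it follows from injectivity of the chart
   of [E], whose base coordinates are constant on the fibre. *)
have fcb b' : c.1 b' -> fib_coord b' h.
  move=> cb'; have Bb' := admissible_sub ac cb'.
  have [c1 c2 c3] := cl b' Bb'; have [s D Z h0] := fib b' cb'.
  split=> // x y [Ex xb] [Ey yb] e.
  apply: (admissible_inj at_); [by split=> //=; rewrite xb|by split=> //=; rewrite yb|].
  by rewrite /= xb yb e.
have ptP (p : B * 'rV[R]_r) : exists x, c.1 p.1 -> vfib V p.1 x /\ h x = p.2.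
  have [cp|ncp] := pselect (c.1 p.1); last by exists (vzero V b).
  by have [x xP] := fc_surj (fcb _ cp) p.2; exists x.
have [pt hpt] := choice ptP.
exists n, r, c, h, (fun b v => pt (b, v)); split=> //; split=> // b' v cb'.
exact: (hpt (b', v)).
Qed.

Lemma vb_is_fib b : carrier B b -> is_fib b.
Proof. by move=> /vb_triv[n [r [c [h [pt [lt cb]]]]]]; exists r, h; exact: lt_fib lt _ cb. Qed.

End Bundle.

Section Triv.
Context {n r : nat} {c : chart R B n} {h : E -> 'rV[R]_r} {pt : B -> 'rV[R]_r -> E}.
Hypothesis lt : local_triv c h pt.

Lemma tchart_admissible : admissible (tchart c h). Proof. exact: lt_tot lt. Qed.

Lemma lsm_pt U m (d : chart R U m) (g : U -> B) (w : U -> 'rV[R]_r) x :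
  lsm d c g x -> (forall j, lsmR d (fun y => w y 0 j) x) ->
  lsm d (tchart c h) (fun y => pt (g y) (w y)) x.
Proof.
move=> [ng sg] sw; split.
  by apply: lnear_imp ng => y _ cy /=; have [[? ->] _] := lt_pt lt (w y) cy.
move=> j; apply: (@lsmR_near _ _ _ _ _ (fun y => row_mx (c.2 (g y)) (w y) 0 j)).
  by apply: lnear_imp ng => y _ cy /=; have [[? ->] ->] := lt_pt lt (w y) cy.
exact: lsm_row_mx.
Qed.

Lemma lsm_vpr x : lsm (tchart c h) c (vpr V) x.
Proof.
split; first by apply: lnear_all => y [].
move=> j; apply: lsmR_ext (lsmR_coord _ (lshift r j) _) => y _.
by rewrite row_mxEl.
Qed.

Lemma lsmR_fibcoord j x : lsmR (tchart c h) (fun y => h y 0 j) x.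
Proof.
apply: lsmR_ext (lsmR_coord _ (rshift n j) _) => y _.
by rewrite row_mxEr.
Qed.

Lemma lsm_scl U m (d : chart R U m) (g : U -> E) (a : U -> R) x :
  lsm d (tchart c h) g x -> lsmR d a x ->
  lsm d (tchart c h) (fun y => vscl V (a y) (g y)) x.
Proof.
move=> [ng sg] sa.
have E1 y : (tchart c h).1 (g y) ->
    vfib V (vpr V (g y)) (vscl V (a y) (g y)) /\
    h (vscl V (a y) (g y)) = a y *: h (g y).
  move=> [Ey cy]; have fc := lt_fib lt cy; split; first exact: fc_scl fc _ _ _.
  exact: fc_Z fc _ _ _.
split; first by apply: lnear_imp ng => y _ gy /=; have [[? ->] _] := E1 y gy; case: gy.
move=> j; apply: (@lsmR_near _ _ _ _ _
    (fun y => row_mx (lsubmx ((tchart c h).2 (g y)))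
                     (a y *: rsubmx ((tchart c h).2 (g y))) 0 j)).
  apply: lnear_imp ng => y _ gy /=; have [[? ->] ->] := E1 y gy.
  by rewrite row_mxKl row_mxKr.
apply: lsm_row_mx => i.
  by apply: lsmR_ext (sg (lshift r i)) => y _; rewrite mxE.
apply: lsmR_ext (lsmRM sa (sg (rshift n i))) => y _.
by rewrite !mxE.
Qed.

Lemma lsm_add U m (d : chart R U m) (f g : U -> E) x :
  lsm d (tchart c h) f x -> lsm d (tchart c h) g x ->
  (forall y, d.1 y -> vpr V (f y) = vpr V (g y)) ->
  lsm d (tchart c h) (fun y => vadd V (f y) (g y)) x.
Proof.
move=> [nf sf] [ng sg] fg.
have E1 y : (tchart c h).1 (f y) -> (tchart c h).1 (g y) -> vpr V (f y) = vpr V (g y) ->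
    vfib V (vpr V (f y)) (vadd V (f y) (g y)) /\
    h (vadd V (f y) (g y)) = h (f y) + h (g y).
  move=> [Ef cf] [Eg cg] e; have fc := lt_fib lt cf.
  by split; [exact: fc_add fc _ _ _ _|exact: fc_D fc _ _ _ _].
have nfg := lnear_and nf ng.
split.
  apply: (lnear_imp _ nfg) => y dy [fy gy] /=.
  by have [[? ->] _] := E1 y fy gy (fg y dy); case: fy.
move=> j; apply: (@lsmR_near _ _ _ _ _
    (fun y => row_mx (lsubmx ((tchart c h).2 (f y)))
       (rsubmx ((tchart c h).2 (f y)) + rsubmx ((tchart c h).2 (g y))) 0 j)).
  apply: (lnear_imp _ nfg) => y dy [fy gy] /=.
  have [[? ->] ->] := E1 y fy gy (fg y dy).
  by rewrite row_mxKl !row_mxKr.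
apply: lsm_row_mx => i.
  by apply: lsmR_ext (sf (lshift r i)) => y _; rewrite mxE.
apply: lsmR_ext (lsmRD (sf (rshift n i)) (sg (rshift n i))) => y _.
by rewrite !mxE.
Qed.

End Triv.

End Fibres.

Section BundleOperations.
Context {R : realType} {E B : mfd R} {V : vbstr E B} (Vvb : is_vb V).

Lemma vpr_fib x : carrier E x -> is_fib V (vpr V x).
Proof. by move=> Ex; apply: vb_is_fib => //; exact: vpr_carrier. Qed.

Lemma vscl_carrier t x : carrier E x -> carrier E (vscl V t x).
Proof. by move=> Ex; have [] := vfibZ (vpr_fib Ex) t (conj Ex erefl). Qed.

Lemma vpr_vscl t x : carrier E x -> vpr V (vscl V t x) = vpr V x.
Proof. by move=> Ex; have [] := vfibZ (vpr_fib Ex) t (conj Ex erefl). Qed.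

Lemma vadd_carrier x y : carrier E x -> carrier E y -> vpr V x = vpr V y ->
  carrier E (vadd V x y).
Proof.
move=> Ex Ey e.
by have [] := vfibD (vpr_fib Ex) (conj Ex erefl) (conj Ey (esym e)).
Qed.

Lemma vpr_vadd x y : carrier E x -> carrier E y -> vpr V x = vpr V y ->
  vpr V (vadd V x y) = vpr V x.
Proof.
move=> Ex Ey e.
by have [] := vfibD (vpr_fib Ex) (conj Ex erefl) (conj Ey (esym e)).
Qed.

Lemma vzero_carrier b : carrier B b -> carrier E (vzero V b).
Proof. by move=> Bb; have [] := vfib0 (vb_is_fib Vvb Bb). Qed.

Lemma vpr_vzero b : carrier B b -> vpr V (vzero V b) = b.
Proof. by move=> Bb; have [] := vfib0 (vb_is_fib Vvb Bb). Qed.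

Lemma smooth_vpr : smooth_map (vpr V).
Proof. by case: Vvb. Qed.

End BundleOperations.

Section FibreMatrices.
Context {R : realType} {E B : mfd R} {V : vbstr E B} {b : B} {r : nat}
  {h : E -> 'rV[R]_r} (fc : fib_coord V b h) {e : 'I_r -> E}.
Hypothesis eP : forall i, vfib V b (e i) /\ h (e i) = delta_mx 0 i.

Lemma fc_lcomb x : vfib V b x -> x = lcomb V b (h x) e.
Proof.
move=> xb; have eb i : vfib V b (e i) by have [] := eP i.
have [lb lh] := lcombP fc (h x) eb; apply: (fc_inj fc xb lb).
rewrite lh (_ : \matrix_i h (e i) = 1%:M) ?mulmx1//.
apply/matrixP => i l; have [_ ei] := eP i.
by rewrite mxE ei !mxE eqxx eq_sym.
Qed.

Lemma fc_linear f x : linear_on V b f -> vfib V b x ->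
  f x = \sum_i h x 0 i * f (e i).
Proof.
move=> lf xb; rewrite {1}(fc_lcomb xb).
by apply: (linear_lcomb fc) => // i; have [] := eP i.
Qed.

Lemma fc_linear_mx k (L : E -> 'rV[R]_k) x :
  (forall j, linear_on V b (fun y => L y 0 j)) ->
  vfib V b x -> L x = h x *m \matrix_i L (e i).
Proof.
move=> lL xb; apply/rowP => j; rewrite (fc_linear (lL j) xb) mxE.
by apply: eq_bigr => i _; rewrite mxE.
Qed.

End FibreMatrices.

(** * Frames and the charts of dual bundles *)

Section Frames.
Context {R : realType}.

Lemma restrict_chart (X : mfd R) n (c : chart R X n) P x :
  is_manifold X -> admissible c -> c.1 x -> lnear c P x ->
  exists c' : chart R X n, [/\ admissible c', c'.1 x, c'.2 = c.2 &
    forall y, c'.1 y -> c.1 y /\ P y].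
Proof.
move=> mX ac cx /lnearP[W [oW Wx PW]].
pose c' : chart R X n := (c.1 `&` c.2 @^-1` W, c.2).
have ci := admissible_inj ac.
exists c'; split=> //; last by move=> y [cy Wy]; split=> //; exact: PW.
apply: build_admissible => //.
- by move=> y [cy _]; exact: admissible_sub cy.
- by move=> y z [cy _] [cz _]; exact: ci.
- rewrite (_ : _ @` _ = (c.2 @` c.1) `&` W); first exact: openI (admissible_open ac) oW.
  apply/seteqP; split=> [_ [y [cy Wy] <-]|_ [[y cy <-] Wy]].
    by split=> //; exists y.
  by exists y.
- move=> y [cy Wy]; exists n, c; split=> //.
    by apply: (lsm_res (c := c)) (lsm_id c y) => // z [].
  split; last by move=> j; exact: lsmR_coord.
  by apply/lnearP; exists W.
Qed.

Section Bundle.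
Context {E B : mfd R} {V : vbstr E B} (Vvb : is_vb V).

Lemma lsm_vzero n (c : chart R B n) m (d : chart R E m) b :
  admissible c -> admissible d -> c.1 b -> d.1 (vzero V b) -> lsm c d (vzero V) b.
Proof.
move=> ac ad cb db; have Bb := admissible_sub ac cb.
have [p [r [c' [h [pt [lt cb']]]]]] := vb_triv Vvb Bb.
have s0 : lsm c c' id b := admissible_lsm (vb_base Vvb) ac (lt_base lt) cb cb'.
have s1 : lsm c (tchart V c' h) (vzero V) b.
  apply: (@lsm_near _ _ _ _ _ _ _ _ (fun y => pt y 0)); last first.
    by apply: (lsm_pt lt) => // j; apply: lsmR_ext (lsmR_cst _ 0 _) => y _; rewrite mxE.
  apply: lnear_imp s0.1 => y cy c'y; have fc := lt_fib lt c'y.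
  have [ptb hpt] := lt_pt lt 0 c'y.
  by apply: (fc_inj fc (fc_zero fc) ptb); rewrite hpt (fc_0 fc).
apply: (lsm_comp cb s1 (g := id)).
apply: (admissible_lsm (vb_total Vvb)) => //; first exact: tchart_admissible lt.
by have [Ez zb] := vfib0 (vb_is_fib Vvb Bb); split=> //=; rewrite zb.
Qed.

(** The domain of [c'] may be smaller than that of the trivialization because the coordinates [w]
    may involve a denominator that vanishes elsewhere. *)
Lemma triv_frame n r (c : chart R B n) h pt k (c' : chart R B k)
    (w : 'I_r -> B -> 'rV[R]_r) :
  local_triv V c h pt -> admissible c' -> (forall b, c'.1 b -> c.1 b) ->
  (forall b i j, c'.1 b -> lsmR c' (fun y => w i y 0 j) b) ->
  (forall b, c'.1 b -> \matrix_i w i b \in unitmx) ->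
  (forall b i, c'.1 b -> lsm c' (tchart V c h) (fun b => pt b (w i b)) b) /\
  smooth_frame V c'.1 (fun i b => pt b (w i b)).
Proof.
move=> lt ac' c'c sw uw; have ac := lt_base lt.
have se b i : c'.1 b -> lsm c' (tchart V c h) (fun b => pt b (w i b)) b.
  move=> cb; apply: (lsm_pt lt); last by move=> j; exact: sw.
  have s0 : lsm c' c id b := admissible_lsm (vb_base Vvb) ac' ac cb (c'c _ cb).
  exact: s0.
split=> //; split.
  move=> i; apply: manifold_smooth_on; first exact: (vb_base Vvb).
  move=> b Bb c'b p d ad db q l al lb.
  have [[Ee be] _] := lt_pt lt (w i b) (c'c _ c'b).
  have s0 : lsm d c' id b := admissible_lsm (vb_base Vvb) ad ac' db c'b.
  have s1 := lsm_comp db s0 (se b i c'b).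
  apply: (lsm_comp db s1 (g := id)).
  apply: (admissible_lsm (vb_total Vvb)) => //; first exact: tchart_admissible lt.
    exact: atlas_admissible (vb_total Vvb) _ _ al.
  by split=> //=; rewrite be; exact: c'c.
move=> b cb; have fc := lt_fib lt (c'c _ cb).
have eb i : vfib V b (pt b (w i b)) by have [] := lt_pt lt (w i b) (c'c _ cb).
split=> //; apply: (frame_unique fc eb).
rewrite (_ : \matrix_i _ = \matrix_i w i b); first exact: uw.
by apply/matrixP => i j; rewrite !mxE; have [_ ->] := lt_pt lt (w i b) (c'c _ cb).
Qed.

Lemma triv_basis_frame n r (c : chart R B n) (h : E -> 'rV[R]_r) pt :
  local_triv V c h pt ->
  smooth_frame V c.1 (fun i b => pt b (delta_mx 0 i)).
Proof.
move=> lt; have sw b (i j : 'I_r) : c.1 b -> lsmR c (fun=> (delta_mx 0 i : 'rV[R]_r) 0 j) b.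
  by move=> _; exact: lsmR_cst.
have uw b : c.1 b -> \matrix_i (delta_mx 0 i : 'rV[R]_r) \in unitmx.
  move=> _; rewrite (_ : \matrix_i _ = 1%:M) ?unitmx1//.
  by apply/matrixP => i j; rewrite !mxE eqxx eq_sym.
by have [] := triv_frame (w := fun i _ => delta_mx 0 i) lt (lt_base lt)
  (fun b cb => cb) sw uw.
Qed.

End Bundle.

Section DualCharts.
Context {E B : mfd R} {V : vbstr E B}.

Definition dchart n r (c : chart R B n) (e : 'I_r -> B -> E) :
    chart R (B * (E -> R)) (n + r) :=
  (dual_set V `&` [set u | c.1 u.1], fun u => row_mx (c.2 u.1) (\row_i u.2 (e i u.1))).

Lemma dchart_atlas n r (c : chart R B n) (e : 'I_r -> B -> E) :
  admissible c -> smooth_frame V c.1 e -> atlas (dual_mfd V) (dchart c e).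
Proof. by move=> ac se; exact: DualChart. Qed.

(** A linear functional is determined by its values on a frame, and an extension by 0 by its values
    on the fibre. *)
Lemma dchart_inj n r (c : chart R B n) (e : 'I_r -> B -> E) :
  chart_inj c -> smooth_frame V c.1 e -> (forall b, c.1 b -> is_fib V b) ->
  chart_inj (dchart c e).
Proof.
move=> ci [_ se] fV [b f] [b' g] [[/= Bb fl fe] cb] [[/= Bb' gl ge] cb'].
move=> /eq_row_mx[/= ec ee]; have eb := ci _ _ cb cb' ec.
rewrite -{b'}eb in Bb' gl ge cb' ee ec *; congr pair; apply: (ext0_inj fe ge) => x xb.
have [eb /(_ x xb)[v [-> _]]] := se b cb; have [r' [h fc]] := fV b cb.
rewrite -/(lcomb V b v (fun i => e i b)) !(linear_lcomb fc)//.
apply: eq_bigr => i _; congr (_ * _).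
by have := congr1 (fun M : 'rV_r => M 0 i) ee; rewrite !mxE.
Qed.

Lemma lsm_dchart U m (d : chart R U m) n r (c : chart R B n) (e : 'I_r -> B -> E)
    (g : U -> dual_mfd V) x :
  lnear d (fun y => dual_set V (g y)) x -> lsm d c (fun y => (g y).1) x ->
  (forall i, lsmR d (fun y => (g y).2 (e i (g y).1)) x) ->
  lsm d (dchart c e) g x.
Proof.
move=> Vg [ng sg] se; split; first exact: lnear_and.
apply: lsm_row_mx => // i.
by apply: lsmR_ext (se i) => y _; rewrite mxE.
Qed.

End DualCharts.

Lemma manifold_id_smooth (X : mfd R) : is_manifold X -> @smooth_map R X X id.
Proof.
move=> mX; split=> //; apply: manifold_smooth_on => // x Xx _ m c ac cx n d ad dx.
exact: (admissible_lsm mX ac (atlas_admissible mX ad) cx dx).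
Qed.

(** Not automatic: the atlas of [sub_mfd S] contains every slice chart, and two of them are compared
    inside [X], through an injective chart of its atlas. *)
Lemma sub_id_smooth (X : mfd R) (S : set X) :
  (forall x, carrier X x -> S x -> exists n (e : chart R X n),
    [/\ atlas X e, chart_inj e & e.1 x]) ->
  @smooth_map R (sub_mfd S) (sub_mfd S) id.
Proof.
move=> h; split=> //; apply: sub_smooth_on => x Xx Sx _ k q d ad sd dx n e ae ex.
case: n e / ae ex => k' q' d' ad' sd' [d'x _].
apply: lsm_slice_target; first by apply: lnear_all => y [].
have [p [e [ae ei ex]]] := h x Xx Sx.
apply: (lsm_comp (g := id) (c := slice S d) _ (lsm_slice_source _ sd)); first by split.
exact: (admissible_lsm_via ad ad' ae ei dx d'x ex).
Qed.

Lemma diffeo_id (X : mfd R) : @smooth_map R X X id -> @diffeo R X X id.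
Proof. by move=> sX; split=> //; exists id. Qed.

End Frames.

(** * The level set of a fibrewise linear function as an embedded submanifold *)

Section LevelSlice.
Context {R : realType} {E B : mfd R} {V : vbstr E B} (Vvb : is_vb V).
Variable l : E -> R.
Hypothesis l_nz : nonzero_linear_fun V l.

(** Some component [mu i0] of [l] is nonzero near the base point of [a0]. Exchanging the fibre
    coordinate [i0] for [l - 1] gives a chart in which the level set is where the last coordinate
    vanishes. *)
Lemma level_slice a0 : carrier E a0 -> l a0 = 1 ->
  exists k q (d : chart R E (k + q)),
  [/\ admissible d, is_slice [set a | l a = 1] d & d.1 a0].
Proof.
move=> Ea0 la0; have Bm0 := vpr_carrier Vvb Ea0.
have [n [r [c [h [pt [lt cm0]]]]]] := vb_triv Vvb Bm0.
have ac := lt_base lt; have [sl ll _] := l_nz.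
pose mu i b := l (pt b (delta_mx 0 i)).
have lE a : carrier E a -> c.1 (vpr V a) -> l a = \sum_i h a 0 i * mu i (vpr V a).
  move=> Ea ca; apply: (fc_linear (lt_fib lt ca) (fun i => lt_pt lt (delta_mx 0 i) ca)) => //.
  exact/ll/vpr_carrier.
have smu i b : c.1 b -> lsmR c (mu i) b.
  move=> cb.
  have s0 : lsm c (tchart V c h) (fun b => pt b (delta_mx 0 i)) b.
    by apply: (lsm_pt lt (lsm_id c b)) => j; exact: lsmR_cst.
  have [[De ea] _] := lt_pt lt (delta_mx 0 i) cb.
  have te : (tchart V c h).1 (pt b (delta_mx 0 i)) by split=> //=; rewrite ea.
  exact: (lsmR_comp cb s0 (smooth_fun_lsmR (vb_total Vvb) sl (tchart_admissible lt) te)).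
(* If all components vanished, [l a0] would be 0 instead of 1. *)
have [i0 mu0] : exists i, mu i (vpr V a0) != 0.
  apply: contrapT => nmu.
  have := lE a0 Ea0 cm0; rewrite la0 big1 => [/eqP|i _]; first by rewrite oner_eq0.
  have [->|mi] := eqVneq (mu i (vpr V a0)) 0; first by rewrite mulr0.
  by case: nmu; exists i.
have [c' [ac' c'm0 ec ce]] := restrict_chart (vb_base Vvb) ac cm0
  (lsmR_neq0 cm0 (smu i0 _ cm0) mu0).
have csub b : c'.1 b -> c.1 b by move=> /ce[].
have smu' i b : c'.1 b -> lsmR c' (mu i) b.
  by move=> c'b; apply: (lsmR_res csub ec); apply: smu; exact: csub.
pose dom : set E := [set a | carrier E a /\ c'.1 (vpr V a)].
pose d : chart R E ((n + r.-1) + 1) :=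
  (dom, fun a => row_mx (row_mx (c'.2 (vpr V a)) (col' i0 (h a))) (const_mx (l a - 1))).
(* The fibre coordinates in terms of the ones other than i0 and of l - 1. *)
pose rec b (v : 'rV[R]_r.-1) (s : R) : 'rV[R]_r := \row_i
  if unlift i0 i is Some j then v 0 j
  else (s + 1 - \sum_j v 0 j * mu (lift i0 j) b) / mu i0 b.
have recl b v s : col' i0 (rec b v s) = v.
  by apply/rowP => j; rewrite !mxE liftK.
have sum_lift (f : 'I_r -> R) : \sum_i f i = f i0 + \sum_j f (lift i0 j).
  by rewrite (bigD1_ord i0).
have recs b v s : mu i0 b != 0 -> \sum_i rec b v s 0 i * mu i b = s + 1.
  move=> m0; rewrite sum_lift mxE unlift_none divfK//.
  rewrite [X in _ + X](eq_bigr (fun j => v 0 j * mu (lift i0 j) b)) ?subrK// => j _.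
  by rewrite mxE liftK.
have hrec a : dom a -> h a = rec (vpr V a) (col' i0 (h a)) (l a - 1).
  move=> [Ea ca]; have [cc m0] := ce _ ca; apply/rowP => i; rewrite mxE.
  case: unliftP => [j ->|->]; first by rewrite mxE.
  rewrite subrK lE// sum_lift [X in _ + X - _](eq_bigr
    (fun j => col' i0 (h a) 0 j * mu (lift i0 j) (vpr V a))).
    by rewrite addrK mulfK.
  by move=> j _; rewrite mxE.
have dl a : lsubmx (d.2 a) = row_mx (c'.2 (vpr V a)) (col' i0 (h a)).
  by rewrite row_mxKl.
have dr a : rsubmx (d.2 a) = const_mx (l a - 1) by rewrite row_mxKr.
have di : chart_inj d.
  move=> a a' da da' /eq_row_mx[/eq_row_mx[e1 e2] e3].
  have [Ea ca] := da; have [Ea' ca'] := da'.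
  have eb : vpr V a = vpr V a' by apply: (admissible_inj ac').
  have el : l a - 1 = l a' - 1.
    by have := congr1 (fun M : 'rV_1 => M 0 0) e3; rewrite !mxE.
  apply: (fc_inj (lt_fib lt (csub _ ca))); [by []|by split|].
  by rewrite (hrec a)// (hrec a')// e2 el eb.
have od : open (d.2 @` d.1).
  (* The base point ranges over the domain of [c'], and the remaining coordinates are arbitrary,
     since [rec] solves for the one that was left out. *)
  have -> : d.2 @` d.1 = setT `&`
      (fun w : 'rV[R]_((n + r.-1) + 1) => lsubmx (lsubmx w)) @^-1` (c'.2 @` c'.1).
    apply/seteqP; split=> [_ [a [Ea ca] <-]|w [_ [b c'b eb]]].
      by split=> //=; exists (vpr V a) => //; rewrite row_mxKl row_mxKl.
    have [cb m0] := ce b c'b.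
    have [[Ep pb] hp] := lt_pt lt (rec b (rsubmx (lsubmx w)) (rsubmx w 0 0)) cb.
    exists (pt b (rec b (rsubmx (lsubmx w)) (rsubmx w 0 0))).
      by split=> //; rewrite pb.
    rewrite /= lE ?pb// hp recs// recl addrK eb hsubmxK.
    rewrite -[RHS]hsubmxK; congr row_mx.
    by apply/rowP => j; rewrite mxE ord1.
  apply: Csmooth_preimage_open; [exact: openT|exact: admissible_open ac'|].
  apply/CsmoothP; first exact: openT.
  move=> j k; apply: (@Cks_ext _ _ _ _ (fun w => w 0 (lshift 1 (lshift r.-1 j)))).
  - exact: openT.
  - by move=> w _; rewrite !mxE.
  - exact: Cks_coord.
have ad : admissible d.
  apply: (build_admissible (vb_total Vvb) _ di od); first by move=> a [].
  move=> a da; have [Ea ca] := da; have [cc m0] := ce _ ca.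
  have ta : (tchart V c h).1 a by split.
  exists (n + r)%N, (tchart V c h); split=> //; first exact: tchart_admissible lt.
    have sq : lsm d c' (vpr V) a.
      split; first by apply: lnear_all => y [].
      move=> j; apply: lsmR_ext (lsmR_coord d (lshift 1 (lshift r.-1 j)) a) => y _.
      by rewrite row_mxEl row_mxEl.
    split; first by apply: lnear_all => y [Ey cy]; split=> //; exact: csub.
    apply: lsm_row_mx => j.
      by apply: lsmR_ext (sq.2 j) => y _; rewrite ec.
    apply: (@lsmR_ext _ _ _ _ _
      (fun y => rec (vpr V y) (col' i0 (h y)) (l y - 1) 0 j)).
      by move=> y dy; rewrite -hrec.
    have sh j' : lsmR d (fun y => col' i0 (h y) 0 j') a.
      apply: lsmR_ext (lsmR_coord d (lshift 1 (rshift n j')) a) => y _.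
      by rewrite row_mxEl row_mxEr.
    have sls : lsmR d (fun y => l y - 1) a.
      apply: lsmR_ext (lsmR_coord d (rshift (n + r.-1) 0) a) => y _.
      by rewrite row_mxEr mxE.
    have smd i : lsmR d (fun y => mu i (vpr V y)) a.
      exact: (lsmR_comp da sq (smu' i _ ca)).
    case: (unliftP i0 j) => [j' ->|->].
      by apply: lsmR_ext (sh j') => y _; rewrite mxE liftK.
    apply: (@lsmR_ext _ _ _ _ _ (fun y => (((l y - 1) + 1) + (-1) *
      (\sum_j' col' i0 (h y) 0 j' * mu (lift i0 j') (vpr V y))) * (mu i0 (vpr V y))^-1)).
      by move=> y _; rewrite mxE unlift_none mulN1r.
    apply: lsmRM; last exact: lsmRV.
    apply: lsmRD; first by apply: lsmRD => //; exact: lsmR_cst.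
    apply: lsmRM; first exact: lsmR_cst.
    by apply: lsmR_sum => j'; exact: lsmRM.
  have sc : lsm (tchart V c h) c' (vpr V) a.
    apply: (lsm_comp ta (lsm_vpr V _) (g := id)).
    exact: (admissible_lsm (vb_base Vvb) ac ac' cc ca).
  split.
    by apply: (lnear_imp _ sc.1) => y [Ey _] cy.
  apply: lsm_row_mx => j.
    move: j; apply: lsm_row_mx => j; first exact: sc.2.
    by apply: lsmR_ext (lsmR_fibcoord V (lift i0 j) a) => y _; rewrite mxE.
  apply: (@lsmR_ext _ _ _ _ _ (fun y => l y + (-1))); first by move=> y _; rewrite mxE.
  apply: lsmRD; last exact: lsmR_cst.
  exact: (smooth_fun_lsmR (vb_total Vvb) sl (tchart_admissible lt) ta).
exists (n + r.-1)%N, 1%N, d; split=> // a da; rewrite dr.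
split=> [/= ->|/(congr1 (fun M : 'rV_1 => M 0 0))].
  by rewrite subrr; apply/rowP => j; rewrite !mxE.
by rewrite !mxE => /eqP; rewrite subr_eq0 => /eqP.
Qed.

End LevelSlice.

Section FrameFunctionals.
Context {R : realType} {E B : mfd R} {V : vbstr E B} {b : B} (fb : is_fib V b).
Context {r : nat} {e : 'I_r -> E}.
Hypothesis eb : forall i, vfib V b (e i).
Hypothesis ef : forall x, vfib V b x -> exists! v, x = lcomb V b v e.

Lemma frame_linear_eq f g : linear_on V b f -> linear_on V b g ->
  (forall i, f (e i) = g (e i)) -> forall x, vfib V b x -> f x = g x.
Proof.
move=> fl gl fg x /ef[v [-> _]]; case: fb => r' [h fc].
by rewrite !(linear_lcomb fc)//; apply: eq_bigr => i _; rewrite fg.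
Qed.

(** The coefficients [k x] with respect to the frame are unique, hence linear in [x], and supply the
    dual basis. *)
Lemma frame_functional (v : 'I_r -> R) : exists2 f, linear_on V b f &
  forall i, f (e i) = v i.
Proof.
case: (fb) => r' [h fc].
have kex x : exists k : 'rV[R]_r, vfib V b x ->
    x = lcomb V b k e /\ forall k', x = lcomb V b k' e -> k = k'.
  have [xb|nx] := pselect (vfib V b x); last by exists 0.
  by have [k [kx ku]] := ef xb; exists k.
have [k kP] := choice kex.
have kE x w : vfib V b x -> h x = w *m \matrix_i h (e i) -> k x = w.
  move=> xb hx; have [_] := kP x xb; apply.
  by have [lb lh] := lcombP fc w eb; apply: (fc_inj fc xb lb); rewrite lh.
have kh x : vfib V b x -> h x = k x *m \matrix_i h (e i).
  by move=> xb; have [kx _] := kP x xb; rewrite {1}kx; have [_ ->] := lcombP fc (k x) eb.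
exists (fun x => \sum_i k x 0 i * v i).
  split=> [x y xb yb|t x xb].
    rewrite (kE _ (k x + k y)); [|exact: vfibD|].
      by rewrite -big_split; apply: eq_bigr => i _; rewrite mxE mulrDl.
    by rewrite (fc_D fc)// (kh x)// (kh y)// mulmxDl.
  rewrite (kE _ (t *: k x)); [|exact: vfibZ|].
    by rewrite mulr_sumr; apply: eq_bigr => i _; rewrite mxE mulrA.
  by rewrite (fc_Z fc)// (kh x)// scalemxAl.
move=> i; rewrite (kE _ (delta_mx 0 i))//; last by rewrite -rowE rowK.
rewrite (bigD1 i)//= big1 => [|j /negbTE ji]; last by rewrite mxE ji andbF mul0r.
by rewrite mxE !eqxx mul1r addr0.
Qed.

End FrameFunctionals.

(** * Affine functions on a hyperplane of a fibre that avoids the origin *)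

Section AffineExtension.
Context {R : realType} {E B : mfd R} (V : vbstr E B) (b : B) (fb : is_fib V b).
Variable l : E -> R.
Hypothesis l_lin : linear_on V b l.

Definition hyperplane : set E := [set x | vfib V b x /\ l x = 1].

Definition affine_on_hyperplane (f : E -> R) : Prop := forall t x y,
  hyperplane x -> hyperplane y ->
  f (vadd V (vscl V t x) (vscl V (1 - t) y)) = t * f x + (1 - t) * f y.

Let H := hyperplane.

Hint Resolve vfibD vfibZ vfib0 vfibB : core.

Lemma hyperplane_aff t x y : H x -> H y ->
  H (vadd V (vscl V t x) (vscl V (1 - t) y)).
Proof.
move=> [xb lx] [yb ly]; have [lD lZ] := l_lin.
split; first by auto.
by rewrite lD ?lZ; auto; rewrite lx ly; ring.
Qed.

Lemma linear_affine f : linear_on V b f -> affine_on_hyperplane f.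
Proof.
by move=> [fD fZ] t x y [xb _] [yb _]; rewrite fD ?fZ; auto.
Qed.

(** Only combinations of two points are available: [x + y - z] is the combination with weights 2 and
    -1 of the midpoint of [x] and [y] and of [z]. *)
Lemma affine_parallelogram f x y z : affine_on_hyperplane f -> H x -> H y -> H z ->
  f (vadd V (vadd V x y) (vscl V (-1) z)) = f x + f y - f z.
Proof.
move=> fa Hx Hy Hz.
pose mid := vadd V (vscl V 2^-1 x) (vscl V (1 - 2^-1) y).
have Hm : H mid by exact: hyperplane_aff.
have -> : vadd V (vadd V x y) (vscl V (-1) z) =
    vadd V (vscl V 2 mid) (vscl V (1 - 2) z).
  have [xb _] := Hx; have [yb _] := Hy; have [zb _] := Hz; have [mb _] := Hm.
  case: (fb) => r [h fc]; apply: (fc_inj fc); [by auto 8|by auto 8|].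
  rewrite /mid !(fc_D fc, fc_Z fc); auto 8.
  by apply/rowP => j; rewrite !mxE; field.
by rewrite (fa 2) // /mid fa//; field.
Qed.

(** Every vector [x] is moved along [x0] to the point [A x] of the hyperplane, at the cost of the
    multiple [l x - 1] of [x0]; a linear extension has to send this multiple to [(l x - 1) * f x0],
    which dictates the formula. *)
Lemma affine_extension f x0 : H x0 -> affine_on_hyperplane f ->
  exists2 g, linear_on V b g & forall x, H x -> g x = f x.
Proof.
move=> H0 fa; have [x0b l0] := H0; have [lD lZ] := l_lin.
pose A x := vadd V x (vscl V (1 - l x) x0).
have HA x : vfib V b x -> H (A x).
  by move=> xb; split; [rewrite /A; auto|rewrite /A lD ?lZ; auto; rewrite l0; ring].
exists (fun x => f (A x) + (l x - 1) * f x0).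
  split=> [x y xb yb|t x xb].
    have -> : A (vadd V x y) = vadd V (vadd V (A x) (A y)) (vscl V (-1) x0).
      case: (fb) => r [h fc]; rewrite /A; apply: (fc_inj fc); [by auto 8|by auto 8|].
      rewrite lD// !(fc_D fc, fc_Z fc); auto 8.
      by apply/rowP => j; rewrite !mxE; ring.
    by rewrite affine_parallelogram ?lD//; [ring|exact: HA|exact: HA].
  have -> : A (vscl V t x) = vadd V (vscl V t (A x)) (vscl V (1 - t) x0).
    case: (fb) => r [h fc]; rewrite /A; apply: (fc_inj fc); [by auto 8|by auto 8|].
    rewrite lZ// !(fc_D fc, fc_Z fc); auto 8.
    by apply/rowP => j; rewrite !mxE; ring.
  by rewrite fa ?lZ//; [ring|exact: HA].
move=> x [xb lx]; rewrite lx subrr mul0r addr0; congr f.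
case: (fb) => r [h fc]; rewrite /A; apply: (fc_inj fc); [by auto|by auto|].
by rewrite lx subrr (vscl0 fb x0b) (vaddx0 fb xb).
Qed.

(** A hyperplane off the origin spans: [x] is the difference of a point of the hyperplane and a
    multiple of [x0]. *)
Lemma linear_hyperplane_unique f g x0 : H x0 -> linear_on V b f -> linear_on V b g ->
  (forall x, H x -> f x = g x) -> forall x, vfib V b x -> f x = g x.
Proof.
move=> H0 [fD fZ] [gD gZ] fg x xb; have [x0b l0] := H0; have [lD lZ] := l_lin.
have H1 : H (vadd V x (vscl V (1 - l x) x0)).
  by split; [auto|rewrite lD ?lZ; auto; rewrite l0; ring].
have := fg _ H1; rewrite fD ?fZ ?gD ?gZ; auto.
by rewrite (fg _ H0) => /addIr.
Qed.

End AffineExtension.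

Section DaggerCharts.
Context {R : realType} {A B : mfd R} {P : affstr A B}.

Definition gchart n r (c : chart R B n) (s : 'I_r -> B -> A) :
    chart R (B * (A -> R)) (n + r) :=
  (dagger_set P `&` [set u | c.1 u.1], fun u => row_mx (c.2 u.1) (\row_i u.2 (s i u.1))).

Lemma gchart_inj n r (c : chart R B n) (s : 'I_r -> B -> A) :
  chart_inj c -> smooth_affine_frame P c.1 s -> chart_inj (gchart c s).
Proof.
move=> ci [_ ss] [b f] [b' g] [fd cb] [gd cb'] /eq_row_mx[/= ec ee].
have eb := ci _ _ cb cb' ec; rewrite /= in eb cb cb'; rewrite -{b'}eb in gd cb' ee ec *.
have [_ /(_ (fun i => f (s i b)))[u [_ uu]]] := ss b cb.
rewrite -(uu (b, f)) ?(uu (b, g))//; split=> // i /=.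
by have := congr1 (fun M : 'rV_r => M 0 i) ee; rewrite !mxE.
Qed.

Lemma lsm_gchart U m (d : chart R U m) n r (c : chart R B n) (s : 'I_r -> B -> A)
    (g : U -> dagger_mfd P) x :
  lnear d (fun y => dagger_set P (g y)) x -> lsm d c (fun y => (g y).1) x ->
  (forall i, lsmR d (fun y => (g y).2 (s i (g y).1)) x) ->
  lsm d (gchart c s) g x.
Proof.
move=> Vg [ng sg] se; split; first exact: lnear_and.
apply: lsm_row_mx => // i.
by apply: lsmR_ext (se i) => y _; rewrite mxE.
Qed.

End DaggerCharts.

(** Serves the charts of linear and of affine duals alike: both consist of base coordinates followed
    by values on a frame. *)
Lemma lsm_fst (R : realType) (T U : Type) n r (D : set (T * U)) (c : chart R T n)
    (k : T * U -> 'rV[R]_r) x : (forall u, D u -> c.1 u.1) ->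
  lsm ((D, fun u => row_mx (c.2 u.1) (k u)) : chart R _ (n + r)) c fst x /\
  forall i, lsmR ((D, fun u => row_mx (c.2 u.1) (k u)) : chart R _ (n + r))
    (fun u => k u 0 i) x.
Proof.
move=> Dc; split; first split; first by apply: lnear_all => u /Dc.
  by move=> j; apply: lsmR_ext (lsmR_coord _ (lshift r j) _) => u _; rewrite row_mxEl.
by move=> j; apply: lsmR_ext (lsmR_coord _ (rshift n j) _) => u _; rewrite row_mxEr.
Qed.

(** * Linearity of the structure maps of a double vector bundle *)

Section Homogeneity.
Context {R : realType}.

Definition uchart n : chart R 'rV[R]_n n := (setT, id).

Lemma lsm_cst T U m n (c : chart R T m) (d : chart R U n) (y : U) x :
  d.1 y -> lsm c d (fun=> y) x.
Proof. by move=> dy; split; [exact: lnear_all|move=> j; exact: lsmR_cst]. Qed.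

Lemma lsm_differentiable m n (g : 'rV[R]_m -> 'rV[R]_n) x :
  (forall j, lsmR (uchart m) (fun y => g y 0 j) x) -> differentiable g x.
Proof.
move=> sg; apply/differentiable_rvP => j.
have [W [h [oW Wx sh gh]]] := sg j.
apply: (@differentiable_near_eq _ _ _ h); last by have [+ _] := sh 1; apply.
by apply: filterS (open_near oW Wx) => y Wy; rewrite gh.
Qed.

(** In fibre coordinates [G] is a map from the plane, homogeneous of degree 1 and differentiable at
    the origin, hence additive, and [(1,1)] is the sum of [(1,0)] and [(0,1)]. Smoothness may be
    known in any admissible chart [d], which need not be fitted to the bundle. *)
Lemma homogeneous_fibre_additive (E B : mfd R) (V : vbstr E B) (b : B) (G : R -> R -> E)
    n (d : chart R E n) :
  is_vb V -> carrier B b -> (forall s t, vfib V b (G s t)) ->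
  (forall r s t, G (r * s) (r * t) = vscl V r (G s t)) ->
  admissible d -> d.1 (G 0 0) ->
  lsm (uchart 2) d (fun v => G (v 0 0) (v 0 1)) 0 ->
  G 1 1 = vadd V (G 1 0) (G 0 1).
Proof.
move=> Vvb Bb Gb hG ad dG sG.
have [p [r [c [h [pt [lt cb]]]]]] := vb_triv Vvb Bb.
have fc := lt_fib lt cb.
pose g (v : 'rV[R]_2) := h (G (v 0 0) (v 0 1)).
have dg : differentiable g 0.
  apply: lsm_differentiable => j.
  have G00 : G ((0 : 'rV[R]_2) 0 0) ((0 : 'rV[R]_2) 0 1) = G 0 0 by rewrite !mxE.
  have tG : (tchart V c h).1 (G 0 0) by have [EG bG] := Gb 0 0; split=> //=; rewrite bG.
  rewrite -G00 in dG tG.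
  have st := admissible_lsm (vb_total Vvb) ad (tchart_admissible lt) dG tG.
  have {}st := lsm_comp (c := uchart 2) I sG st.
  exact: (lsmR_comp (c := uchart 2) I st (lsmR_fibcoord V j _)).
have hg t v : g (t *: v) = t *: g v by rewrite /g !mxE hG (fc_Z fc).
have := homogeneous_additive dg hg (\row_j (j == 0)%:R) (\row_j (j == 1)%:R).
rewrite /g !mxE /= !(addr0, add0r) => e.
apply: (fc_inj fc) => //; first exact: fc_add fc _ _ _ _.
by rewrite (fc_D fc)// e.
Qed.

(** Additivity gives homogeneity for integer factors only; along the sequence [1 / (n + 1)] the
    difference quotients at 0 are then constantly [f x], so [f] is its differential. *)
Lemma additive_differentiable_linear (V W : normedModType R) (f : V -> W) :
  differentiable f 0 -> (forall x y, f (x + y) = f x + f y) ->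
  forall t x, f (t *: x) = t *: f x.
Proof.
move=> df fD.
have f0 : f 0 = 0 by apply: (addrI (f 0)); rewrite -fD !addr0.
have fn n x : f (x *+ n) = f x *+ n.
  by elim: n => [|n IH]; rewrite ?mulr0n// !mulrS fD IH.
suff E x : f x = 'd f 0 x by move=> t x; rewrite !E linearZ.
have df0 := diff_derivable (v := x) df.
have hm : @harmonic R n @[n --> \oo] --> 0^'.
  move=> P P0; have P1 : nbhs (0 : R) [set y | y != 0 -> P y] := P0.
  have P2 : \forall n \near \oo, harmonic n != 0 :> R -> P (harmonic n) :=
    cvg_harmonic P1.
  by apply: filterS P2 => n; apply; rewrite /= invr_eq0 pnatr_eq0.
have H := cvg_comp _ _ hm df0.
rewrite -deriveE//; apply: cvg_unique H => //.
apply: cvg_near_cst; near=> n.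
rewrite /= addr0 f0 subr0 /harmonic invrK.
by rewrite scaler_nat -fn -scaler_nat scalerA mulfV ?scale1r// pnatr_eq0.
Unshelve. all: by end_near. Qed.

End Homogeneity.

(** Exchanging the two structures turns a statement about [p1] and the second structure into one
    about [p2] and the first. *)
Definition dvb_swap (R : realType) (D : dvb R) : dvb R :=
  @DVB R (dtot D) (dside2 D) (dside1 D) (dbase D)
    (dstr2 D) (dstr1 D) (dstrS2 D) (dstrS1 D).

Lemma is_dvb_swap (R : realType) (D : dvb R) : is_dvb D -> is_dvb (dvb_swap D).
Proof.
move=> [[? ?] [? ?] sq st ps]; split=> //=.
- by move=> x Dx; rewrite sq.
- by move=> s t x Dx; rewrite st.
- by move=> t x Dx; have [] := ps t x Dx.
Qed.

Section DVB.
Context {R : realType} {D : dvb R} (HD : is_dvb D).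

Notation p1 := (vpr (dstr1 D)).
Notation p2 := (vpr (dstr2 D)).
Notation q1 := (vpr (dstrS1 D)).
Notation q2 := (vpr (dstrS2 D)).
Notation add1 := (vadd (dstr1 D)).
Notation add2 := (vadd (dstr2 D)).
Notation s1 := (vscl (dstr1 D)).
Notation s2 := (vscl (dstr2 D)).
Notation z2 := (vzero (dstr2 D)).
Notation addS1 := (vadd (dstrS1 D)).
Notation sS1 := (vscl (dstrS1 D)).
Notation zS1 := (vzero (dstrS1 D)).

Lemma dvb1 : is_vb (dstr1 D). Proof. by case: HD => -[]. Qed.
Lemma dvb2 : is_vb (dstr2 D). Proof. by case: HD => -[]. Qed.
Lemma dvbS1 : is_vb (dstrS1 D). Proof. by case: HD => _ []. Qed.
Lemma dvbS2 : is_vb (dstrS2 D). Proof. by case: HD => _ []. Qed.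

Lemma dsquare x : carrier (dtot D) x -> q1 (p1 x) = q2 (p2 x).
Proof. by case: HD => _ _ + _ _; apply. Qed.

Lemma dscl_comm s t x : carrier (dtot D) x -> s1 s (s2 t x) = s2 t (s1 s x).
Proof. by case: HD => _ _ _ + _; apply. Qed.

Lemma p1_s2 t x : carrier (dtot D) x -> p1 (s2 t x) = sS1 t (p1 x).
Proof. by case: HD => _ _ _ _ h /(h t)[]. Qed.

(** The map [G] follows the combinations of [x] and [y]; it is homogeneous because [p1] intertwines
    [s2] with the homotheties of the side. *)
Lemma p1_add2 x y : carrier (dtot D) x -> carrier (dtot D) y -> p2 x = p2 y ->
  p1 (add2 x y) = addS1 (p1 x) (p1 y).
Proof.
move=> Dx Dy xy; set b := p2 x.
have Bb : carrier (dside2 D) b by apply: vpr_carrier => //; exact: dvb2.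
have fb := vb_is_fib dvb2 Bb.
have xb : vfib (dstr2 D) b x by [].
have yb : vfib (dstr2 D) b y by [].
have gb s t : vfib (dstr2 D) b (add2 (s2 s x) (s2 t y)).
  by apply: vfibD => //; apply: vfibZ.
pose G s t := p1 (add2 (s2 s x) (s2 t y)).
have Mm : carrier (dbase D) (q2 b) by apply: vpr_carrier => //; exact: dvbS2.
have Gm s t : vfib (dstrS1 D) (q2 b) (G s t).
  have [Dg bg] := gb s t; split; first by apply: vpr_carrier => //; exact: dvb1.
  by rewrite /G dsquare// bg.
have [n [r [c [h [pt [lt cb]]]]]] := vb_triv dvb2 Bb.
have [n' [r' [c' [h' [pt' [lt' cm]]]]]] := vb_triv dvbS1 Mm.
have -> : p1 (add2 x y) = G 1 1 by rewrite /G !(vscl1 fb).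
have -> : p1 x = G 1 0 by rewrite /G (vscl1 fb)// (vscl0 fb)// (vaddx0 fb).
have -> : p1 y = G 0 1 by rewrite /G (vscl1 fb)// (vscl0 fb)// (vadd0x fb).
apply: (homogeneous_fibre_additive (b := q2 b) (d := tchart (dstrS1 D) c' h') dvbS1) => //.
- move=> u s t; have [Dg bg] := gb s t.
  rewrite /G -p1_s2// (vsclDr fb); [|exact: vfibZ|exact: vfibZ].
  by rewrite !(vsclA fb).
- exact: tchart_admissible lt'.
- by have [Eg bg] := Gm 0 0; split=> //=; rewrite bg.
have sc u : vfib (dstr2 D) b u -> (tchart (dstr2 D) c h).1 u.
  by case=> Du bu; split=> //=; rewrite bu.
have sg : lsm (uchart 2) (tchart (dstr2 D) c h)
    (fun v : 'rV[R]_2 => add2 (s2 (v 0 0) x) (s2 (v 0 1) y)) 0.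
  apply: (lsm_add lt).
  - by apply: (lsm_scl lt); [apply: lsm_cst; exact: sc|exact: (lsmR_coord (uchart 2))].
  - by apply: (lsm_scl lt); [apply: lsm_cst; exact: sc|exact: (lsmR_coord (uchart 2))].
  - by move=> v _; have [_ ->] := vfibZ fb (v 0 0) xb; have [_ ->] := vfibZ fb (v 0 1) yb.
have [_ sp1] := smooth_vpr dvb1.
set v0 : 'rV[R]_2 := 0.
have gb0 := gb (v0 0 0) (v0 0 1).
have sp := smooth_on_lsm (vb_total dvb1) (vb_base dvb1) sp1 (tchart_admissible lt)
  (tchart_admissible lt') (sc _ gb0) I _.
apply: (lsm_comp (c := uchart 2) I sg (sp _)).
by have [Eg bg] := Gm (v0 0 0) (v0 0 1); split=> //=; rewrite bg.
Qed.

Lemma p1_z2 b : carrier (dside2 D) b -> p1 (z2 b) = zS1 (q2 b).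
Proof.
move=> Bb; have fb := vb_is_fib dvb2 Bb; have zb := vfib0 fb; have [Dz bz] := zb.
rewrite -(vscl0 fb zb) p1_s2//; apply: (vscl0 (vb_is_fib dvbS1 _)).
  by apply: vpr_carrier => //; exact: dvbS2.
by split; [apply: vpr_carrier => //; exact: dvb1|rewrite dsquare// bz].
Qed.

(** Here commutation of the homotheties enters: it makes [s2 t] homogeneous for the first structure,
    and smoothness makes it additive. *)
Lemma s2_add1 t x y : carrier (dtot D) x -> carrier (dtot D) y -> p1 x = p1 y ->
  s2 t (add1 x y) = add1 (s2 t x) (s2 t y).
Proof.
move=> Dx Dy xy; set a := p1 x.
have Aa : carrier (dside1 D) a by apply: vpr_carrier => //; exact: dvb1.
have fa := vb_is_fib dvb1 Aa.
have xa : vfib (dstr1 D) a x by [].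
have ya : vfib (dstr1 D) a y by [].
have ga r s : vfib (dstr1 D) a (add1 (s1 r x) (s1 s y)).
  by apply: vfibD => //; apply: vfibZ.
pose G r s := s2 t (add1 (s1 r x) (s1 s y)).
have ta : carrier (dside1 D) (sS1 t a) by apply: vscl_carrier => //; exact: dvbS1.
have Ga r s : vfib (dstr1 D) (sS1 t a) (G r s).
  have [Dg ag] := ga r s; split; first by apply: vscl_carrier => //; exact: dvb2.
  by rewrite /G p1_s2// ag.
have -> : s2 t (add1 x y) = G 1 1 by rewrite /G !(vscl1 fa).
have -> : s2 t x = G 1 0 by rewrite /G (vscl1 fa)// (vscl0 fa)// (vaddx0 fa).
have -> : s2 t y = G 0 1 by rewrite /G (vscl1 fa)// (vscl0 fa)// (vadd0x fa).
set v0 : 'rV[R]_2 := 0.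
have g0 := ga (v0 0 0) (v0 0 1); set w := add1 _ _ in g0; have [Dw aw] := g0.
have bw : carrier (dside2 D) (p2 w) by apply: vpr_carrier => //; exact: dvb2.
have [n [r [c [h [pt [lt ca]]]]]] := vb_triv dvb1 Aa.
have [n' [r' [c' [h' [pt' [lt' cb]]]]]] := vb_triv dvb2 bw.
apply: (homogeneous_fibre_additive (b := sS1 t a) (d := tchart (dstr2 D) c' h') dvb1) => //.
- move=> u r0 s; have [Dg ag] := ga r0 s.
  rewrite /G dscl_comm// (vsclDr fa); [|exact: vfibZ|exact: vfibZ].
  by rewrite !(vsclA fa).
- exact: tchart_admissible lt'.
- have G00 : G 0 0 = s2 t w by rewrite /G /w !mxE.
  rewrite G00; split; first by apply: vscl_carrier => //; exact: dvb2.
  by rewrite /= vpr_vscl//; exact: dvb2.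
have sc u : vfib (dstr1 D) a u -> (tchart (dstr1 D) c h).1 u.
  by case=> Du au; split=> //=; rewrite au.
have sg : lsm (uchart 2) (tchart (dstr1 D) c h)
    (fun v : 'rV[R]_2 => add1 (s1 (v 0 0) x) (s1 (v 0 1) y)) v0.
  apply: (lsm_add lt).
  - by apply: (lsm_scl lt); [apply: lsm_cst; exact: sc|exact: (lsmR_coord (uchart 2))].
  - by apply: (lsm_scl lt); [apply: lsm_cst; exact: sc|exact: (lsmR_coord (uchart 2))].
  - by move=> v _; have [_ ->] := vfibZ fa (v 0 0) xa; have [_ ->] := vfibZ fa (v 0 1) ya.
have st : lsm (tchart (dstr1 D) c h) (tchart (dstr2 D) c' h') (s2 t) w.
  apply: (lsm_scl lt'); last exact: lsmR_cst.
  apply: (admissible_lsm (vb_total dvb1)) => //; first exact: tchart_admissible lt.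
    exact: tchart_admissible lt'.
  exact: sc.
exact: (lsm_comp (c := uchart 2) I sg st).
Qed.

End DVB.

Section DVBLinear.
Context {R : realType} {D : dvb R} (HD : is_dvb D).

Notation p1 := (vpr (dstr1 D)).
Notation p2 := (vpr (dstr2 D)).
Notation q1 := (vpr (dstrS1 D)).
Notation q2 := (vpr (dstrS2 D)).
Notation add1 := (vadd (dstr1 D)).
Notation add2 := (vadd (dstr2 D)).
Notation s1 := (vscl (dstr1 D)).
Notation s2 := (vscl (dstr2 D)).
Notation z1 := (vzero (dstr1 D)).
Notation z2 := (vzero (dstr2 D)).
Notation addS2 := (vadd (dstrS2 D)).
Notation sS2 := (vscl (dstrS2 D)).
Notation zS1 := (vzero (dstrS1 D)).
Notation zS2 := (vzero (dstrS2 D)).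

Let HD' := is_dvb_swap HD.
Let V1 := dvb1 HD.
Let V2 := dvb2 HD.
Let VS1 := dvbS1 HD.
Let VS2 := dvbS2 HD.

Lemma p2_s1 t x : carrier (dtot D) x -> p2 (s1 t x) = sS2 t (p2 x).
Proof. exact: (p1_s2 HD'). Qed.

Lemma p2_add1 x y : carrier (dtot D) x -> carrier (dtot D) y -> p1 x = p1 y ->
  p2 (add1 x y) = addS2 (p2 x) (p2 y).
Proof. exact: (p1_add2 HD'). Qed.

Lemma p2_z1 a : carrier (dside1 D) a -> p2 (z1 a) = zS2 (q1 a).
Proof. exact: (p1_z2 HD'). Qed.

Lemma s1_add2 t x y : carrier (dtot D) x -> carrier (dtot D) y -> p2 x = p2 y ->
  s1 t (add2 x y) = add2 (s1 t x) (s1 t y).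
Proof. exact: (s2_add1 HD'). Qed.

(** With [x], [y] scaled by [s] and [z], [w] by [t], the right-hand side becomes a map of [(s, t)]
    into one fibre over D_2, homogeneous by [s2_add1]. Its values at [(1,0)] and [(0,1)] are the two
    summands on the left. *)
Lemma interchange x y z w : carrier (dtot D) x -> carrier (dtot D) y ->
  carrier (dtot D) z -> carrier (dtot D) w ->
  p1 x = p1 y -> p1 z = p1 w -> p2 x = p2 z -> p2 y = p2 w ->
  add2 (add1 x y) (add1 z w) = add1 (add2 x z) (add2 y w).
Proof.
move=> Dx Dy Dz Dw xy zw xz yw.
set b := p2 x; set b' := p2 y.
have Bb : carrier (dside2 D) b by apply: vpr_carrier.
have Bb' : carrier (dside2 D) b' by apply: vpr_carrier.
have fb := vb_is_fib V2 Bb; have fb' := vb_is_fib V2 Bb'.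
have xb : vfib (dstr2 D) b x by [].
have zb : vfib (dstr2 D) b z by [].
have yb : vfib (dstr2 D) b' y by [].
have wb : vfib (dstr2 D) b' w by [].
have gx s t : vfib (dstr2 D) b (add2 (s2 s x) (s2 t z)).
  by apply: vfibD => //; apply: vfibZ.
have gy s t : vfib (dstr2 D) b' (add2 (s2 s y) (s2 t w)).
  by apply: vfibD => //; apply: vfibZ.
have e1 s t : p1 (add2 (s2 s x) (s2 t z)) = p1 (add2 (s2 s y) (s2 t w)).
  have [Dsx sx] := vfibZ fb s xb; have [Dtz tz] := vfibZ fb t zb.
  have [Dsy sy] := vfibZ fb' s yb; have [Dtw tw] := vfibZ fb' t wb.
  rewrite !p1_add2 ?sx ?tz ?sy ?tw// !(p1_s2 HD)//.
  by rewrite xy zw.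
pose G s t := add1 (add2 (s2 s x) (s2 t z)) (add2 (s2 s y) (s2 t w)).
have sumb : vpr (dstr2 D) (add1 x y) = addS2 b b' by rewrite p2_add1.
have Bbb' : carrier (dside2 D) (addS2 b b').
  by rewrite -sumb; apply: vpr_carrier => //; exact: vadd_carrier.
have Gb s t : vfib (dstr2 D) (addS2 b b') (G s t).
  have [Dg bg] := gx s t; have [Dg' bg'] := gy s t.
  split; first exact: vadd_carrier.
  by rewrite /G p2_add1// bg bg'.
have <- : G 1 1 = add1 (add2 x z) (add2 y w).
  by rewrite /G (vscl1 fb xb) (vscl1 fb zb) (vscl1 fb' yb) (vscl1 fb' wb).
have <- : G 1 0 = add1 x y.
  by rewrite /G (vscl1 fb xb) (vscl0 fb zb) (vscl1 fb' yb) (vscl0 fb' wb)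
    (vaddx0 fb xb) (vaddx0 fb' yb).
have <- : G 0 1 = add1 z w.
  by rewrite /G (vscl0 fb xb) (vscl1 fb zb) (vscl0 fb' yb) (vscl1 fb' wb)
    (vadd0x fb zb) (vadd0x fb' wb).
apply/esym.
set v0 : 'rV[R]_2 := 0.
have gx0 := gx (v0 0 0) (v0 0 1); set u := add2 _ _ in gx0; have [Du ub] := gx0.
have gy0 := gy (v0 0 0) (v0 0 1); set u' := add2 _ _ in gy0; have [Du' ub'] := gy0.
have uu' : p1 u = p1 u' by exact: e1.
have Aa : carrier (dside1 D) (p1 u) by apply: vpr_carrier.
have [n [r [c [h [pt [lt cb]]]]]] := vb_triv V2 Bb.
have [n' [r' [c' [h' [pt' [lt' cb']]]]]] := vb_triv V2 Bb'.
have [k [l [d [g [pd [ltd da]]]]]] := vb_triv V1 Aa.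
apply: (homogeneous_fibre_additive (b := addS2 b b') (d := tchart (dstr1 D) d g) V2) => //.
- move=> a s t; have [Dg bg] := gx s t; have [Dg' bg'] := gy s t.
  rewrite /G (s2_add1 HD)//.
  rewrite (vsclDr fb _ (vfibZ fb _ xb) (vfibZ fb _ zb)).
  rewrite (vsclDr fb' _ (vfibZ fb' _ yb) (vfibZ fb' _ wb)).
  by rewrite (vsclA fb _ _ xb) (vsclA fb _ _ zb) (vsclA fb' _ _ yb) (vsclA fb' _ _ wb).
- exact: tchart_admissible ltd.
- have -> : G 0 0 = add1 u u' by rewrite /G /u /u' !mxE.
  by split; [exact: vadd_carrier|rewrite /= vpr_vadd].
have sc v : vfib (dstr2 D) b v -> (tchart (dstr2 D) c h).1 v.
  by case=> Dv bv; split=> //=; rewrite bv.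
have sc' v : vfib (dstr2 D) b' v -> (tchart (dstr2 D) c' h').1 v.
  by case=> Dv bv; split=> //=; rewrite bv.
have coord i := lsmR_coord (uchart 2) i v0.
apply: (lsm_add ltd).
- apply: (lsm_comp (c := uchart 2) (d := tchart (dstr2 D) c h) (g := id) I).
    apply: (lsm_add lt).
    + by apply: (lsm_scl lt) (coord _); apply: lsm_cst; exact: sc.
    + by apply: (lsm_scl lt) (coord _); apply: lsm_cst; exact: sc.
    + by move=> v _; have [_ ->] := vfibZ fb (v 0 0) xb; have [_ ->] := vfibZ fb (v 0 1) zb.
  apply: (admissible_lsm (vb_total V2)); [exact: tchart_admissible lt|
    exact: tchart_admissible ltd|exact: sc|by split].
- apply: (lsm_comp (c := uchart 2) (d := tchart (dstr2 D) c' h') (g := id) I).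
    apply: (lsm_add lt').
    + by apply: (lsm_scl lt') (coord _); apply: lsm_cst; exact: sc'.
    + by apply: (lsm_scl lt') (coord _); apply: lsm_cst; exact: sc'.
    + by move=> v _; have [_ ->] := vfibZ fb' (v 0 0) yb; have [_ ->] := vfibZ fb' (v 0 1) wb.
  apply: (admissible_lsm (vb_total V2)); [exact: tchart_admissible lt'|
    exact: tchart_admissible ltd|exact: sc'|by split=> //=; rewrite -/u' -uu'].
- by move=> v _; exact: e1.
Qed.

(** * The core, and surjectivity onto the fibre product of the sides *)

Lemma core_fib1 c : carrier (core D) c -> vfib (dstr1 D) (zS1 (dpr c)) c.
Proof. by move=> [Dc [c1 c2]]. Qed.

Lemma core_fib2 c : carrier (core D) c -> vfib (dstr2 D) (zS2 (dpr c)) c.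
Proof. by move=> [Dc [c1 c2]]. Qed.

Lemma dpr_carrier x : carrier (dtot D) x -> carrier (dbase D) (dpr x).
Proof. by move=> Dx; apply: vpr_carrier => //; exact: vpr_carrier. Qed.

(** Both zeros result from multiplying by 0 in both structures, and the order does not matter. *)
Lemma double_zero m : carrier (dbase D) m -> z1 (zS1 m) = z2 (zS2 m).
Proof.
move=> Mm; have A0 := vzero_carrier VS1 Mm; have B0 := vzero_carrier VS2 Mm.
have [Dz zp] := vfib0 (vb_is_fib V2 B0).
have fA := vb_is_fib V1 A0.
have zA : vfib (dstr1 D) (zS1 m) (z2 (zS2 m)).
  by split=> //; rewrite (p1_z2 HD)// vpr_vzero.
rewrite -(vscl0 fA zA) -{1}(vscl0 (vb_is_fib V2 B0) (x := z2 (zS2 m))) //.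
rewrite dscl_comm//; apply: (vscl0 (vb_is_fib V2 B0)).
split; first exact: vscl_carrier.
by rewrite p2_s1// vpr_vzero// (vsclx0 (vb_is_fib VS2 Mm)).
Qed.

(** The Eckmann-Hilton argument: the interchange law for [c + 0] and [0 + c'], the zeros of the two
    structures being the same. *)
Lemma core_add12 c c' : carrier (core D) c -> carrier (core D) c' -> dpr c = dpr c' ->
  add2 c c' = add1 c c'.
Proof.
move=> Cc Cc' e; set m := dpr c.
have [Dc _] := Cc; have [Dc' _] := Cc'.
have Mm : carrier (dbase D) m by exact: dpr_carrier.
have A0 := vzero_carrier VS1 Mm; have B0 := vzero_carrier VS2 Mm.
have fA := vb_is_fib V1 A0; have fB := vb_is_fib V2 B0.
have [Dz zA] := vfib0 fA; have [_ zB] := vfib0 fB; rewrite -double_zero// in zB.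
have [_ c1] := core_fib1 Cc; have [_ c2] := core_fib2 Cc.
have [_ c1'] := core_fib1 Cc'; have [_ c2'] := core_fib2 Cc'.
rewrite -e in c1' c2'.
have := interchange (x := c) (y := z1 (zS1 m)) (z := z1 (zS1 m)) (w := c').
rewrite c1 c2 c1' c2' zA zB => /(_ Dc Dz Dz Dc' erefl erefl erefl erefl).
rewrite (vaddx0 fA)// (vadd0x fA)// double_zero//.
by rewrite (vaddx0 fB)// (vadd0x fB).
Qed.

(** Since the two additions agree on the core, [s |-> s2 s c] is additive for the first structure;
    being differentiable at 0, it is linear, and its value at 1 is [c]. *)
Lemma core_s12 t c : carrier (core D) c -> s2 t c = s1 t c.
Proof.
move=> Cc; have [Dc _] := Cc; set m := dpr c.
have Mm : carrier (dbase D) m by exact: dpr_carrier.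
have A0 := vzero_carrier VS1 Mm; have B0 := vzero_carrier VS2 Mm.
have fA := vb_is_fib V1 A0; have fB := vb_is_fib V2 B0.
have cA : vfib (dstr1 D) (zS1 m) c by exact: core_fib1.
have cB : vfib (dstr2 D) (zS2 m) c by exact: core_fib2.
have [n [r [d [h [pt [lt dA]]]]]] := vb_triv V1 A0.
have [n' [r' [d' [h' [pt' [lt' dB]]]]]] := vb_triv V2 B0.
have fc := lt_fib lt dA.
have sA s : vfib (dstr1 D) (zS1 m) (s2 s c).
  split; first exact: vscl_carrier.
  by rewrite (p1_s2 HD)//; have [_ ->] := cA; rewrite (vsclx0 (vb_is_fib VS1 Mm)).
have sB s : vfib (dstr2 D) (zS2 m) (s2 s c) by exact: vfibZ.
have sC s : carrier (core D) (s2 s c).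
  have [Ds as_] := sA s; have [_ bs] := sB s.
  have ds : dpr (s2 s c) = m by rewrite /dpr as_ vpr_vzero.
  by split=> //; split; rewrite ds.
pose f (v : 'rV[R]_1) := h (s2 (v 0 0) c).
have df : differentiable f 0.
  apply: lsm_differentiable => j.
  have st : lsm (uchart 1) (tchart (dstr2 D) d' h') (fun v : 'rV[R]_1 => s2 (v 0 0) c) 0.
    apply: (lsm_scl lt'); last exact: (lsmR_coord (uchart 1)).
    by apply: lsm_cst; split=> //=; have [_ ->] := cB.
  have [Ds as_] := sA ((0 : 'rV[R]_1) 0 0); have [_ bs] := sB ((0 : 'rV[R]_1) 0 0).
  have st' : lsm (tchart (dstr2 D) d' h') (tchart (dstr1 D) d h) id
      (s2 ((0 : 'rV[R]_1) 0 0) c).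
    apply: (admissible_lsm (vb_total V2)); [exact: tchart_admissible lt'|
      exact: tchart_admissible lt|by split=> //=; rewrite bs|by split=> //=; rewrite as_].
  have := lsm_comp (c := uchart 1) I st st' => {}st.
  exact: (lsmR_comp (c := uchart 1) I st (lsmR_fibcoord (dstr1 D) j _)).
have fD u v : f (u + v) = f u + f v.
  rewrite /f mxE (vsclDl fB)// core_add12//; last first.
    by rewrite /dpr; have [_ ->] := sA (u 0 0); have [_ ->] := sA (v 0 0).
  exact: fc_D fc _ _ (sA _) (sA _).
have := additive_differentiable_linear df fD t (const_mx 1).
rewrite /f !mxE mulr1 (vscl1 fB)// => e.
by apply: (fc_inj fc (sA t) (vfibZ fA t cA)); rewrite e (fc_Z fc).
Qed.

Lemma p1_linear b r (hS : dside1 D -> 'rV[R]_r) j : carrier (dside2 D) b ->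
  fib_coord (dstrS1 D) (q2 b) hS ->
  linear_on (dstr2 D) b (fun x => hS (p1 x) 0 j).
Proof.
move=> Bb fc.
have m1 x : vfib (dstr2 D) b x -> vfib (dstrS1 D) (q2 b) (p1 x).
  by move=> [Dx xb]; split; [exact: vpr_carrier|rewrite (dsquare HD)// xb].
split=> [x y xb yb|t x xb].
  have [Dx bx] := xb; have [Dy by_] := yb.
  by rewrite (p1_add2 HD)// ?bx// (fc_D fc) ?mxE//; exact: m1.
have [Dx bx] := xb.
by rewrite (p1_s2 HD)// (fc_Z fc) ?mxE//; exact: m1.
Qed.

(* The rank of p1 on the fibre over t b is the one over b for t <> 0, and it is
   maximal for t = 0, hence for t small. *)
Lemma double_surjective a b : carrier (dside1 D) a -> carrier (dside2 D) b ->
  q1 a = q2 b -> exists x, [/\ carrier (dtot D) x, p1 x = a & p2 x = b].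
Proof.
move=> Aa Bb ab; set m := q1 a.
have Mm : carrier (dbase D) m by exact: vpr_carrier.
have A0 := vzero_carrier VS1 Mm; have B0 := vzero_carrier VS2 Mm.
have [k [r1 [cS [hS [ptS [ltS cSm]]]]]] := vb_triv VS1 Mm.
have [n [r [c [h [pt [lt cz]]]]]] := vb_triv V2 B0.
have fcS := lt_fib ltS cSm.
pose e i b := pt b (delta_mx 0 i).
pose P b := \matrix_(i, j) hS (p1 (e i b)) 0 j.
have eP b' (cb' : c.1 b') i : vfib (dstr2 D) b' (e i b') /\ h (e i b') = delta_mx 0 i.
  exact: (lt_pt lt _ cb').
have hP x : carrier (dtot D) x -> c.1 (p2 x) -> q2 (p2 x) = m ->
    hS (p1 x) = h x *m P (p2 x).
  move=> Dx cx xm; have Bx : carrier (dside2 D) (p2 x) by exact: vpr_carrier.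
  rewrite (fc_linear_mx (lt_fib lt cx) (eP _ cx) (L := fun x => hS (p1 x))) //.
  by move=> j; apply: p1_linear => //; rewrite xm.
have sP i j : lsmR c (fun b => P b i j) (zS2 m).
  apply: (@lsmR_ext _ _ _ _ _ (fun b => hS (p1 (e i b)) 0 j)).
    by move=> y _; rewrite mxE.
  have s0 : lsm c (tchart (dstr2 D) c h) (e i) (zS2 m).
    by apply: (lsm_pt lt); [exact: lsm_id|move=> l; exact: lsmR_cst].
  have [[De be] _] := eP _ cz i.
  have [_ sp] := smooth_vpr V1.
  have te : (tchart (dstr2 D) c h).1 (e i (zS2 m)) by split=> //=; rewrite be.
  have tpe : (tchart (dstrS1 D) cS hS).1 (p1 (e i (zS2 m))).
    split; first by apply: vpr_carrier.
    by rewrite /= (dsquare HD)// be vpr_vzero.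
  have s1_ := smooth_on_lsm (vb_total V1) (vb_base V1) sp (tchart_admissible lt)
    (tchart_admissible ltS) te I tpe.
  have s2_ := lsm_comp cz s0 s1_.
  exact: (lsmR_comp cz s2_ (lsmR_fibcoord (dstrS1 D) j _)).
(* Over the zero of D_2 the zero section [z1] is a right inverse of [p1]; the rows of [N0] are the
   coordinates of its values on a basis. *)
pose N0 := \matrix_i h (z1 (ptS m (delta_mx 0 i))).
have N0P : N0 *m P (zS2 m) = 1%:M.
  apply/row_matrixP => i; rewrite row_mul rowK.
  have [[Ai im] hi] := lt_pt ltS (delta_mx 0 i) cSm.
  have [Dz az] := vfib0 (vb_is_fib V1 Ai).
  have bz : p2 (z1 (ptS m (delta_mx 0 i))) = zS2 m by rewrite (p2_z1)// im.
  have := hP _ Dz; rewrite bz => <- //; last by rewrite vpr_vzero.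
  by rewrite az hi rowE mulmx1.
pose Q b := N0 *m P b.
have sQ i j : lsmR c (fun b => Q b i j) (zS2 m).
  by apply: lsmR_mulmx => // k' l; exact: lsmR_cst.
have nQ : lnear c (fun b => c.1 b /\ Q b \in unitmx) (zS2 m).
  apply: lnear_and; first exact: lnear_all.
  by apply: lsmR_unitmx => //; rewrite /Q N0P unitmx1.
have [n' [r' [c' [h' [pt' [lt' cm']]]]]] := vb_triv VS2 Mm.
have bm : vfib (dstrS2 D) m b by split.
have fb := vb_is_fib VS2 Mm.
have st : lsm (@rchart R) c (fun t => sS2 t b) 0.
  have s0 : lsm (@rchart R) (tchart (dstrS2 D) c' h') (fun t => sS2 t b) 0.
    apply: (lsm_scl lt').
      by apply: lsm_cst; split=> //=; rewrite -ab.
    by apply: lsmR_ext (lsmR_coord (@rchart R) 0 _) => t _; rewrite mxE.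
  have st' : lsm (tchart (dstrS2 D) c' h') c id (sS2 0 b).
    rewrite (vscl0 fb bm); apply: (admissible_lsm (vb_total VS2)) => //.
    - exact: tchart_admissible lt'.
    - exact: lt_base lt.
    - by split=> //=; rewrite vpr_vzero.
  exact: (lsm_comp (c := @rchart R) I s0 st').
have z0 : zS2 m = sS2 0 b by rewrite (vscl0 fb bm).
rewrite z0 in nQ; have := lnear_comp (c := @rchart R) I st nQ.
move=> /lnear_rchart_neq0[t t0 [ct uQ]].
(* Since [Q] is [N0 *m P], the row [v] solves [v *m P (sS2 t b) = hS a]. *)
pose v := hS a *m invmx (Q (sS2 t b)) *m N0.
have [xt hx] := lt_pt lt v ct; set x := pt _ _ in xt hx; have [Dx bx] := xt.
have tm : q2 (sS2 t b) = m by have [] := vfibZ fb t bm.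
have p1x : p1 x = a.
  apply: (fc_inj fcS) => //.
    by split; [exact: vpr_carrier|rewrite (dsquare HD)// bx].
  rewrite hP ?bx// hx /v -mulmxA -/(Q _) -mulmxA mulVmx// mulmx1//.
(* Division by [t] in the structure over D_1 keeps [p1] and brings the second projection from [t b]
   back to [b]. *)
exists (s1 t^-1 x); split; first exact: vscl_carrier.
  by rewrite vpr_vscl.
by rewrite (p2_s1)// bx (vsclA fb)// mulVf// (vscl1 fb).
Qed.

End DVBLinear.

(** * The vertical dual and the affine dual *)

Section Duality.
Context {R : realType} {D : dvb R} (HD : is_dvb D).

Notation p1 := (vpr (dstr1 D)).
Notation p2 := (vpr (dstr2 D)).
Notation q1 := (vpr (dstrS1 D)).
Notation q2 := (vpr (dstrS2 D)).
Notation add1 := (vadd (dstr1 D)).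
Notation add2 := (vadd (dstr2 D)).
Notation s1 := (vscl (dstr1 D)).
Notation s2 := (vscl (dstr2 D)).
Notation z1 := (vzero (dstr1 D)).
Notation z2 := (vzero (dstr2 D)).
Notation addS1 := (vadd (dstrS1 D)).
Notation addS2 := (vadd (dstrS2 D)).
Notation sS1 := (vscl (dstrS1 D)).
Notation sS2 := (vscl (dstrS2 D)).
Notation zS1 := (vzero (dstrS1 D)).
Notation zS2 := (vzero (dstrS2 D)).

Let V1 := dvb1 HD.
Let V2 := dvb2 HD.
Let VS1 := dvbS1 HD.
Let VS2 := dvbS2 HD.

Lemma s1_0 x : carrier (dtot D) x -> s1 0 x = z1 (p1 x).
Proof. by move=> Dx; apply: (vscl0 (vpr_fib V1 Dx)). Qed.

Lemma s2_0 x : carrier (dtot D) x -> s2 0 x = z2 (p2 x).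
Proof. by move=> Dx; apply: (vscl0 (vpr_fib V2 Dx)). Qed.

(** As [z2 (p2 x)] is [s2 0 x], linearity of the zero section is linearity of a homothety, with
    factor 0. *)
Lemma z2_addS b b' : carrier (dside2 D) b -> carrier (dside2 D) b' -> q2 b = q2 b' ->
  z2 (addS2 b b') = add1 (z2 b) (z2 b').
Proof.
move=> Bb Bb' e.
have [Dz zb] := vfib0 (vb_is_fib V2 Bb); have [Dz' zb'] := vfib0 (vb_is_fib V2 Bb').
have e1 : p1 (z2 b) = p1 (z2 b') by rewrite !(p1_z2 HD)// e.
rewrite -{1}zb -{1}zb' -(p2_add1 HD)// -s2_0; last exact: vadd_carrier.
by rewrite (s2_add1 HD)// !s2_0// zb zb'.
Qed.

Lemma z2_sS t b : carrier (dside2 D) b -> z2 (sS2 t b) = s1 t (z2 b).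
Proof.
move=> Bb; have [Dz zb] := vfib0 (vb_is_fib V2 Bb).
rewrite -{1}zb -(p2_s1 HD)// -s2_0; last exact: vscl_carrier.
by rewrite -(dscl_comm HD)// s2_0// zb.
Qed.

Lemma z1_sS t a : carrier (dside1 D) a -> z1 (sS1 t a) = s2 t (z1 a).
Proof.
move=> Aa; have [Dz za] := vfib0 (vb_is_fib V1 Aa).
rewrite -{1}za -(p1_s2 HD)// -s1_0; last exact: vscl_carrier.
by rewrite (dscl_comm HD)// s1_0// za.
Qed.

Lemma z1_addS a a' : carrier (dside1 D) a -> carrier (dside1 D) a' -> q1 a = q1 a' ->
  z1 (addS1 a a') = add2 (z1 a) (z1 a').
Proof.
move=> Aa Aa' e.
have [Dz za] := vfib0 (vb_is_fib V1 Aa); have [Dz' za'] := vfib0 (vb_is_fib V1 Aa').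
have e1 : p2 (z1 a) = p2 (z1 a') by rewrite !(p2_z1 HD)// e.
rewrite -{1}za -{1}za' -(p1_add2 HD)// -s1_0; last exact: vadd_carrier.
by rewrite (s1_add2 HD)// !s1_0// za za'.
Qed.

Lemma core_vfib m c : vfib (core_str D) m c <->
  [/\ carrier (dtot D) c, p1 c = zS1 m, p2 c = zS2 m & carrier (dbase D) m].
Proof.
split=> [[[Dc [c1 c2]] cm]|[Dc c1 c2 Mm]].
  by rewrite -cm; split=> //; exact: dpr_carrier.
have cm : dpr c = m by rewrite /dpr c1 vpr_vzero.
by split=> //; split=> //; split; rewrite cm.
Qed.

Lemma core_vfibD m c c' : vfib (core_str D) m c -> vfib (core_str D) m c' ->
  vfib (core_str D) m (add1 c c').
Proof.
move=> /core_vfib[Dc c1 c2 Mm] /core_vfib[Dc' c1' c2' _]; apply/core_vfib.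
have e : p1 c = p1 c' by rewrite c1.
split=> //; first exact: vadd_carrier; first by rewrite vpr_vadd.
by rewrite (p2_add1 HD)// c2 c2' (vaddx0 (vb_is_fib VS2 Mm))//; apply: vfib0; apply: vb_is_fib.
Qed.

Lemma core_vfibZ m t c : vfib (core_str D) m c -> vfib (core_str D) m (s1 t c).
Proof.
move=> /core_vfib[Dc c1 c2 Mm]; apply/core_vfib.
split=> //; first exact: vscl_carrier; first by rewrite vpr_vscl.
by rewrite (p2_s1 HD)// c2 (vsclx0 (vb_is_fib VS2 Mm)).
Qed.

Lemma core_vfib_zero m : carrier (dbase D) m -> vfib (core_str D) m (z1 (zS1 m)).
Proof.
move=> Mm; have A0 := vzero_carrier VS1 Mm.
have [Dz za] := vfib0 (vb_is_fib V1 A0); apply/core_vfib; split=> //.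
by rewrite (p2_z1 HD)// vpr_vzero.
Qed.

Lemma core_at_vfib a c : carrier (dside1 D) a -> vfib (core_str D) (q1 a) c ->
  vfib (dstr1 D) a (core_at a c) /\ p2 (core_at a c) = zS2 (q1 a).
Proof.
move=> Aa /core_vfib[Dc c1 c2 Mm].
have [Dz za] := vfib0 (vb_is_fib V1 Aa).
have e : p2 (z1 a) = p2 c by rewrite (p2_z1 HD).
split; [split|]; first exact: vadd_carrier.
  by rewrite /core_at (p1_add2 HD)// za c1 (vaddx0 (vb_is_fib VS1 Mm)).
by rewrite /core_at vpr_vadd// (p2_z1 HD).
Qed.

Lemma core_atD a c c' : carrier (dside1 D) a -> vfib (core_str D) (q1 a) c ->
  vfib (core_str D) (q1 a) c' ->
  core_at a (add1 c c') = add1 (core_at a c) (core_at a c').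
Proof.
move=> Aa /core_vfib[Dc c1 c2 Mm] /core_vfib[Dc' c1' c2' _].
have [Dz za] := vfib0 (vb_is_fib V1 Aa).
rewrite /core_at -(interchange HD) ?(p2_z1 HD) ?c1 ?c2//.
by rewrite (vaddx0 (vb_is_fib V1 Aa)).
Qed.

Lemma core_atZ a t c : carrier (dside1 D) a -> vfib (core_str D) (q1 a) c ->
  core_at a (s1 t c) = s1 t (core_at a c).
Proof.
move=> Aa /core_vfib[Dc c1 c2 Mm].
have [Dz za] := vfib0 (vb_is_fib V1 Aa).
rewrite /core_at (s1_add2 HD) ?(p2_z1 HD) ?c2//.
by rewrite (vsclx0 (vb_is_fib V1 Aa)).
Qed.

Lemma core_at_zero m c : vfib (core_str D) m c -> core_at (zS1 m) c = c.
Proof.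
move=> /core_vfib[Dc c1 c2 Mm]; have B0 := vzero_carrier VS2 Mm.
by rewrite /core_at (double_zero HD)// (vadd0x (vb_is_fib V2 B0)).
Qed.

(* Meaningful over the zero section of the first side only, where it is the core
   component. *)
Definition core_part (x : dtot D) : dtot D := vsub (dstr1 D) x (z2 (p2 x)).

Section OverZero.
Variable m : dbase D.
Hypothesis Mm : carrier (dbase D) m.

Let A0 := vzero_carrier VS1 Mm.
Let f0 := vb_is_fib V1 A0.

Lemma z2_over_zero x : vfib (dstr1 D) (zS1 m) x ->
  vfib (dstr1 D) (zS1 m) (z2 (p2 x)) /\ q2 (p2 x) = m.
Proof.
move=> [Dx x0]; have xm : q2 (p2 x) = m by rewrite -(dsquare HD)// x0 vpr_vzero.
have Bb : carrier (dside2 D) (p2 x) by exact: vpr_carrier.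
split=> //; split; first exact: vzero_carrier.
by rewrite (p1_z2 HD)// xm.
Qed.

Lemma core_part_vfib x : vfib (dstr1 D) (zS1 m) x ->
  vfib (core_str D) m (core_part x).
Proof.
move=> x0; have [z0 xm] := z2_over_zero x0.
have [Dx _] := x0; have [Dz za] := z0.
have [Dv va] := vfibB f0 x0 z0.
have [Ds sa] := vfibZ f0 (-1) z0.
apply/core_vfib; split=> //.
have e : p1 x = p1 (s1 (-1) (z2 (p2 x))) by rewrite sa; case: x0.
have Bb : carrier (dside2 D) (p2 x) by exact: vpr_carrier.
have fm := vb_is_fib VS2 Mm; have bm : vfib (dstrS2 D) m (p2 x) by [].
rewrite /core_part /vsub (p2_add1 HD)// (p2_s1 HD)// vpr_vzero//.
by rewrite -{1}(vscl1 fm bm) -(vsclDl fm) // subrr (vscl0 fm).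
Qed.

Lemma core_partK x : vfib (dstr1 D) (zS1 m) x ->
  add1 (z2 (p2 x)) (core_part x) = x.
Proof. by move=> x0; have [z0 _] := z2_over_zero x0; exact: (vsubKC f0). Qed.

Lemma core_part_eq x b c : carrier (dside2 D) b -> q2 b = m ->
  vfib (core_str D) m c -> x = add1 (z2 b) c -> core_part x = c.
Proof.
move=> Bb bm Cc ->; have /core_vfib[Dc c1 c2 _] := Cc.
have fm := vb_is_fib VS2 Mm; have bm' : vfib (dstrS2 D) m b by [].
have [Dz zb] := vfib0 (vb_is_fib V2 Bb).
have z0 : vfib (dstr1 D) (zS1 m) (z2 b) by split=> //; rewrite (p1_z2 HD)// bm.
have e : p1 (z2 b) = p1 c by rewrite c1; case: z0.
rewrite /core_part (p2_add1 HD)// c2 zb (vaddx0 fm)//.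
exact: (vaddKC f0).
Qed.

Lemma core_partD x y : vfib (dstr1 D) (zS1 m) x -> vfib (dstr1 D) (zS1 m) y ->
  core_part (add1 x y) = add1 (core_part x) (core_part y).
Proof.
move=> x0 y0; have [zx xm] := z2_over_zero x0; have [zy ym] := z2_over_zero y0.
have Cx := core_part_vfib x0; have Cy := core_part_vfib y0.
have [Dx _] := x0; have [Dy _] := y0.
have Bx : carrier (dside2 D) (p2 x) by exact: vpr_carrier.
have By : carrier (dside2 D) (p2 y) by exact: vpr_carrier.
have exy : q2 (p2 x) = q2 (p2 y) by rewrite xm.
apply: (@core_part_eq _ (addS2 (p2 x) (p2 y))).
- exact: vadd_carrier.
- by rewrite vpr_vadd.
- exact: core_vfibD.
have /core_vfib[Dcx cx1 _ _] := Cx; have /core_vfib[Dcy cy1 _ _] := Cy.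
rewrite z2_addS// (vaddACA f0)//.
by rewrite !core_partK.
Qed.

Lemma core_partZ t x : vfib (dstr1 D) (zS1 m) x ->
  core_part (s1 t x) = s1 t (core_part x).
Proof.
move=> x0; have [zx xm] := z2_over_zero x0.
have Cx := core_part_vfib x0; have [Dx _] := x0.
have Bx : carrier (dside2 D) (p2 x) by exact: vpr_carrier.
apply: (@core_part_eq _ (sS2 t (p2 x))).
- exact: vscl_carrier.
- by rewrite vpr_vscl.
- exact: core_vfibZ.
have /core_vfib[Dcx cx1 _ _] := Cx.
by rewrite z2_sS// -(vsclDr f0)// core_partK.
Qed.

Lemma core_part_core c : vfib (core_str D) m c -> core_part c = c.
Proof.
move=> Cc; have /core_vfib[Dc c1 c2 _] := Cc.
apply: (@core_part_eq _ (zS2 m)) => //; first exact: vzero_carrier.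
  by rewrite vpr_vzero.
by rewrite -(double_zero HD)// (vadd0x f0).
Qed.

Lemma core_part_z2 b : carrier (dside2 D) b -> q2 b = m ->
  core_part (z2 b) = z1 (zS1 m).
Proof.
move=> Bb bm; apply: (@core_part_eq _ b) => //; first exact: core_vfib_zero.
have [Dz zb] := vfib0 (vb_is_fib V2 Bb).
by rewrite (vaddx0 f0)//; split=> //; rewrite (p1_z2 HD)// bm.
Qed.

(** Write [x] as [x] plus the zero over [a], and [y] as [z2 (p2 y)] plus its core part, and
    interchange: adding over D_2 a vector that lies over the zero of D_1 is a translation by the
    core. *)
Lemma add2_core_part a x y : q1 a = m -> vfib (dstr1 D) a x ->
  vfib (dstr1 D) (zS1 m) y -> p2 x = p2 y ->
  add2 x y = add1 x (core_at a (core_part y)).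
Proof.
move=> am [Dx xa] y0 e; have [z0 ym] := z2_over_zero y0.
have Cy := core_part_vfib y0; have /core_vfib[Dc c1 c2 _] := Cy.
have Aa : carrier (dside1 D) a by rewrite -xa; exact: vpr_carrier.
have [Dz za] := vfib0 (vb_is_fib V1 Aa); have [Dzy zy] := z0.
have [Dy _] := y0; have Bb : carrier (dside2 D) (p2 y) by exact: vpr_carrier.
have := interchange HD (x := x) (y := z1 a) (z := z2 (p2 y)) (w := core_part y).
rewrite zy c1 xa za e (vpr_vzero V2)// (p2_z1 HD)// am c2.
move=> /(_ Dx Dz Dzy Dc erefl erefl erefl erefl).
rewrite core_partK// (vaddx0 (vb_is_fib V1 Aa))// => ->.
by rewrite -e (vaddx0 (vpr_fib V2 Dx)).
Qed.

End OverZero.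

(** * Existence and uniqueness of the operations of the vertical dual *)

Lemma vdual_pr2E (u : vdual_tot D) c : vfib (core_str D) (q1 u.1) c ->
  (vdual_pr2 u).2 c = u.2 (core_at u.1 c).
Proof. by move=> Cc; rewrite /= ext0E. Qed.

Lemma vdual_pr2_carrier (u : vdual_tot D) : carrier (vdual_tot D) u ->
  carrier (vdual_side2 D) (vdual_pr2 u).
Proof.
move=> [Au [uD uZ] _]; split; first exact: vpr_carrier.
  split=> [x y Cx Cy|t x Cx]; rewrite !vdual_pr2E//.
  - have [ax _] := core_at_vfib Au Cx; have [ay _] := core_at_vfib Au Cy.
    by rewrite (core_atD)// uD.
  - exact: core_vfibD.
  - have [ax _] := core_at_vfib Au Cx.
    by rewrite (core_atZ)// uZ.
  - exact: core_vfibZ.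
exact: ext0_id.
Qed.

Lemma vdual_add2_core_part (u : vdual_tot D) m x y : carrier (vdual_tot D) u ->
  q1 u.1 = m -> vfib (dstr1 D) u.1 x -> vfib (dstr1 D) (zS1 m) y -> p2 x = p2 y ->
  u.2 (add2 x y) = u.2 x + (vdual_pr2 u).2 (core_part y).
Proof.
move=> [Au [uD uZ] _] um xa y0 e.
have Mm : carrier (dbase D) m by rewrite -um; exact: vpr_carrier.
have Cy := core_part_vfib Mm y0; rewrite -um in Cy.
have [ay _] := core_at_vfib Au Cy.
by rewrite (add2_core_part Mm um xa y0 e) uD// vdual_pr2E.
Qed.

(** Surjectivity onto the fibre product gives some [x] over [a] with the second projection of [z];
    the difference of [z] and [x] over D_2 then lies over [a']. *)
Lemma add2_decomposition a a' z : carrier (dside1 D) a -> carrier (dside1 D) a' ->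
  q1 a = q1 a' -> vfib (dstr1 D) (addS1 a a') z -> exists x y,
  [/\ vfib (dstr1 D) a x, vfib (dstr1 D) a' y, p2 x = p2 y & z = add2 x y].
Proof.
move=> Aa Aa' e [Dz za]; have Bb : carrier (dside2 D) (p2 z) by exact: vpr_carrier.
have ab : q1 a = q2 (p2 z) by rewrite -(dsquare HD)// za vpr_vadd.
have [x [Dx xa xz]] := double_surjective HD Aa Bb ab.
have fb := vb_is_fib V2 Bb.
have zb : vfib (dstr2 D) (p2 z) z by []. have xb : vfib (dstr2 D) (p2 z) x by [].
have [Dy yb] := vfibB fb zb xb.
have [Dnx nxb] := vfibZ fb (-1) xb.
have fm := vb_is_fib VS1 (vpr_carrier VS1 Aa).
have am : vfib (dstrS1 D) (q1 a) a by [].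
have am' : vfib (dstrS1 D) (q1 a) a' by [].
exists x, (vsub (dstr2 D) z x); split=> //; last by rewrite (vsubKC fb).
  split=> //; rewrite /vsub (p1_add2 HD) ?nxb// (p1_s2 HD)// za xa.
  exact: (vaddKC fm).
by rewrite yb.
Qed.

(** The two decompositions differ by a vector [w] over the zero of D_1, with [x = x' + w] and
    [y' = y + w]. Each functional sees [w] through its core part only, where [u] and [v] agree. *)
Lemma vdual_add_well_defined (u v : vdual_tot D) x y x' y' :
  carrier (vdual_tot D) u -> carrier (vdual_tot D) v -> vdual_pr2 u = vdual_pr2 v ->
  vfib (dstr1 D) u.1 x -> vfib (dstr1 D) v.1 y -> p2 x = p2 y ->
  vfib (dstr1 D) u.1 x' -> vfib (dstr1 D) v.1 y' -> p2 x' = p2 y' ->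
  add2 x y = add2 x' y' -> u.2 x + v.2 y = u.2 x' + v.2 y'.
Proof.
move=> Du Dv uv xa ya xy xa' ya' xy' e.
have [Dx xu] := xa; have [Dy yv] := ya; have [Dx' xu'] := xa'; have [Dy' yv'] := ya'.
have [Au _ _] := Du.
have m_uv : q1 u.1 = q1 v.1 by case: uv.
have Mm := vpr_carrier VS1 Au.
have Bb : carrier (dside2 D) (p2 x) by exact: vpr_carrier.
have fb := vb_is_fib V2 Bb.
have xx' : p2 x' = p2 x.
  by rewrite -(vpr_vadd V2 Dx Dy xy) e vpr_vadd.
have xb : vfib (dstr2 D) (p2 x) x by []. have yb : vfib (dstr2 D) (p2 x) y by [].
have xb' : vfib (dstr2 D) (p2 x) x' by [].
have yb' : vfib (dstr2 D) (p2 x) y' by split=> //; rewrite -xy'.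
have d := vadd_sub_sub fb xb yb xb' yb' e.
set w := vsub (dstr2 D) x x' in d.
have [Dw wb] : vfib (dstr2 D) (p2 x) w by exact: vfibB.
have [Dnx nxb] := vfibZ fb (-1) xb'.
have fm := vb_is_fib VS1 Mm.
have um : vfib (dstrS1 D) (q1 u.1) u.1 by [].
have w0 : vfib (dstr1 D) (zS1 (q1 u.1)) w.
  split=> //; rewrite /w /vsub (p1_add2 HD) ?nxb// (p1_s2 HD)// xu xu'.
  by rewrite -{1}(vscl1 fm um) -(vsclDl fm)// subrr (vscl0 fm).
have ex : x = add2 x' w by rewrite (vsubKC fb).
have ey : y' = add2 y w by rewrite d (vsubKC fb).
rewrite {1}ex (vdual_add2_core_part Du erefl)//; last by rewrite wb.
rewrite [in RHS]ey (vdual_add2_core_part Dv (esym m_uv))//; last by rewrite wb.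
by rewrite uv addrAC addrA.
Qed.

(** The value at [z] is computed from any decomposition of [z]; linearity over D_1 is then the
    interchange law. *)
Lemma vdual_add_exists (u v : vdual_tot D) :
  carrier (vdual_tot D) u -> carrier (vdual_tot D) v -> vdual_pr2 u = vdual_pr2 v ->
  exists! w, is_vdual_add u v w.
Proof.
move=> Du Dv uv; have [Au [uD uZ] _] := Du; have [Av [vD vZ] _] := Dv.
have m_uv : q1 u.1 = q1 v.1 by case: uv.
set a := addS1 u.1 v.1; have Aa : carrier (dside1 D) a by exact: vadd_carrier.
have fa := vb_is_fib V1 Aa.
have fu := vb_is_fib V1 Au; have fv := vb_is_fib V1 Av.
have Wex z : exists r, forall x y, vfib (dstr1 D) u.1 x -> vfib (dstr1 D) v.1 y ->
    p2 x = p2 y -> z = add2 x y -> r = u.2 x + v.2 y.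
  have [[x [y [xa ya xy ->]]]|nz] := pselect (exists x y,
    [/\ vfib (dstr1 D) u.1 x, vfib (dstr1 D) v.1 y, p2 x = p2 y & z = add2 x y]).
    by exists (u.2 x + v.2 y) => x' y' *; exact: vdual_add_well_defined.
  by exists 0 => x y xa ya xy ez; case: nz; exists x, y.
have [W WP] := choice Wex.
pose w : vdual_tot D := (a, ext0 (vfib (dstr1 D) a) W).
have wE x y : vfib (dstr1 D) u.1 x -> vfib (dstr1 D) v.1 y -> p2 x = p2 y ->
    w.2 (add2 x y) = u.2 x + v.2 y.
  move=> xa ya xy; rewrite /= ext0E; first exact: WP.
  have [Dx xu] := xa; have [Dy yv] := ya; split; first exact: vadd_carrier.
  by rewrite (p1_add2 HD)// xu yv.
exists w; split.
  split=> //; split=> //=; last exact: ext0_id.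
  split=> [z z' za za'|t z za].
    have [x [y [xa ya xy ez]]] := add2_decomposition Au Av m_uv za.
    have [x' [y' [xa' ya' xy' ez']]] := add2_decomposition Au Av m_uv za'.
    have [Dx xu] := xa; have [Dy yv] := ya; have [Dx' xu'] := xa'; have [Dy' yv'] := ya'.
    rewrite ez ez' -(interchange HD) ?xu ?yv//.
    have e : p2 (add1 x x') = p2 (add1 y y').
      by rewrite !(p2_add1 HD) ?xu ?yv// xy xy'.
    have := wE _ _ (vfibD fu xa xa') (vfibD fv ya ya') e.
    have := wE _ _ xa ya xy; have := wE _ _ xa' ya' xy'; rewrite /= => -> -> ->.
    by rewrite uD// vD// addrACA.
  have [x [y [xa ya xy ez]]] := add2_decomposition Au Av m_uv za.
  have [Dx xu] := xa; have [Dy yv] := ya.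
  rewrite ez (s1_add2 HD)//.
  have e : p2 (s1 t x) = p2 (s1 t y) by rewrite !(p2_s1 HD)// xy.
  have := wE _ _ (vfibZ fu t xa) (vfibZ fv t ya) e.
  have := wE _ _ xa ya xy; rewrite /= => -> ->.
  by rewrite uZ// vZ// mulrDr.
move=> [a' f] [[_ _ fe] /= ea wE']; move: fe; rewrite /= ea => fe; congr pair.
apply: (ext0_inj (ext0_id _ W) fe).
move=> z za; have [x [y [xa ya xy ->]]] := add2_decomposition Au Av m_uv za.
by have := wE _ _ xa ya xy; rewrite /= => ->; rewrite wE'.
Qed.

(** Over the zero of D_1 every vector is some [z2 b] plus a core vector; the functional must vanish
    on the first and be [k] on the second. *)
Lemma vdual_zero_exists (k : vdual_side2 D) : carrier (vdual_side2 D) k ->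
  exists! w, is_vdual_zero k w.
Proof.
move=> Dk; have [Mm [kD kZ] ke] := Dk.
have A0 := vzero_carrier VS1 Mm; have f0 := vb_is_fib V1 A0.
pose w : vdual_tot D := (zS1 k.1, ext0 (vfib (dstr1 D) (zS1 k.1))
  (fun x => k.2 (core_part x))).
have qz : q1 (zS1 k.1) = k.1 by exact: vpr_vzero.
have z2f b : vfib (dstrS2 D) k.1 b -> vfib (dstr1 D) (zS1 k.1) (z2 b).
  by move=> [Bb bm]; split; [exact: vzero_carrier|rewrite (p1_z2 HD)// bm].
exists w; split.
  split=> //=.
  - split=> //=; last exact: ext0_id.
    split=> [x y x0 y0|t x x0].
      rewrite !ext0E//; last exact: vfibD.
      by rewrite (core_partD Mm)// kD//; exact: core_part_vfib.
    rewrite !ext0E//; last exact: vfibZ.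
    by rewrite (core_partZ Mm)// kZ//; exact: core_part_vfib.
  - rewrite /vdual_pr2 /= qz; case: k Mm kD kZ ke A0 f0 @w qz z2f {Dk} => m k /=.
    move=> Mm kD kZ ke A0 f0 qz z2f; congr pair.
    rewrite ke; apply: ext0_ext => c Cc.
    have Cc' : vfib (core_str D) (q1 (zS1 m)) c by rewrite qz.
    have [ac _] := core_at_vfib A0 Cc'.
    rewrite -ke ext0E// (core_at_zero)//.
    by rewrite (core_part_core Mm).
  - move=> b bm; have [Bb qb] := bm; rewrite ext0E; last exact: z2f.
    rewrite (core_part_z2 Mm)//.
    have C0 := core_vfib_zero Mm.
    by have := kZ 0 _ C0; rewrite mul0r (vsclx0 f0).
move=> [a f] [[_ [fD fZ] fe] /= ea fk f0']; move: fD fZ fe fk; rewrite /= ea => fD fZ fe fk.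
congr pair.
apply: (ext0_inj (ext0_id _ (fun x => k.2 (core_part x))) fe) => x x0.
have [zx xm] := z2_over_zero Mm x0; have Cx := core_part_vfib Mm x0.
have [Dx _] := x0; have Bx : carrier (dside2 D) (p2 x) by exact: vpr_carrier.
have Cx' : vfib (dstr1 D) (zS1 k.1) (core_part x).
  by have /(core_vfib)[] := Cx.
rewrite ext0E// -[in RHS](core_partK Mm x0) fD// f0'// add0r.
rewrite -fk /vdual_pr2 /= ext0E; last by rewrite qz.
by rewrite (core_at_zero).
Qed.

Lemma vdual_scl_exists (t : R) (u : vdual_tot D) : carrier (vdual_tot D) u ->
  exists! w, is_vdual_scl t u w.
Proof.
move=> Du; have [Au [uD uZ] ue] := Du.
have fu := vb_is_fib V1 Au; have Mm := vpr_carrier VS1 Au.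
have fm := vb_is_fib VS1 Mm; have um : vfib (dstrS1 D) (q1 u.1) u.1 by [].
have [t0|t0] := eqVneq t 0.
  (* For factor 0 the two specifications agree, because every zero [z2 b] over the base point of [u]
     is [s2 0 x] for some [x] over [u.1]. *)
  have E w : is_vdual_scl t u w <-> is_vdual_zero (vdual_pr2 u) w.
    rewrite t0 /is_vdual_scl /is_vdual_zero /= (vscl0 fm um).
    split=> -[Dw ew wu wE]; split=> //.
      move=> b [Bb bm]; have [x [Dx xu xb]] := double_surjective HD Au Bb (esym bm).
      have := wE x (conj Dx xu); rewrite mul0r (s2_0)// xb.
      exact.
    move=> x [Dx xu]; rewrite (s2_0)// mul0r wE//; split; first exact: vpr_carrier.
    by rewrite -(dsquare HD)// xu.
  have [w [wz wu]] := vdual_zero_exists (vdual_pr2_carrier Du).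
  by exists w; split; [exact/E|move=> w' /E; exact: wu].
set a := sS1 t u.1; have Aa : carrier (dside1 D) a by exact: vscl_carrier.
have qa : q1 a = q1 u.1 by rewrite vpr_vscl.
have fa := vb_is_fib V1 Aa.
have sf s x b : vfib (dstr1 D) b x -> vfib (dstr1 D) (sS1 s b) (s2 s x).
  by move=> [Dx xb]; split; [exact: vscl_carrier|rewrite (p1_s2 HD)// xb].
have tK x : carrier (dtot D) x -> s2 t (s2 t^-1 x) = x.
  by move=> Dx; have fx := vpr_fib V2 Dx; rewrite (vsclA fx)// mulfV// (vscl1 fx).
have tK' x : carrier (dtot D) x -> s2 t^-1 (s2 t x) = x.
  by move=> Dx; have fx := vpr_fib V2 Dx; rewrite (vsclA fx)// mulVf// (vscl1 fx).
have au : sS1 t^-1 a = u.1 by rewrite /a (vsclA fm)// mulVf// (vscl1 fm).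
have sa x : vfib (dstr1 D) a x -> vfib (dstr1 D) u.1 (s2 t^-1 x).
  by move=> xa; rewrite -au; exact: sf.
(* For [t != 0] the map [s2 t] is a bijection from the fibre over [u.1] to the one over [a], which
   forces the formula. *)
pose w : vdual_tot D := (a, ext0 (vfib (dstr1 D) a) (fun x => t * u.2 (s2 t^-1 x))).
exists w; split.
  split=> //.
  - split=> //=; last exact: ext0_id.
    split=> [x y xa ya|s x xa].
      rewrite !ext0E//; last exact: vfibD.
      have [Dx xu] := xa; have [Dy yu] := ya.
      by rewrite (s2_add1 HD) ?xu// uD ?mulrDr//; exact: sa.
    rewrite !ext0E//; last exact: vfibZ.
    have [Dx xu] := xa.
    by rewrite -(dscl_comm HD)// uZ 1?mulrCA//; exact: sa.
  - rewrite /vdual_pr2 /= qa; congr pair; apply: ext0_ext => c Cc.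
    have Cc' : vfib (core_str D) (q1 a) c by rewrite qa.
    have [ac _] := core_at_vfib Aa Cc'; rewrite ext0E//.
    have /(core_vfib)[Dc c1 c2 _] := Cc.
    have Dz : carrier (dtot D) (z1 u.1) by exact: vzero_carrier.
    have Dz' : carrier (dtot D) (z1 a) by exact: vzero_carrier.
    have B0 : carrier (dside2 D) (zS2 (q1 u.1)) by exact: vzero_carrier.
    have fb := vb_is_fib V2 B0.
    rewrite /core_at (vsclDr fb); first last.
    - by [].
    - by split=> //; rewrite (p2_z1 HD)// qa.
    (* On the core [s2 t^-1] is [s1 t^-1], whose factor cancels [t]; hence the restriction to the
       core is unchanged. *)
    rewrite {1}/a (z1_sS)// tK'// (core_s12 HD); last by have [] := Cc.
    have Cs : vfib (core_str D) (q1 u.1) (s1 t^-1 c) by exact: core_vfibZ.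
    have [au' _] := core_at_vfib Au Cc.
    by rewrite -/(core_at _ _) (core_atZ)// uZ// mulrA mulfV// mul1r.
  - move=> x xu; have [Dx _] := xu; rewrite /= ext0E; last exact: sf.
    by rewrite tK'.
move=> [a' f] [[_ _ fe] /= ea _ fE]; move: fe; rewrite /= ea => fe.
congr pair; apply: (ext0_inj (ext0_id _ _) fe) => x xa.
have [Dx _] := xa.
by rewrite ext0E// -fE ?tK//; exact: sa.
Qed.

Lemma vdual_is_well_defined : vdual_well_defined D.
Proof.
split; [exact: vdual_add_exists|exact: vdual_scl_exists|exact: vdual_zero_exists].
Qed.

(** * Smooth frames of the core *)

Lemma p2_linear a r (hS : dside2 D -> 'rV[R]_r) j : carrier (dside1 D) a ->
  fib_coord (dstrS2 D) (q1 a) hS ->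
  linear_on (dstr1 D) a (fun x => hS (p2 x) 0 j).
Proof. exact: (p1_linear (is_dvb_swap HD)). Qed.

(* If N0 is a left inverse of P0 then, for P close to P0, the matrix
   1 - P (N0 P)^-1 N0 is a projection onto the left kernel of P, which depends
   smoothly on P. *)
Lemma core_frame m0 : carrier (dbase D) m0 ->
  exists n k (c : chart R (dbase D) n) (e : 'I_k -> dbase D -> core D),
  [/\ admissible c, c.1 m0, smooth_frame (core_str D) c.1 e &
      forall m, c.1 m -> is_fib (core_str D) m].
Proof.
move=> M0; have A0 := vzero_carrier VS1 M0.
have [n1 [r [c1 [h1 [pt1 [lt1 c1z]]]]]] := vb_triv V1 A0.
have [n2 [r2 [c2 [h2 [pt2 [lt2 c2m]]]]]] := vb_triv VS2 M0.
have ac1 := lt_base lt1; have ac2 := lt_base lt2.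
pose dom m := c2.1 m /\ c1.1 (zS1 m).
pose P m := \matrix_(i, j) h2 (p2 (pt1 (zS1 m) (delta_mx 0 i))) 0 j.
have domM m : dom m -> carrier (dbase D) m by move=> [c2m' _]; exact: admissible_sub c2m'.
have dom0 : dom m0 by [].
have zA m : dom m -> carrier (dside1 D) (zS1 m).
  by move=> dm; apply: vzero_carrier => //; exact: domM.
have qz m : dom m -> q1 (zS1 m) = m by move=> dm; apply: (vpr_vzero VS1 (domM m dm)).
have sz m : dom m -> lsm c2 c1 zS1 m.
  by move=> [c2m' c1z']; exact: (lsm_vzero VS1 ac2 ac1).
have fc1 m : dom m -> fib_coord (dstr1 D) (zS1 m) h1 by move=> [_]; exact: lt_fib lt1 _.
have fc2 m : dom m -> fib_coord (dstrS2 D) m h2 by move=> [+ _]; exact: lt_fib lt2 _.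
have hP m x : dom m -> vfib (dstr1 D) (zS1 m) x -> h2 (p2 x) = h1 x *m P m.
  move=> dm x0; apply: (fc_linear_mx (fc1 _ dm)
    (fun i => lt_pt lt1 (delta_mx 0 i) dm.2) (L := fun x => h2 (p2 x)) _ x0).
  by move=> j; apply: p2_linear; [exact: zA|rewrite qz//; exact: fc2].
have pm m x : dom m -> vfib (dstr1 D) (zS1 m) x -> vfib (dstrS2 D) m (p2 x).
  move=> dm [Dx x0]; split; first exact: vpr_carrier.
  by rewrite -(dsquare HD)// x0 qz.
have sP m i j : dom m -> lsmR c2 (fun m => P m i j) m.
  move=> dm; apply: (@lsmR_ext _ _ _ _ _
    (fun m => h2 (p2 (pt1 (zS1 m) (delta_mx 0 i))) 0 j)).
    by move=> y _; rewrite mxE.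
  have s0 : lsm c2 (tchart (dstr1 D) c1 h1) (fun m => pt1 (zS1 m) (delta_mx 0 i)) m.
    by apply: (lsm_pt lt1 (sz m dm)) => l; exact: lsmR_cst.
  have [xe _] := lt_pt lt1 (delta_mx 0 i) dm.2; have [De de] := xe.
  have [_ sp] := smooth_vpr V2.
  have te : (tchart (dstr1 D) c1 h1).1 (pt1 (zS1 m) (delta_mx 0 i)).
    by split=> //=; rewrite de; exact: dm.2.
  have tpe : (tchart (dstrS2 D) c2 h2).1 (p2 (pt1 (zS1 m) (delta_mx 0 i))).
    by have [Bp qp] := pm m _ dm xe; split=> //=; rewrite qp; exact: dm.1.
  have s1_ := smooth_on_lsm (vb_total V2) (vb_base V2) sp (tchart_admissible lt1)
    (tchart_admissible lt2) te I tpe.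
  exact: (lsmR_comp dm.1 (lsm_comp dm.1 s0 s1_) (lsmR_fibcoord (dstrS2 D) j _)).
pose P0 := P m0.
(* The zero section [z2] is a right inverse of [p2] over the zero of D_1, so its matrix [N0] on a
   basis satisfies [N0 *m P0 = 1]. *)
pose N0 := \matrix_i h1 (z2 (pt2 m0 (delta_mx 0 i))).
have N0P : N0 *m P0 = 1%:M.
  apply/row_matrixP => i; rewrite row_mul rowK.
  have [[Bi im] hi] := lt_pt lt2 (delta_mx 0 i) c2m.
  have [Dz bz] := vfib0 (vb_is_fib V2 Bi).
  have z0 : vfib (dstr1 D) (zS1 m0) (z2 (pt2 m0 (delta_mx 0 i))).
    by split=> //; rewrite (p1_z2 HD)// im.
  by rewrite -(hP _ _ dom0 z0) bz hi rowE mulmx1.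
pose K := row_base (kermx P0).
(* [C] reads off coordinates of kernel vectors in the basis [K]. It serves unchanged for the moving
   basis [W m], because [N0 *m C = 0] gives [Pi m *m C = C]. *)
pose C := (1%:M - P0 *m N0) *m pinvmx K.
have KP : K *m P0 = 0 by apply/sub_kermxP; rewrite eq_row_base.
have CK : C *m K = 1%:M - P0 *m N0.
  rewrite mulmxKpV// eq_row_base; apply/sub_kermxP.
  by rewrite mulmxBl mul1mx -mulmxA N0P mulmx1 subrr.
have KC : K *m C = 1%:M.
  rewrite mulmxA mulmxBr mulmx1 (mulmxA K) KP mul0mx subr0.
  by apply: mulmxVp; exact: row_base_free.
have NC : N0 *m C = 0.
  by rewrite mulmxA mulmxBr mulmx1 (mulmxA N0) N0P mul1mx subrr mul0mx.
pose Q m := N0 *m P m.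
pose Pi m := 1%:M - P m *m invmx (Q m) *m N0.
pose W m := K *m Pi m.
have sQ m i j : dom m -> lsmR c2 (fun m => Q m i j) m.
  by move=> dm; apply: lsmR_mulmx => [k l|k l]; [exact: lsmR_cst|exact: sP].
have PiP m : Q m \in unitmx -> Pi m *m P m = 0.
  by move=> uQ; rewrite mulmxBl mul1mx -(mulmxA _ N0) -/(Q m) mulmxKV// subrr.
have NPi m : Q m \in unitmx -> N0 *m Pi m = 0.
  by move=> uQ; rewrite mulmxBr mulmx1 (mulmxA N0) (mulmxA N0) -/(Q m) mulmxV// mul1mx subrr.
have WP m : Q m \in unitmx -> W m *m P m = 0 by move=> uQ; rewrite -mulmxA PiP// mulmx0.
have WC m : W m *m C = 1%:M.
  by rewrite -mulmxA mulmxBl mul1mx -(mulmxA _ N0) NC mulmx0 subr0.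
have CW m : Q m \in unitmx -> C *m W m = Pi m.
  by move=> uQ; rewrite mulmxA CK mulmxBl mul1mx -(mulmxA _ N0) NPi// mulmx0 subr0.
have nQ : lnear c2 (fun m => c1.1 (zS1 m) /\ Q m \in unitmx) m0.
  apply: lnear_and; first exact: (sz m0 dom0).1.
  apply: lsmR_unitmx => //; first by move=> i j; exact: sQ.
  by rewrite /Q -/P0 N0P unitmx1.
have [c [ac cm0 ec ce]] := restrict_chart (vb_base VS2) ac2 c2m nQ.
have cdom m : c.1 m -> dom m by move=> /ce[? [? _]].
have cQ m : c.1 m -> Q m \in unitmx by move=> /ce[_ []].
have csub m : c.1 m -> c2.1 m by move=> /ce[].
have ker_pt m v : c.1 m -> v *m P m = 0 ->
    vfib (core_str D) m (pt1 (zS1 m) v) /\ h1 (pt1 (zS1 m) v) = v.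
  move=> cm vP; have dm := cdom m cm; have [xv hv] := lt_pt lt1 v dm.2.
  split=> //; apply/(core_vfib); have [Dx x0] := xv; split=> //; last exact: domM.
  apply: (fc_inj (fc2 m dm)); first exact: pm.
    exact: fc_zero (fc2 m dm).
  by rewrite (hP m)// hv vP (fc_0 (fc2 m dm)).
pose e (i : 'I_(\rank (kermx P0))) m := pt1 (zS1 m) (row i (W m)).
have eP i m : c.1 m -> vfib (core_str D) m (e i m) /\ h1 (e i m) = row i (W m).
  by move=> cm; apply: ker_pt => //; rewrite -row_mul WP ?row0//; exact: cQ.
(* On the left kernel of [P m] the projection [Pi m = C *m W m] is the identity, so coordinates
   taken by [C] recover the vector. *)
have ck m x : c.1 m -> vfib (core_str D) m x -> h1 x = h1 x *m C *m W m.
  move=> cm /(core_vfib)[Dx x1 x2 Mm]; have dm := cdom m cm.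
  rewrite -mulmxA CW; last exact: cQ.
  rewrite mulmxBr mulmx1 !mulmxA -(hP m)//.
  by rewrite x2 (fc_0 (fc2 m dm)) !mul0mx subr0.
have fcC m : c.1 m -> fib_coord (core_str D) m (fun x => h1 x *m C).
  move=> cm; have dm := cdom m cm; have fc := fc1 m dm.
  have c0 x : vfib (core_str D) m x -> vfib (dstr1 D) (zS1 m) x.
    by move=> /(core_vfib)[].
  split.
  - by move=> x y; exact: core_vfibD.
  - by move=> t x; exact: core_vfibZ.
  - by apply: core_vfib_zero => //; exact: domM.
  - move=> v; have [|xC xh] := ker_pt m (v *m W m) cm.
      by rewrite -mulmxA WP ?mulmx0//; exact: cQ.
    by exists (pt1 (zS1 m) (v *m W m)); rewrite xh -mulmxA WC mulmx1.
  - by move=> x y /c0 x0 /c0 y0; rewrite (fc_D fc x0 y0) mulmxDl.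
  - by move=> t x /c0 x0; rewrite (fc_Z fc t x0) -scalemxAl.
  - by rewrite (fc_0 fc) mul0mx.
  - move=> x y xC yC exy; apply: (fc_inj fc); [exact: c0|exact: c0|].
    by rewrite (ck m x)// exy -(ck m y).
exists n2, (\rank (kermx P0)), c, e; split=> //; last first.
  by move=> m cm; exists (\rank (kermx P0)), (fun x => h1 x *m C); exact: fcC.
split.
  move=> i; apply: manifold_smooth_on; first exact: (vb_base VS2).
  move=> m Mm cm p d ad dm q l al lm.
  have s0 : lsm d c id m := admissible_lsm (vb_base VS2) ad ac dm cm.
  case: q l / al lm => k q l al sl [lm _].
  apply: lsm_slice_target.
    by apply: lnear_imp s0.1 => y dy cy; have [[_ Ce] _] := (eP i y cy).1.
  have s2_ : lsm d c2 id m := admissible_lsm (vb_base VS2) ad ac2 dm (csub m cm).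
  have s3 : lsm c2 (tchart (dstr1 D) c1 h1) (e i) m.
    apply: (lsm_pt lt1 (sz m (cdom m cm))) => j.
    apply: (@lsmR_ext _ _ _ _ _ (fun m => W m i j)); first by move=> y _; rewrite mxE.
    apply: lsmR_mulmx => [k' l'|k' l']; first exact: lsmR_cst.
    apply: (@lsmR_ext _ _ _ _ _ (fun m => 1%:M k' l' +
      (-1) * (P m *m invmx (Q m) *m N0) k' l')).
      by move=> y _; rewrite !mxE mulN1r.
    apply: lsmRD; first exact: lsmR_cst.
    apply: lsmRM; first exact: lsmR_cst.
    apply: lsmR_mulmx => [i1 i2|i1 i2]; last exact: lsmR_cst.
    apply: lsmR_mulmx => [j1 j2|j1 j2]; first by apply: sP; exact: cdom.
    apply: lsmR_invmx; [exact: csub|by move=> *; apply: sQ; exact: cdom|exact: cQ].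
  have [[Ce ee] _] := eP i m cm.
  apply: (lsm_comp dm (lsm_comp dm s2_ s3) (g := id)).
  apply: (admissible_lsm (vb_total V1)) => //; first exact: tchart_admissible lt1.
  have /(core_vfib)[De e1 _ _] := (eP i m cm).1.
  by split=> //=; rewrite e1; exact: (cdom m cm).2.
move=> m cm; split; first by move=> i; have [] := eP i m cm.
apply: (frame_unique (fcC m cm)); first by move=> i; have [] := eP i m cm.
rewrite (_ : \matrix_i _ = 1%:M) ?unitmx1//.
apply/row_matrixP => i; rewrite rowK; have [_ ->] := eP i m cm.
by rewrite -row_mul WC.
Qed.

(** * Restriction of linear functionals to the double affine bundle *)

Variables (l1 : dside1 D -> R) (l2 : dside2 D -> R) (sigma : dbase D -> core D).
Hypothesis l1_nz : nonzero_linear_fun (dstrS1 D) l1.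
Hypothesis l2_nz : nonzero_linear_fun (dstrS2 D) l2.
Hypothesis sigma_nz : nonvanishing_section (core_str D) sigma.

Let A : dab R := dab_of_dvb l1 l2.
Let B : dab R := @dab_of_dvb R (vdual D) l1 (eval_section sigma).
Let As : dab R := @adual R A sigma.
Let F : atot B -> atot As := @restr_to_A R D l1 l2 sigma.

Lemma afib1P a x : afib (astr1 A) a x <->
  [/\ vfib (dstr1 D) a x, l1 a = 1 & l2 (p2 x) = 1].
Proof.
split=> [[[Dx [x1 x2]] /= xa]|[[Dx xa] a1 x2]]; first by split=> //; rewrite -xa.
by split=> //; split=> //; split=> //; rewrite xa.
Qed.

Lemma afibS2P m y : afib (astrS2 A) m y <-> vfib (dstrS2 D) m y /\ l2 y = 1.
Proof. by split=> [[[Dy y2] /= ym]|[[Dy ym] y2]]. Qed.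

Lemma sigma_core m : carrier (dbase D) m -> vfib (core_str D) m (sigma m).
Proof.
move=> Mm; have [[sc _] sv] := sigma_nz; split; first exact: sc.
by have [] := sv m Mm.
Qed.

Lemma l1_linear m : carrier (dbase D) m -> linear_on (dstrS1 D) m l1.
Proof. by case: l1_nz => _ + _; apply. Qed.

Lemma l2_linear m : carrier (dbase D) m -> linear_on (dstrS2 D) m l2.
Proof. by case: l2_nz => _ + _; apply. Qed.

Lemma l2_hyperplane m : carrier (dbase D) m -> exists y, hyperplane (dstrS2 D) m l2 y.
Proof.
move=> Mm; have [y [ym ly]] : exists y, vfib (dstrS2 D) m y /\ l2 y <> 0.
  by case: l2_nz => _ _; apply.
exists (sS2 (l2 y)^-1 y); split; first by apply: vfibZ => //; exact: vb_is_fib.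
have [_ lZ] := l2_linear Mm.
by rewrite lZ// mulVf//; apply/eqP.
Qed.

Lemma l2p2_linear a : carrier (dside1 D) a -> linear_on (dstr1 D) a (l2 \o p2).
Proof.
move=> Aa; have Mm := vpr_carrier VS1 Aa; have [lD lZ] := l2_linear Mm.
have pm x : vfib (dstr1 D) a x -> vfib (dstrS2 D) (q1 a) (p2 x).
  by move=> [Dx xa]; split; [exact: vpr_carrier|rewrite -(dsquare HD)// xa].
split=> [x y xa ya|t x xa] /=.
  have [Dx xe] := xa; have [Dy ye] := ya.
  by rewrite (p2_add1 HD) ?xe// lD//; exact: pm.
by have [Dx xe] := xa; rewrite (p2_s1 HD)// lZ//; exact: pm.
Qed.

(** A point of A_2 lifts to the fibre over [a] by surjectivity onto the fibre product; this gives
    the base point needed to extend affine functions. *)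
Lemma l2p2_hyperplane a : carrier (dside1 D) a ->
  exists x, hyperplane (dstr1 D) a (l2 \o p2) x.
Proof.
move=> Aa; have [y [[By ym] y1]] := l2_hyperplane (vpr_carrier VS1 Aa).
have [x [Dx xa xy]] := double_surjective HD Aa By (esym ym).
by exists x; split=> //=; rewrite xy.
Qed.

Lemma afib1_hyperplane a x : l1 a = 1 ->
  afib (astr1 A) a x <-> hyperplane (dstr1 D) a (l2 \o p2) x.
Proof. by move=> a1; split=> [/afib1P[]|[xa x1]]//; apply/afib1P. Qed.

Lemma afib1_core a x c : carrier (dside1 D) a -> afib (astr1 A) a x ->
  vfib (core_str D) (q1 a) c ->
  afib (astr1 A) a (add1 x (core_at a c)) /\ p2 (add1 x (core_at a c)) = p2 x.
Proof.
move=> Aa /afib1P[xa a1 x1] Cc.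
have [ca cb] := core_at_vfib Aa Cc.
have [Dx xe] := xa; have [Dc ce] := ca.
have e : p2 (add1 x (core_at a c)) = p2 x.
  rewrite (p2_add1 HD) ?xe// cb (vaddx0 (vb_is_fib VS2 (vpr_carrier VS1 Aa)))//.
  by split; [exact: vpr_carrier|rewrite -(dsquare HD)// xe].
split=> //; apply/afib1P; rewrite e; split=> //.
by apply: vfibD => //; exact: vb_is_fib.
Qed.

Lemma restr_to_A_val (u : atot B) x : afib (astr1 A) u.1 x -> (F u).2 x = u.2 x.
Proof. by move=> xa; rewrite /F /restr_to_A /= ext0E. Qed.

Lemma carrierB (u : atot B) : carrier (atot B) u <->
  [/\ carrier (vdual_tot D) u, l1 u.1 = 1 &
      (vdual_pr2 u).2 (sigma (q1 u.1)) = 1].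
Proof. by split=> [[Du [u1 u2]]|[Du u1 u2]]. Qed.

Lemma restr_to_A_carrier (u : atot B) : carrier (atot B) u -> carrier (atot As) (F u).
Proof.
move=> /carrierB[Du u1 us]; have [Au ul ue] := Du.
have fu := vb_is_fib V1 Au; have Mm := vpr_carrier VS1 Au.
split.
  split; [by []| |exact: ext0_id].
  move=> t x y xa ya.
  have xH := (afib1_hyperplane x u1).1 xa; have yH := (afib1_hyperplane y u1).1 ya.
  rewrite !restr_to_A_val//; last first.
    apply/(afib1_hyperplane _ u1); apply: hyperplane_aff => //; exact: l2p2_linear.
  exact: (linear_affine fu ul (l := l2 \o p2) t xH yH).
move=> x xa; have Cs := sigma_core Mm.
have /afib1P[[Dx xe] _ x1] := xa.
have [ya yb] := afib1_core Au xa Cs.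
have [ca _] := core_at_vfib Au Cs.
have -> : atr (d := A) (sigma (apr (astrS1 A) (F u).1)) x =
    add1 x (core_at u.1 (sigma (q1 u.1))) by rewrite /= xe.
rewrite (restr_to_A_val (u := u) ya) (restr_to_A_val (u := u) xa) (ul.1 _ _ _ ca)//.
by rewrite -vdual_pr2E// us.
Qed.

Lemma restr_to_A_inj (u v : atot B) : carrier (atot B) u -> carrier (atot B) v ->
  F u = F v -> u = v.
Proof.
case: u v => [a f] [a' g] /carrierB[[/= Aa fl fe] a1 _] /carrierB[[/= _ gl ge] _ _].
rewrite /F /restr_to_A /= => -[ea ee]; rewrite -ea in gl ge ee *; congr pair.
apply: (ext0_inj fe ge).
have [x0 H0] := l2p2_hyperplane Aa.
apply: (linear_hyperplane_unique (vb_is_fib V1 Aa) (l2p2_linear Aa) H0 fl gl) => x Hx.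
have xa := (afib1_hyperplane x a1).2 Hx.
by rewrite -[f x](ext0E f xa) -[g x](ext0E g xa) ee.
Qed.

Lemma restr_to_A_surj (v : atot As) : carrier (atot As) v ->
  exists2 u : atot B, carrier (atot B) u & F u = v.
Proof.
case: v => [a f] [[/= [Aa a1] fa fe] fs].
have [x0 H0] := l2p2_hyperplane Aa; have fba := vb_is_fib V1 Aa.
have faH : affine_on_hyperplane (dstr1 D) a (l2 \o p2) f.
  by move=> t x y Hx Hy; apply: fa; apply/(afib1_hyperplane _ a1).
have [g gl gf] := affine_extension fba (l2p2_linear Aa) H0 faH.
have gl' : linear_on (dstr1 D) a (ext0 (vfib (dstr1 D) a) g).
  have [gD gZ] := gl; split=> [x y xa ya|t x xa]; rewrite !ext0E ?gD ?gZ//.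
    exact: vfibD.
  exact: vfibZ.
have ge x : afib (astr1 A) a x -> ext0 (vfib (dstr1 D) a) g x = f x.
  move=> xa; have /afib1P[xv _ _] := xa.
  by rewrite ext0E// gf//; apply/afib1_hyperplane.
exists (a, ext0 (vfib (dstr1 D) a) g).
  apply/carrierB; split=> //; first by split=> //=; exact: ext0_id.
  have Mm := vpr_carrier VS1 Aa; have Cs := sigma_core Mm.
  (* The value on [sigma] is read off as the difference between the values at the translate of [x0]
     by [sigma] and at [x0]. *)
  rewrite vdual_pr2E//= -[LHS](addKr (ext0 (vfib (dstr1 D) a) g x0)).
  have x0a := (afib1_hyperplane x0 a1).2 H0.
  have [ca _] := core_at_vfib Aa Cs.
  have [ya _] := afib1_core Aa x0a Cs.
  have := fs x0 x0a; rewrite /=; have /afib1P[[_ ->] _ _] := x0a => e.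
  have [D0 _] := H0; rewrite -(gl'.1 _ _ D0 ca) (ge _ ya) (ge _ x0a) e.
  by rewrite addKr.
rewrite /F /restr_to_A /=; congr pair; rewrite [RHS]fe; exact: ext0_ext.
Qed.

Lemma restr_to_A_pr2 (u : atot B) : carrier (atot B) u ->
  is_adual_pr2 (F u : adual_tot (A := A) sigma) (vdual_pr2 u : adual_side2 (A := A) sigma).
Proof.
move=> Bu; have /carrierB[Du u1 us] := Bu; have [Au ul ue] := Du.
split=> //; first by split=> //; exact: vdual_pr2_carrier.
move=> x c xa Cc; have /afib1P[[Dx xe] _ x1] := xa.
have [ya yb] := afib1_core Au xa Cc.
have [ca _] := core_at_vfib Au Cc.
have -> : atr (d := A) c x = add1 x (core_at u.1 c) by rewrite /= xe.
rewrite (restr_to_A_val (u := u) ya) (restr_to_A_val (u := u) xa) (ul.1 _ _ _ ca)//.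
by rewrite vdual_pr2E.
Qed.

(** Existence comes from the linear functional that restricts to [v]; uniqueness holds because the
    increments of [v] at a single point determine the functional on the core. *)
Lemma adual_pr2_unique (v : adual_tot (A := A) sigma) : carrier (atot As) v ->
  exists! k, is_adual_pr2 v k.
Proof.
move=> Av; have [u Bu Fu] := restr_to_A_surj Av.
have := restr_to_A_pr2 Bu; rewrite Fu => kP; exists (vdual_pr2 u); split=> //.
case=> m f [Dk /= mv fP].
have [[[Aa v1] _ _] _] := Av.
have [[kc _] _ kE] := kP.
have [x0 H0] := l2p2_hyperplane Aa.
have x0a := (afib1_hyperplane x0 v1).2 H0.
have [[_ _ /= fe] _] := Dk; have [_ _ ke] := kc.
have em : (vdual_pr2 u).1 = m by have [_ -> _] := kP.
rewrite [LHS]surjective_pairing; congr pair => //.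
rewrite em in ke kE; apply: (ext0_inj ke fe) => c Cc.
by have := kE x0 c x0a Cc; rewrite (fP _ _ x0a Cc) => /addrI.
Qed.

Lemma restr_to_A_adual_pr2 (u : atot B) : carrier (atot B) u ->
  adual_pr2 (F u : adual_tot (A := A) sigma) = vdual_pr2 u.
Proof.
move=> Bu; apply: the_eq (restr_to_A_pr2 Bu); apply: adual_pr2_unique.
exact: restr_to_A_carrier.
Qed.

(** The specification of a sum does not mention its projection. It is recovered by evaluating at a
    core vector over [w.1], which is the sum over D_2 of the same core vector over [u.1] and the
    zero over [v.1]. *)
Lemma vdual_add_pr2 (u v w : vdual_tot D) :
  carrier (vdual_tot D) u -> carrier (vdual_tot D) v -> vdual_pr2 u = vdual_pr2 v ->
  is_vdual_add u v w -> vdual_pr2 w = vdual_pr2 u.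
Proof.
move=> Du Dv uv [Dw ew wE]; have [Au ul ue] := Du; have [Av vl ve] := Dv.
have m_uv : q1 u.1 = q1 v.1 by case: uv.
have Mm := vpr_carrier VS1 Au.
have qw : q1 w.1 = q1 u.1 by rewrite ew vpr_vadd.
rewrite /vdual_pr2 qw; congr pair; apply: ext0_ext => c Cc.
have C0 := core_vfib_zero Mm; have Cv : vfib (core_str D) (q1 v.1) (z1 (zS1 (q1 u.1))).
  by rewrite -m_uv.
have [ac bc] := core_at_vfib Au Cc.
have [a0 b0] := core_at_vfib Av Cv.
have /(core_vfib)[Dc c1 c2 _] := Cc.
have B0 := vzero_carrier VS2 Mm; have fb := vb_is_fib V2 B0.
have zu : vfib (dstr2 D) (zS2 (q1 u.1)) (z1 u.1).
  by split; [exact: vzero_carrier|rewrite (p2_z1 HD)].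
have zv : vfib (dstr2 D) (zS2 (q1 u.1)) (z1 v.1).
  by split; [exact: vzero_carrier|rewrite (p2_z1 HD)// m_uv].
have cb : vfib (dstr2 D) (zS2 (q1 u.1)) c by [].
have z0 : core_at v.1 (z1 (zS1 (q1 u.1))) = z1 v.1.
  by rewrite /core_at (double_zero HD)// (vaddx0 fb).
have -> : core_at w.1 c = add2 (core_at u.1 c) (z1 v.1).
  rewrite /core_at ew (z1_addS)// -!(vaddA fb)//; congr (add2 _ _).
  exact: (vaddC fb).
rewrite wE//; first by rewrite (linear_on0 (vb_is_fib V1 Av))// addr0.
  by apply: vfib0; exact: vb_is_fib.
by rewrite bc; case: zv => _ ->.
Qed.

Section Combination.
Variables (t : R) (u v : atot B).
Hypotheses (Bu : carrier (atot B) u) (Bv : carrier (atot B) v).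
Hypothesis uv : vdual_pr2 u = vdual_pr2 v.

Let Du : carrier (vdual_tot D) u. Proof. by have /carrierB[] := Bu. Qed.
Let Dv : carrier (vdual_tot D) v. Proof. by have /carrierB[] := Bv. Qed.

Let w : atot B := aff (astr2 B) t u v.

(** Trades the chosen multiples and sums for their defining equations, the form in which the affine
    dual states its own combinations. *)
Lemma vdual_aff_spec :
  [/\ carrier (vdual_tot D) w, w.1 = addS1 (sS1 t u.1) (sS1 (1 - t) v.1),
      vdual_pr2 w = vdual_pr2 u &
      forall x y, vfib (dstr1 D) u.1 x -> vfib (dstr1 D) v.1 y -> p2 x = p2 y ->
        w.2 (add2 (s2 t x) (s2 (1 - t) y)) = t * u.2 x + (1 - t) * v.2 y].
Proof.
have [wd_add wd_scl _] := vdual_is_well_defined.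
have [ut [utP _]] := wd_scl t u Du; have [vt [vtP _]] := wd_scl (1 - t) v Dv.
have eu : vscl (vdual_str2 D) t u = ut by apply: the_eq => //; exact: wd_scl.
have ev : vscl (vdual_str2 D) (1 - t) v = vt by apply: the_eq => //; exact: wd_scl.
have [Dut u1 upr uE] := utP; have [Dvt v1 vpr_ vE] := vtP.
have e : vdual_pr2 ut = vdual_pr2 vt by rewrite upr vpr_.
have [w' [wP _]] := wd_add ut vt Dut Dvt e.
have ew : w = w'.
  have -> : w = vadd (vdual_str2 D) (vscl (vdual_str2 D) t u)
    (vscl (vdual_str2 D) (1 - t) v) by [].
  by rewrite eu ev; apply: the_eq wP; exact: wd_add.
rewrite ew; have [Dw w1 wE] := wP; split=> //.
- by rewrite w1 u1 v1.
- by rewrite (vdual_add_pr2 Dut Dvt e wP).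
move=> x y xu yv xy; have [Dx xe] := xu; have [Dy ye] := yv.
rewrite wE ?uE ?vE//.
- by split; [exact: vscl_carrier|rewrite (p1_s2 HD)// u1 xe].
- by split; [exact: vscl_carrier|rewrite (p1_s2 HD)// v1 ye].
- by rewrite !vpr_vscl.
Qed.

Lemma base_eq : q1 u.1 = q1 v.1. Proof. by case: uv. Qed.

Lemma aff_l1 : l1 (addS1 (sS1 t u.1) (sS1 (1 - t) v.1)) = 1.
Proof.
have /carrierB[[Au _ _] u1 _] := Bu; have /carrierB[[Av _ _] v1 _] := Bv.
have Mm := vpr_carrier VS1 Au; have fm := vb_is_fib VS1 Mm.
have um : vfib (dstrS1 D) (q1 u.1) u.1 by [].
have vm : vfib (dstrS1 D) (q1 u.1) v.1 by split=> //; rewrite -base_eq.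
have [lD lZ] := l1_linear Mm.
by rewrite lD ?lZ//; [rewrite u1 v1; ring|exact: vfibZ|exact: vfibZ].
Qed.

Lemma aff_carrier : carrier (atot B) w.
Proof.
have [Dw w1 wpr _] := vdual_aff_spec; apply/carrierB; split=> //.
  by rewrite w1 aff_l1.
have /carrierB[_ _ us] := Bu; rewrite wpr.
by have -> : q1 w.1 = q1 u.1 by case: wpr.
Qed.

Lemma restr_to_A_aff2 : is_adual_aff2 t (F u : adual_tot (A := A) sigma) (F v) (F w).
Proof.
have [Dw w1 wpr wE] := vdual_aff_spec.
split; [by apply: restr_to_A_carrier => //; exact: aff_carrier|exact: w1|].
move=> x y xa ya xy; rewrite (restr_to_A_val (u := u) xa) (restr_to_A_val (u := v) ya).
have /afib1P[xu u1 x2] := xa; have /afib1P[yv v1 y2] := ya.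
rewrite -wE//; apply: (restr_to_A_val (u := w)).
have [Dx xe] := xu; have [Dy ye] := yv; have e : p2 x = p2 y by [].
have [Dsx sx] : vfib (dstr2 D) (p2 x) (s2 t x) by apply: vfibZ => //; exact: vpr_fib.
have [Dsy sy] : vfib (dstr2 D) (p2 x) (s2 (1 - t) y).
  by apply: vfibZ => //; exact: vpr_fib.
apply/afib1P; split.
- split; first by apply: vadd_carrier => //; rewrite sx sy.
  by rewrite (p1_add2 HD) ?sx ?sy// !(p1_s2 HD)// xe ye w1.
- by rewrite w1 aff_l1.
- by rewrite vpr_vadd// ?sx ?sy.
Qed.

End Combination.

(** For [t = 0] the second point must be [z] and the first is any point over [a] with the right
    projection; otherwise the second is chosen freely and the first is solved for. *)
Lemma aff2_decomposition t a a' z : carrier (dside1 D) a -> carrier (dside1 D) a' ->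
  l1 a = 1 -> l1 a' = 1 -> q1 a = q1 a' ->
  afib (astr1 A) (addS1 (sS1 t a) (sS1 (1 - t) a')) z -> exists x y,
  [/\ afib (astr1 A) a x, afib (astr1 A) a' y, p2 x = p2 y &
      z = add2 (s2 t x) (s2 (1 - t) y)].
Proof.
move=> Aa Aa' a1 a1' aa' /afib1P[[Dz za] _ z1_].
have Bb : carrier (dside2 D) (p2 z) by exact: vpr_carrier.
have Mm := vpr_carrier VS1 Aa; have fm := vb_is_fib VS1 Mm.
have am : vfib (dstrS1 D) (q1 a) a by [].
have am' : vfib (dstrS1 D) (q1 a) a' by [].
have tam := vfibZ fm t am; have tam' := vfibZ fm (1 - t) am'.
have zm : q2 (p2 z) = q1 a.
  by rewrite -(dsquare HD)// za; have [_ ->] := vfibD fm tam tam'.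
have fb := vb_is_fib V2 Bb; have zb : vfib (dstr2 D) (p2 z) z by [].
have [t0|t0] := eqVneq t 0.
  have [x [Dx xa xz]] := double_surjective HD Aa Bb (esym zm).
  exists x, z; rewrite t0 subr0 in za *; split=> //.
  - by apply/afib1P; rewrite xz.
  - apply/afib1P; split=> //; split=> //.
    by rewrite za (vscl0 fm am) (vscl1 fm am') (vadd0x fm am').
  - have xb : vfib (dstr2 D) (p2 z) x by [].
    by rewrite (vscl0 fb xb) (vscl1 fb zb) (vadd0x fb zb).
have [y [Dy ya yz]] := double_surjective HD Aa' Bb (esym (etrans zm aa')).
have yb : vfib (dstr2 D) (p2 z) y by [].
have sb := vfibZ fb (1 - t) yb; have db := vfibB fb zb sb.
have xb := vfibZ fb t^-1 db; have [Dx xe] := xb.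
exists (s2 t^-1 (vsub (dstr2 D) z (s2 (1 - t) y))), y; split.
- apply/afib1P; rewrite xe; split=> //; split=> //.
  have [Dsb sbe] := sb; have [Dn ne] := vfibZ fb (-1) sb; have [Dd de] := db.
  rewrite (p1_s2 HD)// /vsub (p1_add2 HD)// ?ne// !(p1_s2 HD)// za ya.
  case: (fm) => r [h fc]; have stm := vfibZ fm (-1) tam'.
  have e1 := vfibD fm tam tam'; have e2 := vfibD fm e1 stm.
  apply: (fc_inj fc _ am); first exact: vfibZ.
  rewrite (fc_Z fc)// (fc_D fc)// (fc_D fc)// (fc_Z fc _ tam') !(fc_Z fc)//.
  by apply/rowP => j; rewrite !mxE; field.
- by apply/afib1P; rewrite yz.
- by rewrite xe yz.
by rewrite (vsclA fb)// mulfV// (vscl1 fb)// (vaddC fb)// (vsubKC fb).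
Qed.

(** Existence is transported from the vertical dual by the restriction map; uniqueness holds because
    every point of the target fibre is a combination of the prescribed form. *)
Lemma adual_aff2_exists t (u v : adual_tot (A := A) sigma) :
  carrier (atot As) u -> carrier (atot As) v -> adual_pr2 u = adual_pr2 v ->
  exists! w, is_adual_aff2 t u v w.
Proof.
move=> Au Av; have [u' Bu <-] := restr_to_A_surj Au.
have [v' Bv <-] := restr_to_A_surj Av.
rewrite -/F !restr_to_A_adual_pr2// => uv; have wP := restr_to_A_aff2 t Bu Bv uv.
exists (F (aff (astr2 B) t u' v')); split=> // w [Aw w1 wE].
have [[[Aw1 _] _ we] _] := Aw.
have [[[_ _ we'] _] w1' wE'] := wP.
have /carrierB[[Cu _ _] u1 _] := Bu; have /carrierB[[Cv _ _] v1 _] := Bv.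
case: w Aw w1 wE we {Aw1} => a f Aw /= w1 wE we.
rewrite [LHS]surjective_pairing; congr pair; first by rewrite w1 w1'.
have ea : (F (aff (astr2 B) t u' v')).1 = a by rewrite w1 w1'.
rewrite ea in we'; apply: (ext0_inj we' we) => z za; rewrite w1 in za.
have [x [y [xa ya xy ->]]] := aff2_decomposition Cu Cv u1 v1 (base_eq uv) za.
by rewrite (wE' _ _ xa ya xy) (wE _ _ xa ya xy).
Qed.

Lemma adual_is_well_defined : @adual_well_defined R A sigma.
Proof.
split; first exact: adual_pr2_unique.
by move=> t u v; exact: adual_aff2_exists.
Qed.

Lemma restr_to_A_affine1 : affine_morph (astr1 B) (astr1 As) F id.
Proof.
split=> [//|t [a f] [a' g] /= _ _ aa']; rewrite -aa'.
congr pair; apply/funext => x; rewrite /ext0 /patch.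
by case: ifPn => _; rewrite ?mulr0 ?addr0.
Qed.

Lemma restr_to_A_affine2 : affine_morph (astr2 B) (astr2 As) F id.
Proof.
split=> [u Bu|t u v Bu Bv uv]; first exact: restr_to_A_adual_pr2.
apply/esym/the_eq; last exact: restr_to_A_aff2.
apply: adual_aff2_exists; [exact: restr_to_A_carrier|exact: restr_to_A_carrier|].
by rewrite -/F !restr_to_A_adual_pr2.
Qed.

(** * The cores of the two double affine bundles *)

Lemma core_incl_core (w : dual_mfd (dstrS2 D)) : carrier (dual_mfd (dstrS2 D)) w ->
  carrier (core (vdual D)) (vdual_core_incl w) /\
  dpr (vdual_core_incl w) = w.1 /\
  vdual_pr2 (vdual_core_incl w) = (w.1, fun=> 0).
Proof.
case: w => m f [/= Mm fl fe]; have A0 := vzero_carrier VS1 Mm.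
have [fD fZ] := fl; have f0 := vb_is_fib V1 A0.
have qz : q1 (zS1 m) = m by exact: vpr_vzero.
have pm x : vfib (dstr1 D) (zS1 m) x -> vfib (dstrS2 D) m (p2 x).
  by move=> [Dx x0]; split; [exact: vpr_carrier|rewrite -(dsquare HD)// x0].
have ud : carrier (vdual_tot D) (vdual_core_incl ((m, f) : dual_mfd (dstrS2 D))).
  split=> //=; last exact: ext0_id.
  split=> [x y xa ya|t x xa].
    have [Dx xe] := xa; have [Dy ye] := ya.
    rewrite !ext0E//; last exact: vfibD.
    by rewrite (p2_add1 HD) ?xe// fD//; exact: pm.
  have [Dx xe] := xa; rewrite !ext0E//; last exact: vfibZ.
  by rewrite (p2_s1 HD)// fZ//; exact: pm.
have pr : vdual_pr2 (vdual_core_incl ((m, f) : dual_mfd (dstrS2 D))) = (m, fun=> 0).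
  rewrite /vdual_pr2 /= qz; congr pair; apply/funext => c.
  rewrite /ext0 /patch; case: ifPn => //; rewrite inE => Cc.
  have Cc' : vfib (core_str D) (q1 (zS1 m)) c by rewrite qz.
  have [ca cb] := core_at_vfib A0 Cc'.
  by case: ifPn => // _; rewrite cb qz (linear_on0 (vb_is_fib VS2 Mm)).
split=> //; split=> //; split.
  by rewrite /= /dpr /= qz.
by rewrite [LHS]pr /dpr /= qz.
Qed.

Lemma core_incl_bij : fiberwise_linear_bij (dual_str (dstrS2 D)) (acorestr B)
  (@vdual_core_incl R D).
Proof.
split.
- split.
  + by move=> w Dw; have [] := core_incl_core Dw.
  + move=> [m f] [m' g]; rewrite !inE => -[/= Mm fl fe] [/= Mm' gl ge] [ez ef].
    have em : m = m' by rewrite -(vpr_vzero VS1 Mm) ez vpr_vzero.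
    rewrite -{m'}em in gl ge ez ef Mm' *; congr pair; apply: (ext0_inj fe ge) => b [Bb bm].
    have [Dz zb] := vfib0 (vb_is_fib V2 Bb).
    have z0 : vfib (dstr1 D) (zS1 m) (z2 b) by split=> //; rewrite (p1_z2 HD)// bm.
    have := congr1 (fun k => k (z2 b)) ef.
    by rewrite /= !ext0E// zb.
  + move=> [a f] [[/= Aa fl fe] [/= ea ek]].
    set m := q1 a; have ea' : a = zS1 m by [].
    have Mm : carrier (dbase D) m by exact: vpr_carrier.
    have fa := vb_is_fib V1 Aa.
    have [fD fZ] := fl.
    have zf b : vfib (dstrS2 D) m b -> vfib (dstr1 D) a (z2 b).
      by move=> [Bb bm]; split; [exact: vzero_carrier|rewrite (p1_z2 HD)// bm ea'].
    have fm := vb_is_fib VS2 Mm.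
    exists (m, ext0 (vfib (dstrS2 D) m) (fun b => f (z2 b))).
      split=> //=; last exact: ext0_id.
      split=> [b b' bm bm'|t b bm].
        rewrite !ext0E//; last exact: vfibD.
        have [Bb qb] := bm; have [Bb' qb'] := bm'.
        by rewrite (z2_addS) ?qb// fD//; exact: zf.
      rewrite !ext0E//; last exact: vfibZ.
      by have [Bb qb] := bm; rewrite (z2_sS)// fZ//; exact: zf.
    rewrite /vdual_core_incl /= -ea'; congr pair; rewrite [RHS]fe.
    apply: ext0_ext => x xa; have x0 : vfib (dstr1 D) (zS1 m) x by rewrite -ea'.
    have [zx xm] := z2_over_zero Mm x0; have Cx := core_part_vfib Mm x0.
    have [Dx _] := xa; rewrite ext0E; last by split=> //; exact: vpr_carrier.
    have /(core_vfib)[Dc c1 c2 _] := Cx.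
    rewrite -{2}(core_partK Mm x0) fD; [|by rewrite ea'|by split=> //; rewrite c1].
    (* Belonging to the core of the vertical dual means vanishing on D_3; hence [f] depends on the
       second projection only and comes from D_2^*. *)
    have -> : f (core_part x) = 0.
      have := congr1 (fun k => k.2 (core_part x)) ek; rewrite /= ext0E; last exact: Cx.
      by rewrite {1}ea' (core_at_zero).
    by rewrite addr0.
- by move=> w Dw; have [_ [e _]] := core_incl_core Dw; exact: e.
- move=> [m f] [m' g] [/= Mm _ _] _ em; rewrite -em.
  rewrite /vdual_core_incl /=; congr pair; apply/funext => x.
  by rewrite /ext0 /patch; case: ifPn => _; rewrite ?addr0.
- move=> t [m f] _; rewrite /vdual_core_incl /=; congr pair; apply/funext => x.
  by rewrite /ext0 /patch; case: ifPn => _; rewrite ?mulr0.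
Qed.

Lemma restr_to_A2_bij : fiberwise_linear_bij (dual_str (dstrS2 D)) (acorestr As)
  (restr_to_A2 l1 l2).
Proof.
have ah m y : afib (astrS2 A) m y <-> hyperplane (dstrS2 D) m l2 y.
  exact: afibS2P.
split.
- split.
  + move=> [m f] [/= Mm fl fe]; split=> //=; last exact: ext0_id.
    have fm := vb_is_fib VS2 Mm.
    move=> t x y /ah xa /ah ya; rewrite !ext0E; [|exact/ah|exact/ah|].
      exact: (linear_affine fm fl (l := l2) t xa ya).
    exact/ah/(hyperplane_aff fm (l2_linear Mm)).
  + move=> [m f] [m' g]; rewrite !inE => -[/= Mm fl fe] [/= Mm' gl ge] [em ef].
    rewrite /= in em; rewrite -{m'}em in gl ge ef Mm' *; congr pair.
    have [y0 H0] := l2_hyperplane Mm; have fm := vb_is_fib VS2 Mm.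
    apply: (ext0_inj fe ge).
    apply: (linear_hyperplane_unique fm (l2_linear Mm) H0 fl gl) => y /ah ya.
    have := congr1 (fun k => k y) ef.
    by rewrite /= !ext0E.
  + move=> [m f] [/= Mm fa fe]; have fm := vb_is_fib VS2 Mm.
    have [y0 H0] := l2_hyperplane Mm.
    have faH : affine_on_hyperplane (dstrS2 D) m l2 f.
      by move=> t x y Hx Hy; apply: fa; exact/ah.
    have [g [gD gZ] gf] := affine_extension fm (l2_linear Mm) H0 faH.
    exists (m, ext0 (vfib (dstrS2 D) m) g).
      split=> //=; last exact: ext0_id.
      split=> [x y xa ya|t x xa]; rewrite !ext0E ?gD ?gZ//.
        exact: vfibD.
      exact: vfibZ.
    rewrite /restr_to_A2 /=; congr pair; rewrite [RHS]fe; apply: ext0_ext => y /ah Hy.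
    by have [yb _] := Hy; rewrite ext0E// gf.
- by [].
- move=> [m f] [m' g] _ _ em; rewrite /= in em; rewrite -em.
  rewrite /restr_to_A2 /=; congr pair; apply/funext => x.
  by rewrite /ext0 /patch; case: ifPn => _; rewrite ?addr0.
- move=> t [m f] _; rewrite /restr_to_A2 /=; congr pair; apply/funext => x.
  by rewrite /ext0 /patch; case: ifPn => _; rewrite ?mulr0.
Qed.

(** In [B] the core acts through the sum over D_3^* of the zero functional [o] at [u.1] and the
    image of [w]. Evaluated at [x], written as [x] plus [z2 (p2 x)] over D_2, this sum is
    [w.2 (p2 x)], which is the action on the affine side. *)
Lemma restr_to_A_core_action (w : dual_mfd (dstrS2 D)) (u : atot B) :
  carrier (dual_mfd (dstrS2 D)) w -> carrier (atot B) u -> w.1 = q1 u.1 ->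
  F (atr (d := B) (vdual_core_incl w) u) =
  atr (d := As) (restr_to_A2 l1 l2 w) (F u).
Proof.
move=> Dw /carrierB[Du u1 us] wu; have [Au ul ue] := Du.
have [Cw [dw pw]] := core_incl_core Dw; have [Dc _] := Cw.
have [Mm wl we] := Dw.
have fu := vb_is_fib V1 Au; have fm := vb_is_fib VS1 Mm.
pose o : vdual_tot D := vzero (dual_str (dstr1 D)) u.1.
have Do : carrier (vdual_tot D) o.
  split=> //=; first by split=> *; rewrite ?addr0 ?mulr0.
  by apply/funext => x; rewrite /ext0 /patch; case: ifPn.
have op : vdual_pr2 o = vdual_pr2 (vdual_core_incl w : vdual_tot D).
  rewrite pw /vdual_pr2 /= -wu; congr pair; apply/funext => x.
  by rewrite /ext0 /patch; case: ifPn.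
have [wd_add _ _] := vdual_is_well_defined.
have [s [sP _]] := wd_add _ _ Do Dc op.
have es : core_at (D := vdual D) u.1 (vdual_core_incl w) = s.
  by apply: the_eq sP; exact: wd_add.
have -> : atr (d := B) (vdual_core_incl w) u = (u.1, fun x => u.2 x + s.2 x).
  by rewrite /= -es.
rewrite /F /restr_to_A /=; congr pair; apply: ext0_ext => x xa.
have /afib1P[xv _ x2] := xa; have [Dx xe] := xv.
have Bx : carrier (dside2 D) (p2 x) by exact: vpr_carrier.
have xm : q2 (p2 x) = w.1 by rewrite -(dsquare HD)// xe wu.
have x2m : afib (astrS2 A) w.1 (p2 x) by apply/afibS2P.
rewrite (ext0E _ xa) (ext0E _ x2m); congr (_ + _).
have [Dz zb] := vfib0 (vb_is_fib V2 Bx).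
have z0 : vfib (dstr1 D) (zS1 w.1) (z2 (p2 x)) by split=> //; rewrite (p1_z2 HD)// xm.
have [_ _ sE] := sP; have := sE x (z2 (p2 x)) xv z0 (esym zb).
by rewrite (vaddx0 (vpr_fib V2 Dx))// => ->; rewrite /= add0r ext0E// zb.
Qed.

(** * Adapted frames and smoothness of the restriction map *)

Lemma adapted_frame a0 : carrier (dside1 D) a0 ->
  exists n r (c : chart R (dside1 D) n) (e : 'I_r -> dside1 D -> dtot D),
  [/\ admissible c, c.1 a0, smooth_frame (dstr1 D) c.1 e &
      forall a i, c.1 a -> l2 (p2 (e i a)) = 1].
Proof.
move=> Aa0.
have [n [r [c [h [pt [lt ca0]]]]]] := vb_triv V1 Aa0.
have ac := lt_base lt.
pose la i a := l2 (p2 (pt a (delta_mx 0 i))).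
have ptP a v : c.1 a -> vfib (dstr1 D) a (pt a v) /\ h (pt a v) = v.
  by move=> ca; exact: (lt_pt lt v ca).
have lin a : c.1 a -> linear_on (dstr1 D) a (l2 \o p2).
  by move=> ca; apply: (l2p2_linear); exact: admissible_sub ca.
have laE a x : c.1 a -> vfib (dstr1 D) a x -> l2 (p2 x) = \sum_i h x 0 i * la i a.
  move=> ca xa; apply: (fc_linear (lt_fib lt ca) _ (lin a ca) xa) => i; exact: ptP.
have sla a i : c.1 a -> lsmR c (la i) a.
  move=> ca.
  have s0 : lsm c (tchart (dstr1 D) c h) (fun a => pt a (delta_mx 0 i)) a.
    by apply: (lsm_pt lt (lsm_id c a)) => j; exact: lsmR_cst.
  have [[De ea] _] := ptP a (delta_mx 0 i) ca.
  have te : (tchart (dstr1 D) c h).1 (pt a (delta_mx 0 i)) by split=> //=; rewrite ea.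
  have [_ sp] := smooth_vpr V2; have [sl _ _] := l2_nz.
  have s1_ : lsmR (tchart (dstr1 D) c h) (l2 \o p2) (pt a (delta_mx 0 i)).
    apply: (smooth_on_smooth_fun (vb_total V1) (vb_base V2) sp) => //.
      exact: vpr_carrier.
    exact: tchart_admissible lt.
  exact: (lsmR_comp ca s0 s1_).
have [i0 la0] : exists i, la i a0 != 0.
  apply: contrapT => nla; have [x0 [x0a x01]] := l2p2_hyperplane Aa0.
  have := laE a0 x0 ca0 x0a; rewrite -[l2 _]/((l2 \o p2) x0) x01 big1.
    by move/eqP; rewrite oner_eq0.
  by move=> i _; have [->|li] := eqVneq (la i a0) 0; [rewrite mulr0|case: nla; exists i].
have [c' [ac' c'a0 ec ce]] := restrict_chart (vb_base V1) ac ca0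
  (lsmR_neq0 ca0 (sla a0 i0 ca0) la0).
(* The i-th basis vector, corrected along i0 so that l2 takes the value 1; for
   i = i0 this is the basis vector divided by la i0. *)
pose w i a : 'rV[R]_r := delta_mx 0 i + ((1 - la i a) / la i0 a) *: delta_mx 0 i0.
have sla' a i : c'.1 a -> lsmR c' (la i) a.
  move=> c'a; apply: (lsmR_res (c := c)) => //; first by move=> y /ce[].
  by apply: sla; have [] := ce a c'a.
have sw a i j : c'.1 a -> lsmR c' (fun y => w i y 0 j) a.
  move=> c'a; have [ca lan] := ce a c'a.
  apply: (@lsmR_ext _ _ _ _ _ (fun y => (delta_mx 0 i : 'rV[R]_r) 0 j +
    ((1 + (-1) * la i y) * (la i0 y)^-1) * (delta_mx 0 i0 : 'rV[R]_r) 0 j)).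
    by move=> y _; rewrite !mxE mulN1r.
  apply: lsmRD; first exact: lsmR_cst.
  apply: lsmRM; last exact: lsmR_cst.
  apply: lsmRM; last by apply: lsmRV => //; exact: sla'.
  apply: lsmRD; first exact: lsmR_cst.
  by apply: lsmRM; [exact: lsmR_cst|exact: sla'].
have uw a : c'.1 a -> \matrix_i w i a \in unitmx.
  move=> c'a; have [ca lan] := ce a c'a.
  pose u : 'cV[R]_r := \col_i ((1 - la i a) / la i0 a).
  pose d : 'rV[R]_r := delta_mx 0 i0.
  have wE : \matrix_i w i a = 1%:M + u *m d.
    by apply/matrixP => i j; rewrite !mxE big_ord1 !mxE eqxx eq_sym.
  have du : d *m u = (1 / la i0 a - 1)%:M.
    apply/matrixP => i j; rewrite !ord1 !mxE (bigD1 i0)//= big1 ?addr0.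
      by rewrite !mxE !eqxx /= mul1r mulr1n; field.
    by move=> k /negbTE ki0; rewrite !mxE ki0 andbF mul0r.
  (* The Sherman-Morrison formula: the matrix is [1 + u d] with [1 + d u = 1 / la i0 a], so its
     inverse is [1 - la i0 a *: (u d)]. *)
  have : \matrix_i w i a *m (1%:M - la i0 a *: (u *m d)) = 1%:M.
    set X := u *m d in wE *; have XX : X *m X = (1 / la i0 a - 1) *: X.
      by rewrite /X mulmxA -(mulmxA u) du mul_mx_scalar scalemxAl.
    rewrite wE mulmxBr mulmx1 -scalemxAr mulmxDl mul1mx XX.
    rewrite -[X in _ - _ *: (X + _)]scale1r -scalerDl scalerA.
    rewrite (_ : la i0 a * _ = 1) ?scale1r ?addrK//.
    by rewrite addrC subrK mulrC divfK.
  by case/mulmx1_unit.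
have [se fe] := triv_frame V1 lt ac' (fun y c'y => (ce y c'y).1) sw uw.
exists n, r, c', (fun i a => pt a (w i a)); split=> // a i c'a.
have [ca lan] := ce a c'a; have [xa hx] := ptP a (w i a) ca.
rewrite (laE a)// hx.
rewrite (eq_bigr (fun k => (k == i)%:R * la k a +
  (k == i0)%:R * ((1 - la i a) / la i0 a * la k a))); last first.
  by move=> k _; rewrite !mxE eqxx /=; ring.
rewrite big_split/= (bigD1 i)//= big1 => [|k /negbTE->]; last by rewrite mul0r.
rewrite (bigD1 i0)//= big1 => [|k /negbTE->]; last by rewrite mul0r.
by rewrite !eqxx !addr0 !mul1r divfK// addrC subrK.
Qed.

Let A1 := [set a : dside1 D | l1 a = 1].

(** The chart is a slice chart of A_1, shrunk so that it carries the frame. Affine functions with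
    prescribed values on the frame exist and are unique because they are restrictions of linear
    ones. *)
Lemma adapted_pair a0 : carrier (dside1 D) a0 -> l1 a0 = 1 ->
  exists k q r (d : chart R (dside1 D) (k + q)) (e : 'I_r -> dside1 D -> dtot D),
  [/\ admissible d, is_slice A1 d, d.1 a0, smooth_frame (dstr1 D) d.1 e &
      smooth_affine_frame (astr1 A) (slice A1 d).1 e].
Proof.
move=> Aa0 a01.
have [k [q [d0 [ad0 sd0 d0a]]]] := level_slice VS1 l1_nz Aa0 a01.
have [n [r [c [e [ac ca [se fe] le]]]]] := adapted_frame Aa0.
have [d [ad da ed de]] := restrict_chart (vb_base V1) ad0 d0a
  (admissible_lsm (vb_base V1) ad0 ac d0a ca).1.
have dc a : d.1 a -> c.1 a by move=> /de[].
have sd : is_slice A1 d by move=> a /de[d0a' _]; rewrite ed; exact: sd0.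
have sde i : smooth_on d.1 (e i).
  by move=> a Da d1 m c' ac' c'a n' d' ad' d'e; apply: se => //; exact: dc.
have Ae a i : (slice A1 d).1 a -> afib (astr1 A) a (e i a).
  move=> [/dc ca' a1]; apply/afib1P; split=> //; last exact: le.
  by have [+ _] := fe a ca'; apply.
exists k, q, r, d, e; split=> //.
  by split=> // a /dc; exact: fe.
split.
  move=> i; apply: sub_smooth_on => a Da a1 [da' _] k' q' c' ac' sc' c'a n' e' ae' e'a.
  case: n' e' / ae' e'a => k2 q2 e' ae' se' [e'a _].
  have s0 := lsm_slice_source a sc'.
  have s1_ : lsm c' d id a := admissible_lsm (vb_base V1) ac' ad c'a da'.
  have ca' : (slice A1 c').1 a by split.
  apply: lsm_slice_target.
    apply: (lnear_imp _ (lsm_comp ca' s0 s1_).1) => y [c'y y1] dy.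
    by have [[]] := Ae y i (conj dy y1).
  apply: (lsm_comp ca' s0 (g := e i)).
  exact: (smooth_on_lsm (vb_base V1) (vb_total V1) (sde i) ac' ae' c'a da' e'a).
move=> a [da' a1]; have Aa := admissible_sub ad da'; have fa := vb_is_fib V1 Aa.
split; first by move=> i; exact: Ae.
move=> v; have [ea fea] := fe a (dc a da').
have [f fl fv] := frame_functional fa ea fea v.
have fE i : ext0 (afib (astr1 A) a) f (e i a) = v i.
  by rewrite (ext0E f (Ae a i (conj da' a1))).
exists (a, ext0 (afib (astr1 A) a) f); split.
  split=> //; split=> //=; last exact: ext0_id.
  move=> t x y xa ya; rewrite (ext0E f xa) (ext0E f ya).
  have Hx := (afib1_hyperplane x a1).1 xa.
  have Hy := (afib1_hyperplane y a1).1 ya.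
  have Hxy := hyperplane_aff fa (l2p2_linear Aa) t Hx Hy.
  rewrite (ext0E f ((afib1_hyperplane _ a1).2 Hxy)).
  exact: (linear_affine fa fl (l := l2 \o p2) t Hx Hy).
move=> [a' g] [[/= _ ga ge] ea' gv]; rewrite ea' in ga ge gv; rewrite ea'; congr pair.
apply: (ext0_inj (ext0_id _ f) ge) => x xa; rewrite (ext0E f xa).
have [x0 H0] := l2p2_hyperplane Aa.
have gaH : affine_on_hyperplane (dstr1 D) a (l2 \o p2) g.
  by move=> t y z Hy Hz; apply: ga; apply/(afib1_hyperplane _ a1).
have [g' gl' gg'] := affine_extension fa (l2p2_linear Aa) H0 gaH.
have /afib1P[xv _ _] := xa.
rewrite -(gg' x); last exact: (afib1_hyperplane x a1).1 xa.
apply: (frame_linear_eq fa ea fea fl gl') => // i.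
have Ha := (afib1_hyperplane _ a1).1 (Ae a i (conj da' a1)).
by rewrite (gg' _ Ha) gv fv.
Qed.

Let SB : set (vdual_tot D) :=
  [set u | l1 u.1 = 1 /\ eval_section sigma (vdual_pr2 u) = 1].
Let SA := @adual_set R A sigma.

(** The slice charts at both ends come from arbitrary admissible charts of the ambient duals, which
    are comparable only with charts of the atlases; hence the passage through [dchart] and [gchart]
    over a common frame. *)
Lemma restr_to_A_smooth : smooth_map F.
Proof.
split; first by move=> u; exact: restr_to_A_carrier.
apply: sub_smooth_on => u Du [u1 us] _ k q d ad sd du n e ae eu.
case: n e / ae eu => k' q' d' ad' sd' [d'u _].
have [Au ul ue] := Du.
have [k2 [q2 [r [c [e [ac sc ca se sae]]]]]] := adapted_pair Au u1.
have fib_c a : c.1 a -> is_fib (dstr1 D) a.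
  by move=> ca'; apply: (vb_is_fib V1); exact: admissible_sub ca'.
have sdu : (slice SB d).1 u by split.
have Bu : carrier (atot B) u by split.
have DCa := dchart_atlas ac se.
have DCi := dchart_inj (admissible_inj ac) se fib_c.
have s1_ : lsm (slice SB d) (dchart (V := dstr1 D) c e) id u.
  have cu : (dchart (V := dstr1 D) c e).1 u by split.
  have s0 : lsm d (dchart (V := dstr1 D) c e) id u := admissible_to_atlas ad DCa du cu.
  exact: (lsm_comp sdu (lsm_slice_source u sd) s0).
have [f1 f2] := lsm_fst (fun u => \row_i u.2 (e i u.1)) u
  (fun u (h : (dual_set (dstr1 D) `&` [set u | c.1 u.1]) u) => h.2).
have sfst : lsm (slice SB d) (slice A1 c) fst u.
  apply: lsm_slice_target; first by apply: lnear_all => y [_ []].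
  exact: (lsm_comp sdu s1_ f1).
pose c1 : chart R (aside1 A) k2 := slice A1 c.
have sB y : (slice SB d).1 y -> carrier (atot B) y.
  by move=> [dy Sy]; split=> //; exact: admissible_sub dy.
have sG : lsm (slice SB d) (gchart (P := astr1 A) c1 e) F u.
  apply: lsm_gchart.
  - by apply: lnear_all => y /sB By; have [] := restr_to_A_carrier By.
  - exact: sfst.
  - move=> i; apply: (lsmR_near (g := fun y : vdual_tot D => y.2 (e i y.1))).
      apply: (lnear_imp _ sfst.1) => y _ cy.
      by apply: (restr_to_A_val (u := y)); have [+ _] := sae.2 _ cy; apply.
    have := lsmR_comp sdu s1_ (f2 i); apply: lsmR_ext => y _.
    by rewrite /= mxE.
have ac1 : @admissible R (sub_mfd A1) k2 c1 := slice_admissible (vb_base V1) ac sc.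
have GCa : atlas (dagger_mfd (astr1 A)) (gchart (P := astr1 A) c1 e) by exact: DaggerChart.
have GCi := gchart_inj (admissible_inj ac1) sae.
have Gu : (gchart (P := astr1 A) c1 e).1 (F u).
  by split; [have [] := restr_to_A_carrier Bu|split].
apply: lsm_slice_target.
  by apply: lnear_all => y /sB By; have [] := restr_to_A_carrier By.
have s2_ : lsm (gchart (P := astr1 A) c1 e) d' id (F u) :=
  @atlas_to_admissible R (dagger_mfd (astr1 A)) _ d' _ _ _ GCi ad' GCa d'u Gu.
exact: (lsm_comp sdu sG s2_).
Qed.

(** Stated for any right inverse, so that one obtained by choice can be used: the equation
    [F (G v) = v] determines the values of [G v] on the frame. *)
Lemma restr_to_A_inv_smooth (G : atot As -> atot B) :
  (forall v, carrier (atot As) v -> carrier (atot B) (G v) /\ F (G v) = v) ->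
  smooth_map G.
Proof.
move=> GP; split; first by move=> v /GP[].
apply: sub_smooth_on => v Dv vs _ k q d ad sd dv n e ae ev.
case: n e / ae ev => k' q' d' ad' sd' [d'v _].
have Av : carrier (atot As) v by split.
have [BG FG] := GP v Av; have [[Aa a1] _ _] := Dv.
have [k2 [q2 [r [c [e [ac sc ca se sae]]]]]] := adapted_pair Aa a1.
have fib_c a : c.1 a -> is_fib (dstr1 D) a.
  by move=> ca'; apply: (vb_is_fib V1); exact: admissible_sub ca'.
have sdv : (slice SA d).1 v by split.
have DCa := dchart_atlas ac se.
have DCi := dchart_inj (admissible_inj ac) se fib_c.
pose c1 : chart R (aside1 A) k2 := slice A1 c.
have ac1 : @admissible R (sub_mfd A1) k2 c1 := slice_admissible (vb_base V1) ac sc.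
have GCa : atlas (dagger_mfd (astr1 A)) (gchart (P := astr1 A) c1 e) by exact: DaggerChart.
have cv : c1.1 v.1 by split.
have s1_ : lsm (slice SA d) (gchart (P := astr1 A) c1 e) id v.
  have gv : (gchart (P := astr1 A) c1 e).1 v by split.
  have s0 : lsm d (gchart (P := astr1 A) c1 e) id v := admissible_to_atlas ad GCa dv gv.
  exact: (lsm_comp sdv (lsm_slice_source v sd) s0).
have [f1 f2] := lsm_fst (fun u => \row_i u.2 (e i u.1)) v
  (fun u (h : (dagger_set (astr1 A) `&` [set u | c1.1 u.1]) u) => h.2).
have sfst : lsm (slice SA d) c1 fst v by exact: (lsm_comp sdv s1_ f1).
have sA y : (slice SA d).1 y -> carrier (atot As) y.
  by move=> [dy Sy]; split=> //; exact: admissible_sub dy.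
have G1 y : (slice SA d).1 y -> (G y).1 = y.1.
  by move=> /sA Ay; have [_ e1] := GP y Ay; rewrite -[in RHS]e1.
have sD : lsm (slice SA d) (dchart (V := dstr1 D) c e) G v.
  apply: lsm_dchart.
  - by apply: lnear_all => y /sA Ay; have [[]] := GP y Ay.
  - apply: (lsm_ext (g := fst)); first by move=> y /G1.
    exact: (lsm_comp sdv sfst (lsm_slice_source _ sc)).
  - move=> i; apply: (lsmR_near (g := fun y : dagger_mfd (astr1 A) => y.2 (e i y.1))).
      apply: (lnear_imp _ sfst.1) => y sy cy; rewrite G1//.
      have [_ e1] := GP y (sA y sy).
      have ye : afib (astr1 A) y.1 (e i y.1) by have [+ _] := sae.2 _ cy; apply.
      have Fv : (F (G y)).2 (e i y.1) = (G y).2 (e i y.1).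
        by apply: (restr_to_A_val (u := G y)); rewrite G1.
      by rewrite -Fv e1.
    have := lsmR_comp sdv s1_ (f2 i); apply: lsmR_ext => y _.
    by rewrite /= mxE.
apply: lsm_slice_target.
  by apply: lnear_all => y /sA Ay; have [[]] := GP y Ay.
have Dv' : (dchart (V := dstr1 D) c e).1 (G v).
  by have [[D1 _] _] := GP v Av; split=> //=; rewrite (G1 v sdv); case: cv.
have s2_ : lsm (dchart (V := dstr1 D) c e) d' id (G v) :=
  @atlas_to_admissible R (dual_mfd (dstr1 D)) _ d' _ _ _ DCi ad' DCa d'v Dv'.
exact: (lsm_comp sdv sD s2_).
Qed.

Lemma restr_to_A_diffeo : diffeo F.
Proof.
split; first exact: restr_to_A_smooth.
have exG (v : atot As) : exists u : atot B, carrier (atot As) v ->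
    carrier (atot B) u /\ F u = v.
  have [Av|nAv] := pselect (carrier (atot As) v).
    by have [u Bu Fu] := restr_to_A_surj Av; exists u.
  by exists (v.1, fun=> 0).
have [G GP] := choice exG; exists G; split.
- exact: restr_to_A_inv_smooth.
- move=> u Bu; have Av := restr_to_A_carrier Bu.
  by have [BG FG] := GP _ Av; exact: (restr_to_A_inj BG Bu FG).
- by move=> v /GP[].
Qed.

(** * The distinguished sections of the cores *)

Lemma section_of_fun_carrier m : carrier (dbase D) m ->
  dual_set (dstrS2 D) (section_of_fun l2 m).
Proof.
move=> Mm; have fm := vb_is_fib VS2 Mm; have [lD lZ] := l2_linear Mm.
split=> //; last exact: ext0_id.
split=> [x y xm ym|t x xm]; rewrite /= !ext0E ?lD ?lZ//.
  exact: vfibD.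
exact: vfibZ.
Qed.

Lemma section_of_fun_nonvanishing :
  nonvanishing_section (dual_str (dstrS2 D)) (section_of_fun l2).
Proof.
have mM := vb_base VS2.
split; last first.
  move=> m Mm; split=> //.
  have [_ _ /(_ m Mm)[y [ym ly]]] := l2_nz.
  move=> /(congr1 (fun u => u.2 y)) /=.
  by rewrite (ext0E l2 ym).
split; first exact: section_of_fun_carrier.
apply: manifold_smooth_on => // m Mm _ p c ac cm n d ad dm.
case: n d / ad dm => k r d e ad se [_ /= d1].
have s0 : lsm c d id m := admissible_lsm mM ac ad cm d1.
apply: lsm_dchart.
- by apply: lnear_all => y cy; exact: (section_of_fun_carrier (admissible_sub ac cy)).
- exact: s0.
move=> i; apply: (lsmR_near (g := fun y => l2 (e i y))).
  apply: lnear_imp s0.1 => y cy dy /=.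
  by rewrite ext0E//; have [+ _] := se.2 y dy; apply.
have sl : lsmR d (l2 \o e i) m.
  have [sl _ _] := l2_nz; have [/(_ i)[Ee _] _] := se.2 m d1.
  by apply: (smooth_on_smooth_fun mM (vb_total VS2) (se.1 i)).
exact: (lsmR_comp cm s0 sl).
Qed.

Lemma core_section_nonvanishing :
  nonvanishing_section (core_str (vdual D))
    (fun m => vdual_core_incl (section_of_fun l2 m)).
Proof.
have mM := vb_base VS1.
have cm m (Mm : carrier (dbase D) m) :=
  core_incl_core (section_of_fun_carrier Mm : carrier (dual_mfd (dstrS2 D)) _).
split; last first.
  move=> m Mm; have [Cm [dm _]] := cm m Mm; split; first exact: dm.
  have [_ _ /(_ m Mm)[y [[By ym] ly]]] := l2_nz.
  (* The functional is nonzero at [z2 y], which lies over the zero of D_1 and projects to [y], where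
     [l2] does not vanish. *)
  have [Dz zy] := vfib0 (vb_is_fib V2 By).
  have z0 : vfib (dstr1 D) (zS1 m) (z2 y) by split=> //; rewrite (p1_z2 HD)// ym.
  move=> /(congr1 (fun u => u.2 (z2 y))) /=.
  by rewrite (ext0E _ z0) zy ext0E.
split; first by move=> m /cm[].
apply: manifold_smooth_on => // m Mm _ p c ac cm0 n d ad dm.
case: n d / ad dm => k q d ad sd [dm _].
have A0 := vzero_carrier VS1 Mm.
have [n1 [r [c1 [h [pt [lt c1z]]]]]] := vb_triv V1 A0.
(* No adapted frame is called for: the admissible chart [d] is compatible with the dual chart of
   every smooth frame. *)
have se := triv_basis_frame V1 lt; have ac1 := lt_base lt.
pose e i b := pt b (delta_mx 0 i : 'rV[R]_r).
have fib_c a : c1.1 a -> is_fib (dstr1 D) a.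
  by move=> ca; apply: (vb_is_fib V1); exact: admissible_sub ca.
have DCa := dchart_atlas ac1 se.
have DCi := dchart_inj (admissible_inj ac1) se fib_c.
have s0 : lsm c c1 zS1 m := lsm_vzero VS1 ac ac1 cm0 c1z.
have gc y : c.1 y -> carrier (core (vdual D)) (vdual_core_incl (section_of_fun l2 y)).
  by move=> cy; have [] := cm y (admissible_sub ac cy).
have sD : lsm c (dchart (V := dstr1 D) c1 e)
    (fun y => vdual_core_incl (section_of_fun l2 y)) m.
  apply: lsm_dchart.
  - by apply: lnear_all => y /gc[].
  - exact: s0.
  move=> i; apply: (lsmR_near (g := fun y => l2 (p2 (e i (zS1 y))))).
    apply: lnear_imp s0.1 => y cy c1y; have [ey _] := lt_pt lt (delta_mx 0 i) c1y.
    have [De e1] := ey; rewrite /= (ext0E _ ey) ext0E//.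
    split; first exact: vpr_carrier.
    rewrite -(dsquare HD)// e1 vpr_vzero//; exact: admissible_sub cy.
  have s1_ : lsm c1 (tchart (dstr1 D) c1 h) (e i) (zS1 m).
    by apply: (lsm_pt lt (lsm_id c1 _)) => j; exact: lsmR_cst.
  have [[De e1] _] := lt_pt lt (delta_mx 0 i) c1z.
  have te : (tchart (dstr1 D) c1 h).1 (e i (zS1 m)) by split=> //=; rewrite e1.
  have [_ sp] := smooth_vpr V2; have [sl _ _] := l2_nz.
  have s2_ : lsmR (tchart (dstr1 D) c1 h) (l2 \o p2) (e i (zS1 m)).
    apply: (smooth_on_smooth_fun (vb_total V1) (vb_base V2) sp) => //.
      exact: vpr_carrier.
    exact: tchart_admissible lt.
  exact: (lsmR_comp cm0 (lsm_comp cm0 s0 s1_) s2_).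
apply: lsm_slice_target.
  by apply: lnear_all => y /gc[].
have Dm : (dchart (V := dstr1 D) c1 e).1 (vdual_core_incl (section_of_fun l2 m)).
  by split; [have [] := gc m cm0|].
have s3 : lsm (dchart (V := dstr1 D) c1 e) d id
    (vdual_core_incl (section_of_fun l2 m)) :=
  @atlas_to_admissible R (dual_mfd (dstr1 D)) _ d _ _ _ DCi ad DCa dm Dm.
exact: (lsm_comp cm0 sD s3).
Qed.

(** Two slice charts of D_3^* are compared through the dual chart of a smooth frame of the core,
    which [core_frame] provides around every point. *)
Lemma ddagger_id_smooth (S : set (dual_mfd (core_str D))) :
  @smooth_map R (sub_mfd S) (sub_mfd S) id.
Proof.
apply: sub_id_smooth => u [Mm ul ue] _.
have [n [k [c [e [ac cm se fc]]]]] := core_frame Mm.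
exists (n + k)%N, (dchart (V := core_str D) c e); split.
- exact: dchart_atlas.
- exact: dchart_inj (admissible_inj ac) se fc.
- by split.
Qed.

Lemma restr_section m : carrier (dbase D) m ->
  restr_to_A2 l1 l2 (section_of_fun l2 m) =
  dagger_one (astrS2 (dab_of_dvb l1 l2)) m.
Proof.
move=> Mm; rewrite /restr_to_A2 /dagger_one /=; congr pair.
apply: ext0_ext => y [[By y1] ym].
by rewrite ext0E.
Qed.

End Duality.

Theorem theorem4p2 (R : realType) (D : dvb R)
    (l1 : dside1 D -> R) (l2 : dside2 D -> R) (sigma : dbase D -> core D)
    (D_dvb : is_dvb D) (M_connected : connected_mfd (dbase D))
    (l1_nz : nonzero_linear_fun (dstrS1 D) l1)
    (l2_nz : nonzero_linear_fun (dstrS2 D) l2)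
    (sigma_nz : nonvanishing_section (core_str D) sigma) :
  let A : dab R := dab_of_dvb l1 l2 in
  let l3 : dside2 (vdual D) -> R := eval_section sigma in
  let B : dab R := @dab_of_dvb R (vdual D) l1 l3 in
  let As : dab R := @adual R A sigma in
  let F : atot B -> atot As := @restr_to_A R D l1 l2 sigma in
  [/\ (* both double affine bundles are well defined *)
      vdual_well_defined D /\ @adual_well_defined R A sigma,
      (* F is an isomorphism over the identities of A_1, D_3^\ddagger and M *)
      @dab_iso R B As F id id id,
      (* it induces on the cores the identification of D_2^* with A_2^\dagger *)
      [/\ fiberwise_linear_bij (dual_str (dstrS2 D)) (acorestr B)
            (@vdual_core_incl R D),
          fiberwise_linear_bij (dual_str (dstrS2 D)) (acorestr As)
            (restr_to_A2 l1 l2) &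
          forall (w : dual_mfd (dstrS2 D)) (u : atot B),
            carrier (dual_mfd (dstrS2 D)) w -> carrier (atot B) u ->
            w.1 = vpr (dstrS1 D) u.1 ->
            F (atr (d := B) (vdual_core_incl w) u) =
            atr (d := As) (restr_to_A2 l1 l2 w) (F u)] &
      (* l2 is a nowhere vanishing section of the core, corresponding to 1 *)
      [/\ nonvanishing_section (dual_str (dstrS2 D)) (section_of_fun l2),
          nonvanishing_section (acorestr B)
            (fun m => vdual_core_incl (section_of_fun l2 m)) &
          forall m, carrier (dbase D) m ->
            restr_to_A2 l1 l2 (section_of_fun l2 m) =
            dagger_one (astrS2 A) m]].
Proof.
move=> A l3 B As F.
have sA1 : @smooth_map R (aside1 A) (aside1 A) id.
  apply: sub_id_smooth => a Aa _.
  have [n [c [ac ca]]] := manifold_covered (vb_base (dvb1 D_dvb)) Aa.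
  exists n, c; split=> //.
  exact: admissible_inj (atlas_admissible (vb_base (dvb1 D_dvb)) ac).
split.
- split; first exact: vdual_is_well_defined.
  exact: adual_is_well_defined.
- split.
  + by split; [exact: restr_to_A_diffeo|exact: diffeo_id].
  + split; first exact/diffeo_id/ddagger_id_smooth.
    exact/diffeo_id/manifold_id_smooth/(vb_base (dvbS1 D_dvb)).
  + exact: restr_to_A_affine1.
  + exact: restr_to_A_affine2.
  + by [].
- split; [exact: core_incl_bij|exact: restr_to_A2_bij|exact: restr_to_A_core_action].
- split; [exact: section_of_fun_nonvanishing|exact: core_section_nonvanishing|].
  by move=> m Mm; exact: restr_section.
Qed.
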